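(* Let $t\ge 2$ be an integer. Then $ex(n,H_{3t+1}^{L^4_t})= t_{3t}^{4}(n)$ for all sufficiently large $n$. Moreover, if $n$ is sufficiently large and $G$ is a $4$-graph on $n$ vertices not containing $H_{3t+1}^{L^4_t}$ as a subgraph with $|G|=t_{3t}^{4}(n)$, then $G=T_{3t}^{4}(n)$ (up to isomorphism).
   Context: An $r$-graph is a vertex set with a family of $r$-element subsets (edges); $|G|$ is the number of edges. The linear star $L^r_t$ is the $r$-graph with $t$ edges all containing a common vertex $x$ and pairwise disjoint outside $\{x\}$ (so $L^4_t$ has $3t+1$ vertices). $ex(n,F)$ is the maximum number of edges of an $r$-graph on $n$ vertices not containing $F$. A pair of vertices is covered in a hypergraph if some edge contains both. For an $r$-graph $F$ ($r\ge3$) and $p\ge|V(F)|$, the extension $H_p^F$ is obtained as follows: label the vertices of $F$ as $v_1,\dots,v_{|V(F)|}$, add new vertices $v_{|V(F)|+1},\dots,v_p$, and for each pair $v_i,v_j$ ($1\le i<j\le p$) not covered in $F$ add a set $B_{ij}$ of $r-2$ new vertices and the edge $\{v_i,v_j\}\cup B_{ij}$, the $B_{ij}$ pairwise disjoint and disjoint from $\{v_1,\dots,v_p\}$. $T^r_m(n)$ is the $r$-graph on $n$ vertices with vertex set partitioned into $m$ parts with sizes differing by at most one and edges all $r$-sets meeting each part in at most one vertex; $t^r_m(n)=|T^r_m(n)|$. *)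

(* Defs.v *)
From mathcomp Require Import all_boot.
From mathcomp Require Import zify.

Set Implicit Arguments.
Unset Strict Implicit.
Unset Printing Implicit Defensive.

(* A hypergraph with vertex set the finite type V is given by its set of
   edges, of type {set {set V}}. *)

Definition uniform (r : nat) (V : finType) (G : {set {set V}}) : bool :=
  [forall e in G, #|e| == r].

(* F is a (not necessarily induced) subgraph of G, up to isomorphism. *)
Definition contains (V W : finType) (G : {set {set V}}) (F : {set {set W}}) :
    bool :=
  [exists f : {ffun W -> V},
     injectiveb f && [forall e in F, f @: e \in G]].

Definition isomorphic (V W : finType) (G : {set {set V}}) (H : {set {set W}}) :
    Prop :=
  exists2 f : V -> W, bijective f & H = [set f @: e | e : {set V} in G].

Definition ex_number (r n : nat) (W : finType) (F : {set {set W}}) : nat :=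
  \max_(G : {set {set 'I_n}} | uniform r G && ~~ contains G F) #|G|.

Section LinearStar.
Variables r t : nat.

(* None is the common vertex; the Some (i, j) are the r - 1 other vertices of
   the i-th edge. *)
Definition star_vertex : finType := option ('I_t * 'I_r.-1).

Definition star_edge (i : 'I_t) : {set star_vertex} :=
  None |: [set Some (i, j) | j : 'I_r.-1].

Definition linear_star : {set {set star_vertex}} := [set star_edge i | i : 'I_t].

Lemma card_star_vertex : #|{: star_vertex}| = r.-1 * t + 1.
Proof. by rewrite card_option card_prod !card_ord mulnC addn1. Qed.

End LinearStar.

Section Extension.
Variables (r p : nat) (W : finType) (F : {set {set W}}).

(* v_1, ..., v_p: the vertices of F and p - |V(F)| new ones.  The subtraction
   is truncated, so the construction is meant for |V(F)| <= p only. *)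
Definition core : finType := (W + 'I_(p - #|W|))%type.

Definition core_edges : {set {set core}} :=
  [set [set inl w | w in e] | e : {set W} in F].

Definition uncovered (P : {set core}) : bool :=
  (#|P| == 2) && ~~ [exists e in core_edges, P \subset e].

Definition uncovered_pair : finType := {P : {set core} | uncovered P}.

(* The vertices inr (P, k), k < r - 2, form the set B_ij for the uncovered pair
   P = {v_i, v_j}. *)
Definition ext_vertex : finType := (core + uncovered_pair * 'I_(r - 2))%type.

Definition ext_edge (P : uncovered_pair) : {set ext_vertex} :=
  [set inl v | v in val P] :|: [set inr (P, k) | k : 'I_(r - 2)].

Definition extension : {set {set ext_vertex}} :=
  [set [set inl v | v in e] | e : {set core} in core_edges]
  :|: [set ext_edge P | P : uncovered_pair].

End Extension.

(* The m parts are the residue classes mod m on {0, ..., n - 1}; by turan_parts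
   below, their sizes differ by at most one. *)
Definition turan (r m n : nat) : {set {set 'I_n}} :=
  [set e : {set 'I_n} | (#|e| == r) &&
     [forall u in e, forall v in e, (u == v %[mod m]) ==> (u == v)]].

Lemma turan_parts (m n i j : nat) : i < m -> j < m ->
  #|[set v : 'I_n | v %% m == i]| <= #|[set v : 'I_n | v %% m == j]|.+1.
Proof.
suff H k : k < m -> #|[set v : 'I_n | v %% m == k]| = n %/ m + (k < n %% m).
  by move=> im jm; rewrite !H //; lia.
move=> km; rewrite -sum1dep_card -(big_mkord (fun v => v %% m == k) (fun=> 1)).
elim: n => [|n IH]; first by rewrite big_geq // div0n mod0n ltn0.
have m0 : 0 < m by apply: leq_ltn_trans km.
rewrite big_mkcond big_nat_recr //= -big_mkcond IH /=.
have rm := ltn_pmod n m0.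
have En := divn_eq n m.
case: (ltngtP (n %% m).+1 m) => h; last first.
- have -> : n.+1 = (n %/ m).+1 * m by rewrite mulSn {1}En; lia.
  rewrite mulnK // modnMl; case: eqP; case: ltnP; lia.
- lia.
have E : n.+1 = n %/ m * m + (n %% m).+1 by rewrite {1}En; lia.
have -> : n.+1 %/ m = n %/ m by rewrite {1}E divnMDl // (divn_small h) addn0.
have -> : n.+1 %% m = (n %% m).+1 by rewrite {1}E modnMDl (modn_small h).
by case: eqP; case: ltnP; case: ltnP; lia.
Qed.

(* Main.v *)
(* Weighted (Lagrangian) symmetrization with stability. Put m = 3t and let
   lam x G be the sum over the edges of G of the product of vertex weights x.

   Call G star-clique-free if no linear star with t edges has all pairs of its 3t + 1
   vertices covered. When every pair of G is covered, the link of a vertex has no t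
   disjoint triples, and shifting the link bounds its Lagrangian by that of the complete
   3-graph on 3t - 1 vertices; equality would make G contain a forbidden star, so the
   heaviest vertex has degree bounded away from that of the complete m-partite 4-graph
   as soon as there are more than m vertices. Symmetrizing along uncovered pairs then
   gives lam x G <= binomial(m, 4) / m^4 for all star-clique-free G and total weight 1.

   Stability is proved by the same symmetrization run in small steps: when G is nearly
   m-partite for a weight x, all vertices of nearly full degree can be properly
   m-coloured (an edge inside a part, or a vertex adjacent to all parts, would create a
   star whose pairs are all covered), and such colourings are carried back from the
   symmetrized weight to x.

   For a 4-graph G on n vertices without the extension, deleting the edges that contain a
   pair of codegree O(n) makes it star-clique-free, since the sets B_ij can be chosen
   greedily. Stability then colours G up to o(n) vertices of low degree; recolouring those
   would strictly beat G if there were any, so G is m-partite, and among m-partite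
   4-graphs the balanced one is the unique optimum. *)

From mathcomp Require Import all_boot all_order all_algebra all_fingroup.
From mathcomp Require Import zify ring lra.
Require Import Defs.

Set Implicit Arguments.
Unset Strict Implicit.
Unset Printing Implicit Defensive.

(** * Product weights of edges, links, and Maclaurin's inequality *)

Section Weights.
Import Order.TTheory GRing.Theory Num.Theory.
Local Open Scope ring_scope.
Variables (R : realFieldType) (V : finType).
Implicit Types (x : V -> R) (e D S : {set V}) (G H P : {set {set V}}).

(** Weights are rational and no compactness is at hand, so an optimal weight need not exist a
    priori. The bound on [lam] is first proved for integer weights of fixed total N, where a maximum
    exists. Its first-order conditions hold only up to 1/N, an error absorbed by the gap eps,
    uniform in the hypergraph, between the degree of the heaviest vertex and [deg0]. The link of a
    vertex of weight al has total weight 1 - al, and the Lagrangian bound on it suffices only for al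
    >= 1/m. For smaller al the bound [capped3] takes over, which uses that no weight exceeds al. In
    the stability proof errors must not pile up over many small steps. A step costs at most eta/2,
    and recolouring turns a colouring with loss eta into one with loss eta/2, because the vertices
    it does not control have low degree and hence little total weight. The recolouring serves twice:
    for star-clique-free hypergraphs, and for the extension-free G itself. In G an edge covering one
    exceptional pair of a star is useful only if it avoids the other star vertices; the flag [h] of
    [norich] records this. *)

Definition wt x e : R := \prod_(v in e) x v.
Definition lam x G : R := \sum_(e in G) wt x e.
Definition tot x S : R := \sum_(v in S) x v.
Definition link G D := [set e : {set V} | [disjoint e & D] && (D :|: e \in G)].
Definition elsym x S k : R := lam x [set e : {set V} | (e \subset S) && (#|e| == k)].

Lemma wt_ge0 x e : (forall v, 0 <= x v) -> 0 <= wt x e.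
Proof. by move=> x0; apply: prodr_ge0 => v _. Qed.

Lemma lam_ge0 x G : (forall v, 0 <= x v) -> 0 <= lam x G.
Proof. by move=> x0; apply: sumr_ge0 => e _; apply: wt_ge0. Qed.

Lemma tot_ge0 x S : (forall v, 0 <= x v) -> 0 <= tot x S.
Proof. by move=> x0; apply: sumr_ge0. Qed.

Lemma wtU x e D : [disjoint e & D] -> wt x (e :|: D) = wt x e * wt x D.
Proof. move=> dj; rewrite /wt -bigU //; apply: eq_bigl => v; by rewrite !inE. Qed.

Lemma wt0 x : wt x set0 = 1.
Proof. by rewrite /wt big_set0. Qed.

Lemma wt1 x v : wt x [set v] = x v.
Proof. by rewrite /wt big_set1. Qed.

Lemma wtU1 x v e : v \notin e -> wt x (v |: e) = x v * wt x e.
Proof. by move=> ve; rewrite /wt big_setU1. Qed.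

Lemma eq_wt x y e : {in e, x =1 y} -> wt x e = wt y e.
Proof. by move=> xy; apply: eq_bigr => v ve; apply: xy. Qed.

Lemma le_wt x y e : (forall v, 0 <= x v <= y v) -> wt x e <= wt y e.
Proof. by move=> xy; apply: ler_prod => v _; apply: xy. Qed.

Lemma lamS x G H : (forall v, 0 <= x v) -> G \subset H -> lam x G <= lam x H.
Proof.
move=> x0 /subsetP GH; rewrite /lam [leRHS](big_setID G) /=.
rewrite (_ : H :&: G = G); last by apply/setIidPr/subsetP.
by rewrite lerDl sumr_ge0 // => e _; apply: wt_ge0.
Qed.

Lemma totS x S D : (forall v, 0 <= x v) -> S \subset D -> tot x S <= tot x D.
Proof.
move=> x0 SD; rewrite /tot [leRHS](big_setID S) /=.
rewrite (_ : D :&: S = S); last exact/setIidPr.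
by rewrite lerDl sumr_ge0.
Qed.

Lemma totD1 x S v : v \in S -> tot x S = x v + tot x (S :\ v).
Proof. by move=> vS; rewrite /tot (big_setD1 v). Qed.

Lemma le_tot x S v : (forall v, 0 <= x v) -> v \in S -> x v <= tot x S.
Proof. by move=> x0 vS; rewrite (totD1 _ vS) lerDl tot_ge0. Qed.

Lemma mem_link1 G v e : (e \in link G [set v]) = (v \notin e) && (v |: e \in G).
Proof. by rewrite inE disjoint_sym disjoints1. Qed.

Lemma lamID x G (P : pred {set V}) :
  lam x G = lam x [set e in G | P e] + lam x [set e in G | ~~ P e].
Proof.
rewrite /lam (bigID P) /=; congr (_ + _).
  by apply: eq_bigl => e; rewrite inE.
by apply: eq_bigl => e; rewrite inE.
Qed.

Lemma sum_link x G D : \sum_(e in G | D \subset e) wt x e = wt x D * lam x (link G D).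
Proof.
rewrite /lam big_distrr /= (reindex_onto (fun e => D :|: e) (fun e => e :\: D)) /=.
  apply: eq_big => [e|e].
    rewrite inE subsetUl andbT; have [dj|dj] := boolP [disjoint e & D]; last first.
      apply/andP => -[_ /eqP E]; move/negP: dj; apply.
      by rewrite -E setDUl setDv set0U -setI_eq0 -subset0 setDE -setIA (setIC _ D) setICr setI0.
    rewrite andbC /=; case: (_ \in G); rewrite ?andbF //= andbT.
    by rewrite setDUl setDv set0U; apply/eqP/setDidPl.
  move=> /andP [_ /eqP E]; rewrite wtU // -E.
  by rewrite setDUl setDv set0U -setI_eq0 -subset0 setDE setICA setICr setI0.
move=> e /andP [_ /subsetP De]; apply/setP => w; rewrite !inE.
by case: (boolP (w \in D)) => //= /De ->.
Qed.

Lemma lam_link1 x G v :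
  lam x G = x v * lam x (link G [set v]) + lam x [set e in G | v \notin e].
Proof.
rewrite -{1}(wt1 x v) -sum_link (lamID x G (fun e => v \in e)); congr (_ + _).
by rewrite /lam; apply: eq_bigl => e; rewrite inE sub1set.
Qed.

Lemma sum_wt_link x G P :
  \sum_(D in P) wt x D * lam x (link G D) =
  \sum_(e in G) wt x e *+ #|[set D in P | D \subset e]|.
Proof.
rewrite (eq_bigr (fun D => \sum_(e in G | D \subset e) wt x e)); last first.
  by move=> D _; rewrite sum_link.
rewrite (exchange_big_dep (mem G)) /=; last by move=> D e _ /andP[].
apply: eq_bigr => e eG; rewrite sumr_const; congr (_ *+ _).
by apply: eq_card => D; rewrite !inE eG.
Qed.

Lemma sum_deg x G k : uniform k G ->
  \sum_v x v * lam x (link G [set v]) = lam x G *+ k.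
Proof.
move=> /forall_inP uG.
have := sum_wt_link x G [set [set v] | v in V].
rewrite big_imset /=; last by move=> u v _ _; apply: set1_inj.
under eq_bigr => v _ do rewrite wt1.
move=> ->; rewrite /lam -sumrMnl; apply: eq_bigr => e eG; congr (_ *+ _).
rewrite -(eqP (uG _ eG)) -(card_imset _ (@set1_inj V)); apply: eq_card => D.
rewrite !inE; apply/andP/imsetP => [[/imsetP [v _ ->]]|[v ve ->]].
  by rewrite sub1set => ve; exists v.
by split; [apply/imsetP; exists v | rewrite sub1set].
Qed.

Lemma elsymS x S k v : v \in S ->
  elsym x S k.+1 = elsym x (S :\ v) k.+1 + x v * elsym x (S :\ v) k.
Proof.
move=> vS; rewrite {1}/elsym (lam_link1 _ _ v) addrC; congr (_ + _ * _).
  by congr lam; apply/setP => e; rewrite !inE subsetD1 andbAC.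
congr lam; apply/setP => e; rewrite mem_link1 !inE subsetD1 subUset sub1set vS /=.
case: (boolP (v \in e)) => ve; first by rewrite andbF.
by rewrite /= cardsU1 ve andbT eqSS.
Qed.

Lemma elsym0 x S : elsym x S 0 = 1.
Proof.
rewrite /elsym /lam (_ : [set _ | _] = [set set0]) ?big_set1 ?wt0 //.
apply/setP => e; rewrite !inE cards_eq0; case: eqP => [->|]; last by rewrite andbF.
by rewrite sub0set.
Qed.

Lemma elsym_set0 x k : elsym x set0 k.+1 = 0.
Proof.
rewrite /elsym /lam big1 // => e; rewrite inE subset0 => /andP [/eqP ->].
by rewrite cards0.
Qed.

Lemma elsym_ge0 x S k : (forall v, 0 <= x v) -> 0 <= elsym x S k.
Proof. exact: lam_ge0. Qed.

(** The power lies above its tangent at [u]; the increment [d] may be negative. *)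
Lemma bernoulli (u d : R) k : 0 <= u -> 0 <= u + d ->
  u ^+ k.+1 + k.+1%:R * (d * u ^+ k) <= (u + d) ^+ k.+1.
Proof.
move=> u0 ud; elim: k => [|k IH]; first by rewrite !expr1 expr0 mulr1 mul1r.
have h : (u ^+ k.+1 + k.+1%:R * (d * u ^+ k)) * (u + d) <= (u + d) ^+ k.+2.
  by rewrite (exprSr (u + d)) ler_wpM2r.
apply: le_trans h; rewrite -subr_ge0.
have -> : (u ^+ k.+1 + k.+1%:R * (d * u ^+ k)) * (u + d) -
  (u ^+ k.+2 + k.+2%:R * (d * u ^+ k.+1)) = k.+1%:R * (d ^+ 2 * u ^+ k).
  rewrite !exprS expr0 -(natr1 k.+1); ring.
by rewrite mulr_ge0 ?ler0n // mulr_ge0 ?sqr_ge0 // exprn_ge0.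
Qed.

(** A weight [y] joins [n] weights of mean [u]. The mean becomes [u + d] with
    [d = (y - u) / (n + 1)], and the left side is exactly the tangent at [u] of the right side,
    evaluated at [u + d]. *)
Lemma maclaurin_step (u y : R) n k : 0 <= u -> 0 <= y ->
  'C(n, k.+1)%:R * u ^+ k.+1 + y * ('C(n, k)%:R * u ^+ k) <=
  'C(n.+1, k.+1)%:R * ((n%:R * u + y) / n.+1%:R) ^+ k.+1.
Proof.
move=> u0 y0; have n1 : (0 : R) < n.+1%:R by rewrite ltr0n.
have n1' : (n.+1%:R : R) != 0 by rewrite lt0r_neq0.
set d := (y - u) / n.+1%:R.
have dE : y = u + d * n.+1%:R by rewrite /d divfK // addrC subrK.
have -> : (n%:R * u + y) / n.+1%:R = u + d.
  by rewrite dE -natr1; field; rewrite natr1.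
have ud : 0 <= u + d.
  rewrite /d (_ : u + _ = (n%:R * u + y) / n.+1%:R); last by rewrite -natr1; field; rewrite natr1.
  by rewrite divr_ge0 ?ler0n // addr_ge0 ?mulr_ge0 ?ler0n.
have h := bernoulli k u0 ud.
have hC : (0 : R) <= 'C(n.+1, k.+1)%:R by rewrite ler0n.
apply: le_trans (ler_wpM2l hC h).
rewrite {1}dE.
have E : n.+1%:R * 'C(n, k)%:R = k.+1%:R * 'C(n.+1, k.+1)%:R :> R.
  by rewrite -!natrM mul_bin_diag.
rewrite mulrDr.
have -> : 'C(n.+1, k.+1)%:R * (k.+1%:R * (d * u ^+ k)) = d * u ^+ k * (n.+1%:R * 'C(n, k)%:R) :> R.
  by rewrite E; ring.
rewrite binS natrD exprS; rewrite le_eqVlt; apply/orP; left; apply/eqP; ring.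
Qed.

(** Induction on [N], removing one vertex at a time. [N] only bounds the size of [S], which amounts
    to padding with zero weights. *)
Lemma maclaurin x S k N : (forall v, 0 <= x v) -> (#|S| <= N)%N ->
  elsym x S k <= 'C(N, k)%:R * (tot x S / N%:R) ^+ k.
Proof.
move=> x0; elim: N S k => [|N IH] S [|k] SN; rewrite ?elsym0 ?bin0 ?expr0 ?mulr1 //.
  move: SN; rewrite leqn0 cards_eq0 => /eqP ->.
  by rewrite elsym_set0 bin0n mul0r.
have NE (T : {set V}) : (#|T| <= N)%N -> N%:R * (tot x T / N%:R) = tot x T.
  case: (posnP N) => [->|Np]; last by move=> _; rewrite mulrC divfK // pnatr_eq0 -lt0n.
  by rewrite leqn0 cards_eq0 => /eqP ->; rewrite /tot big_set0 !mul0r.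
case: (set_0Vmem S) => [S0|[v vS]].
  by rewrite S0 elsym_set0 mulr_ge0 ?ler0n // exprn_ge0 // divr_ge0 ?ler0n ?tot_ge0.
have cS : (#|S :\ v| <= N)%N by move: SN; rewrite (cardsD1 v S) vS.
rewrite (elsymS _ _ vS) (totD1 _ vS).
have u0 : 0 <= tot x (S :\ v) / N%:R by rewrite divr_ge0 ?ler0n ?tot_ge0.
apply: le_trans (_ : _ <= 'C(N, k.+1)%:R * (tot x (S :\ v) / N%:R) ^+ k.+1 +
  x v * ('C(N, k)%:R * (tot x (S :\ v) / N%:R) ^+ k)) _.
  by rewrite lerD ?ler_wpM2l ?IH.
have := maclaurin_step N k u0 (x0 v).
by rewrite NE // [x v + _]addrC.
Qed.

End Weights.

(** * Compression and shifted hypergraphs *)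

Section Shifting.
Import Order.TTheory GRing.Theory Num.Theory.
Local Open Scope ring_scope.
Variables (V : finType).
Implicit Types (e D S f g : {set V}) (G H M P : {set {set V}}).

Definition mfree t H :=
  [forall M : {set {set V}}, (M \subset H) && trivIset M ==> (#|M| < t)%N].

Lemma mfreeP t H : reflect (forall M, M \subset H -> trivIset M -> (#|M| < t)%N) (mfree t H).
Proof.
apply: (iffP forallP) => h M; first by move=> MH tM; apply: (implyP (h M)); rewrite MH.
by apply/implyP => /andP [MH tM]; apply: h.
Qed.

Lemma mfree_sub t G H : G \subset H -> mfree t H -> mfree t G.
Proof. by move=> GH /mfreeP h; apply/mfreeP => M MG; apply/h/(subset_trans MG). Qed.

Lemma uniform_sub k G H : G \subset H -> uniform k H -> uniform k G.
Proof. by move=> /subsetP GH /forall_inP h; apply/forall_inP => e /GH /h. Qed.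

Section Compression.
Variables a b : V.

Definition sw f : {set V} := tperm a b @: f.

Lemma mem_sw v f : (v \in sw f) = (tperm a b v \in f).
Proof. by rewrite -{1}(tpermK a b v) mem_imset //; apply: perm_inj. Qed.

Lemma swK : involutive sw.
Proof. by move=> f; apply/setP => v; rewrite !mem_sw tpermK. Qed.

Lemma card_sw f : #|sw f| = #|f|.
Proof. by rewrite card_imset //; apply: perm_inj. Qed.

Lemma sw_id f : a \notin f -> b \notin f -> sw f = f.
Proof.
move=> af bf; apply/setP => v; rewrite mem_sw.
by case: tpermP => [->|->|//]; rewrite (negPf af) (negPf bf).
Qed.

Lemma sw_swap f : a \in f -> b \notin f -> sw f = b |: (f :\ a).
Proof.
move=> af bf; apply/setP => v; rewrite mem_sw !inE.
have ab : a != b by apply: contraNneq bf => <-.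
case: tpermP => [->|->|/eqP va /eqP vb]; rewrite ?eqxx ?af ?(negPf bf) ?(negPf ab) //.
by rewrite va (negPf vb).
Qed.

Lemma sw_sub S f : a \in S -> b \in S -> (sw f \subset S) = (f \subset S).
Proof.
move=> aS bS; suff h g : g \subset S -> sw g \subset S.
  by apply/idP/idP => [/h|/h //]; rewrite swK.
move=> /subsetP gS; apply/subsetP => v; rewrite mem_sw => /gS.
by case: tpermP => [->|->|].
Qed.

(** These are the new edges created by the compression; the edges they replace are [sw @: mov H]. *)
Definition mov H : {set {set V}} :=
  [set f : {set V} | [&& b \in f, a \notin f, f \notin H & sw f \in H]].

Definition compress H := (H :\: (sw @: mov H)) :|: mov H.

(** Stated without subtraction, so that it applies to weights in a field and to ranks in [nat]
    alike. *)
Lemma compress_sum (T : nmodType) (phi : {set V} -> T) H :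
  \sum_(e in compress H) phi e + \sum_(e in mov H) phi (sw e) =
  \sum_(e in H) phi e + \sum_(e in mov H) phi e.
Proof.
rewrite -(big_imset phi (h := sw)) /=; last by move=> f g _ _ /(can_inj swK).
rewrite [\sum_(e in H) _](big_setID (sw @: mov H)) /=.
rewrite (_ : H :&: _ = sw @: mov H); last first.
  apply/setIidPr/subsetP => _ /imsetP [f + ->].
  by rewrite inE => /and4P [].
rewrite -addrA [RHS]addrC; congr (_ + _).
rewrite /compress -bigU /=.
  by apply: eq_bigl => f; rewrite !inE.
apply/pred0P => f /=; rewrite !inE.
by case: (f \in H); rewrite ?andbF.
Qed.

Lemma uniform_compress k H : uniform k H -> uniform k (compress H).
Proof.
move=> /forall_inP uH; apply/forall_inP => f; rewrite inE => /orP [].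
  by rewrite inE => /andP [_ /uH].
by rewrite inE => /and4P [_ _ _ /uH]; rewrite card_sw.
Qed.

(** If a matching uses a new edge [f], exchanging [a] and [b] throughout gives a matching of [H]:
    [f] returns to an edge of [H], and any other edge through [a] survived the compression only
    because its exchange was already an edge. *)
Lemma mfree_compress t H : mfree t H -> mfree t (compress H).
Proof.
move=> /mfreeP fH; apply/mfreeP => M /subsetP MC tM.
have [MH|] := boolP (M \subset H); first exact: fH.
move=> /subsetPn [f fM fH'].
have fm : f \in mov H.
  by move: (MC f fM); rewrite inE => /orP [] //; rewrite inE (negPf fH') andbF.
have [bf af _ sfH] : [/\ b \in f, a \notin f, f \notin H & sw f \in H].
  by move: fm; rewrite inE => /and4P [].
rewrite -(card_imset _ (can_inj swK)); apply: fH.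
  apply/subsetP => _ /imsetP [h hM ->].
  have [->//|hf] := eqVneq h f.
  have bh : b \notin h.
    have /trivIsetP/(_ _ _ hM fM hf) := tM.
    by rewrite disjoint_sym => /disjointFr ->.
  have hm : h \notin mov H by rewrite inE (negPf bh).
  move: (MC h hM); rewrite inE (negPf hm) orbF inE => /andP [hs hH].
  have [ah|ah] := boolP (a \in h); last by rewrite sw_id.
  apply: contraR hs => sh; apply/imsetP; exists (sw h); last by rewrite swK.
  by rewrite inE !mem_sw tpermL tpermR ah bh sh swK hH.
apply/trivIsetP => _ _ /imsetP [g gM ->] /imsetP [h hM ->] gh.
have gh' : g != h by apply: contraNneq gh => ->.
have /trivIsetP/(_ _ _ gM hM gh') := tM.
rewrite -!setI_eq0 -imsetI; last by move=> ? ? _ _; apply: perm_inj.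
by rewrite imset_eq0.
Qed.

End Compression.

(** A small rank stands for a large weight, so edges may be pushed towards heavier vertices. *)
Definition shifted (r : V -> nat) S H := forall e a b, e \in H -> a \in e ->
  b \in S -> b \notin e -> (r b < r a)%N -> b |: (e :\ a) \in H.

(** Among the hypergraphs with the required properties, one of minimal total rank is shifted: a
    compression that still moved an edge would lower the rank. *)
Lemma shift_exists (R : realFieldType) (x : V -> R) (r : V -> nat) k t S H :
  (forall v, 0 <= x v) -> (forall u v, (r u < r v)%N -> x v <= x u) ->
  uniform k H -> H \subset powerset S -> mfree t H ->
  exists H', [/\ uniform k H', H' \subset powerset S, mfree t H',
    lam x H <= lam x H' & shifted r S H'].
Proof.
move=> x0 rx uH HS fH.
pose P H' := [&& uniform k H', H' \subset powerset S, mfree t H' & lam x H <= lam x H'].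
pose rk e := (\sum_(v in e) r v)%N.
have PH : P H by rewrite /P uH HS fH lexx.
case: (arg_minnP (fun H' => (\sum_(e in H') rk e)%N) PH) => H' /and4P [uH' HS' fH' lH'] mn.
exists H'; split => // e a b eH ae bS be rba.
rewrite -sw_swap //; apply/negPn/negP => nH.
have ab : a != b by apply: contraNneq be => <-.
have aS : a \in S.
  by have := subsetP HS' _ eH; rewrite inE => /subsetP; apply.
have mS : sw a b e \in mov a b H'.
  by rewrite inE !mem_sw tpermL tpermR swK ae be nH eH.
have movE f : f \in mov a b H' -> exists2 g, f = b |: g & [/\ b \notin g, a \notin g &
   sw a b f = a |: g].
  rewrite inE => /and4P [bf af _ _].
  exists (f :\ b); first by rewrite setD1K.
  rewrite !inE eqxx (negPf af) andbF; split => //.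
  apply/setP => v; rewrite mem_sw !inE.
  case: tpermP => [->|->|/eqP va /eqP vb]; rewrite ?eqxx ?bf ?(negPf af) //=.
    by rewrite eq_sym (negPf ab).
  by rewrite (negPf va) vb.
have rkm f : f \in mov a b H' -> (rk f < rk (sw a b f))%N.
  move=> /movE [g -> [bg ag ->]]; by rewrite /rk (big_setU1 _ bg) (big_setU1 _ ag) /= ltn_add2r.
have wtm f : f \in mov a b H' -> wt x (sw a b f) <= wt x f.
  move=> /movE [g -> [bg ag ->]]; rewrite !wtU1 // ler_wpM2r ?wt_ge0 //; exact: rx.
have Pc : P (compress a b H').
  apply/and4P; split; [exact: uniform_compress| |exact: mfree_compress|].
    apply/subsetP => f; rewrite inE => /orP [].
      by rewrite inE => /andP [_ /(subsetP HS')].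
    rewrite inE => /and4P [_ _ _ /(subsetP HS')].
    by rewrite !inE sw_sub.
  apply: le_trans lH' _; have := compress_sum a b (wt x) H'.
  rewrite -/(lam x (compress a b H')) -/(lam x H') => E.
  have : \sum_(f in mov a b H') wt x (sw a b f) <= \sum_(f in mov a b H') wt x f.
    by apply: ler_sum => f /wtm.
  lra.
have := mn _ Pc; rewrite leqNgt => /negP; apply.
have := compress_sum a b rk H'.
have : (\sum_(f in mov a b H') rk f < \sum_(f in mov a b H') rk (sw a b f))%N.
  rewrite !(big_setD1 _ mS) /=; have := rkm _ mS.
  have : (\sum_(f in mov a b H' :\ sw a b e) rk f <=
     \sum_(f in mov a b H' :\ sw a b e) rk (sw a b f))%N.
    by apply: leq_sum => f; rewrite inE => /andP [_ /rkm /ltnW].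
  by move=> h1 h2; rewrite -addSn; apply: leq_add.
move=> h E; rewrite -(ltn_add2r (\sum_(f in mov a b H') rk (sw a b f))).
rewrite (E : (_ + _ = _ + _)%N); by rewrite ltn_add2l.
Qed.

Lemma rank_exists (R : realFieldType) (x : V -> R) : exists r : V -> nat,
  injective r /\ (forall u v, (r u < r v)%N -> x v <= x u).
Proof.
pose s := sort (fun u v => x v <= x u) (enum V).
have sV v : v \in s by rewrite mem_sort mem_enum.
exists (index^~ s); split.
  by move=> u v E; rewrite -(nth_index u (sV u)) E nth_index.
have st : sorted (fun u v => x v <= x u) s by apply: sort_sorted => u v; apply: le_total.
move=> u v; apply: (sorted_ltn_index _ st) => //.
by move=> p q w /= h1 h2; apply: le_trans h2 h1.
Qed.

End Shifting.

(** * Moving weight from one vertex to another *)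

Section Moves.
Import Order.TTheory GRing.Theory Num.Theory.
Local Open Scope ring_scope.
Variables (R : realFieldType) (V : finType).
Implicit Types (x : V -> R) (e D S : {set V}) (G H P M : {set {set V}}).

Definition mv x k o (s : R) : V -> R :=
  fun v => if v == k then x k + s else if v == o then x o - s else x v.

Lemma mv_ge0 x k o s : (forall v, 0 <= x v) -> 0 <= s <= x o ->
  forall v, 0 <= mv x k o s v.
Proof.
move=> x0 /andP [s0 so] v; rewrite /mv; case: eqP => _; first by rewrite addr_ge0.
by case: eqP => _ //; rewrite subr_ge0.
Qed.

Lemma tot_mv x k o s S : k != o -> k \in S -> o \in S ->
  tot (mv x k o s) S = tot x S.
Proof.
move=> ko kS oS; have oS' : o \in S :\ k by rewrite !inE eq_sym ko.
rewrite !(totD1 _ kS) !(totD1 _ oS').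
have -> : tot (mv x k o s) ((S :\ k) :\ o) = tot x ((S :\ k) :\ o).
  by apply: eq_bigr => v; rewrite !inE /mv => /and3P [/negPf -> /negPf -> _].
by rewrite /mv eqxx eq_sym (negPf ko) eqxx; lra.
Qed.

Lemma eq_lam x y H : (forall e, e \in H -> {in e, x =1 y}) -> lam x H = lam y H.
Proof. by move=> h; apply: eq_bigr => e /h; apply: eq_wt. Qed.

Lemma lam_two x H a b : a != b -> (forall e, e \in H -> a \in e -> b \notin e) ->
  lam x H = x a * lam x (link H [set a]) + x b * lam x (link H [set b]) +
            lam x [set e in H | (a \notin e) && (b \notin e)].
Proof.
move=> ab unc; rewrite (lam_link1 x H a) -addrA; congr (_ + _).
rewrite (lam_link1 x _ b); congr (_ * _ + _).
  congr lam; apply/setP => e; rewrite !mem_link1 !inE (negPf ab) /=.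
  case: (boolP (b \in e)) => //= be; apply/andP/idP => [[]//|bH]; split => //.
  by apply: contraTN (bH) => ae; apply/negP => /unc; rewrite !inE ae eqxx orbT => /(_ isT).
by congr lam; apply/setP => e; rewrite !inE andbA.
Qed.

Lemma lam_mv x H k o s : k != o -> (forall e, e \in H -> k \in e -> o \notin e) ->
  lam (mv x k o s) H =
  lam x H + s * (lam x (link H [set k]) - lam x (link H [set o])).
Proof.
move=> ko unc; rewrite !(lam_two _ ko unc).
have mvE e : k \notin e -> o \notin e -> {in e, mv x k o s =1 x}.
  move=> ke oe v ve; rewrite /mv; case: eqP => [E|_]; first by rewrite -E ve in ke.
  by case: eqP => [E|//]; rewrite -E ve in oe.
rewrite (eq_lam (x := mv x k o s) (y := x) (H := link _ [set k])); last first.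
  move=> e; rewrite mem_link1 => /andP [ke kH]; apply: mvE => //.
  by have := unc _ kH; rewrite !inE eqxx => /(_ isT); rewrite negb_or => /andP[].
rewrite (eq_lam (x := mv x k o s) (y := x) (H := link _ [set o])); last first.
  move=> e; rewrite mem_link1 => /andP [oe oH]; apply: mvE => //.
  apply: contraTN (oH) => ke; apply/negP => /unc; rewrite !inE ke eqxx orbT.
  by move=> /(_ isT).
rewrite (eq_lam (x := mv x k o s) (y := x) (H := [set _ in _ | _])); last first.
  by move=> e; rewrite inE => /and3P [_ ke oe]; apply: mvE.
by rewrite /mv eqxx eq_sym (negPf ko) eqxx; ring.
Qed.

(** When no edge contains both vertices, [lam] is linear in the moved weight, so a single direction
    works for every [s]. The full weight of [o] empties that vertex; intermediate values give the
    small steps of the stability proof. *)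
Lemma merge_exists x H a b : (forall v, 0 <= x v) -> a != b ->
  (forall e, e \in H -> a \in e -> b \notin e) ->
  exists k o, [/\ (k == a) && (o == b) || (k == b) && (o == a) &
     forall s, 0 <= s -> lam x H <= lam (mv x k o s) H].
Proof.
move=> x0 ab unc.
case: (lerP (lam x (link H [set b])) (lam x (link H [set a]))) => h.
  exists a, b; rewrite !eqxx; split => // s s0.
  by rewrite lam_mv // lerDl mulr_ge0 // subr_ge0.
exists b, a; rewrite !eqxx orbT; split => // s s0.
rewrite lam_mv //; first by rewrite lerDl mulr_ge0 // subr_ge0 ltW.
  by rewrite eq_sym.
by move=> e eH be; apply: contraL be => /(unc _ eH).
Qed.

Lemma lam_zero x H o : x o = 0 -> lam x H = lam x [set e in H | o \notin e].
Proof. by move=> xo; rewrite (lam_link1 x H o) xo mul0r add0r. Qed.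

(** The Lagrangian of the complete [k]-graph on [n] vertices at total weight 1. *)
Definition mac (k n : nat) : R := 'C(n, k)%:R / n%:R ^+ k.

Lemma maclaurin' x S k N : (forall v, 0 <= x v) -> (#|S| <= N)%N ->
  elsym x S k <= mac k N * tot x S ^+ k.
Proof.
move=> x0 SN; apply: le_trans (maclaurin k x0 SN) _.
by rewrite expr_div_n /mac mulrAC mulrA.
Qed.

Lemma mac_ge0 k n : 0 <= mac k n.
Proof. by rewrite divr_ge0 ?exprn_ge0 ?ler0n. Qed.

Lemma elsym1 x S : elsym x S 1 = tot x S.
Proof.
rewrite /elsym /lam /tot.
rewrite (_ : [set _ | _] = [set [set v] | v in S]).
  rewrite big_imset /=; last by move=> u v _ _; apply: set1_inj.
  by apply: eq_bigr => v _; rewrite wt1.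
apply/setP => e; rewrite inE; apply/andP/imsetP => [[eS /cards1P [v ev]]|[v vS ->]].
  by exists v => //; rewrite -sub1set -ev.
by rewrite sub1set vS cards1.
Qed.

Lemma lam_le_elsym x H S k : (forall v, 0 <= x v) -> uniform k H -> H \subset powerset S ->
  lam x H <= elsym x S k.
Proof.
move=> x0 /forall_inP uH /subsetP HS; apply: lamS => //.
by apply/subsetP => e eH; have := HS e eH; rewrite !inE uH // andbT.
Qed.

Lemma link_uniform k H v : uniform k.+1 H -> uniform k (link H [set v]).
Proof.
move=> /forall_inP uH; apply/forall_inP => e; rewrite mem_link1 => /andP [ve /uH].
by rewrite cardsU1 ve.
Qed.

Lemma link_powerset H S v : H \subset powerset S -> link H [set v] \subset powerset (S :\ v).
Proof.
move=> /subsetP HS; apply/subsetP => e; rewrite mem_link1 => /andP [ve /HS].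
by rewrite !inE subUset subsetD1 ve andbT => /andP [].
Qed.

Lemma link_le_elsym x H S k v : (forall v, 0 <= x v) -> uniform k.+1 H ->
  H \subset powerset S -> lam x (link H [set v]) <= elsym x (S :\ v) k.
Proof.
by move=> x0 uH HS; apply: lam_le_elsym (link_uniform _ uH) (link_powerset _ HS).
Qed.

Lemma elsym2_le x S : (forall v, 0 <= x v) -> elsym x S 2 <= tot x S ^+ 2 / 2.
Proof.
move=> x0; have := sum_deg x (k := 2) (G := [set e : {set V} | (e \subset S) && (#|e| == 2)]).
rewrite -/(elsym x S 2) => /(_ _) E.
have {}E : \sum_v x v * lam x (link [set e : {set V} | (e \subset S) && (#|e| == 2)] [set v]) = elsym x S 2 *+ 2.
  by apply: E; apply/forall_inP => e; rewrite inE => /andP [].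
suff : elsym x S 2 *+ 2 <= tot x S ^+ 2 by rewrite mulr2n; lra.
rewrite -E [leLHS](bigID (mem S)) /= [X in _ + X]big1 ?addr0; last first.
  move=> v vS; rewrite /lam big1 ?mulr0 // => e; rewrite mem_link1 !inE subUset sub1set (negPf vS).
  by rewrite andbF.
rewrite expr2 {1}/tot big_distrl /=; apply: ler_sum => v vS; rewrite ler_wpM2l //.
apply: le_trans (link_le_elsym (S := S) (k := 1) v x0 _ _) _.
- by apply/forall_inP => e; rewrite inE => /andP [].
- by apply/subsetP => e; rewrite !inE => /andP [].
by rewrite elsym1 totS // subsetDl.
Qed.

(** An edge either misses [D] or is counted at least once among the edges through a vertex of
    [D]. *)
Lemma lam_hit x H D : (forall v, 0 <= x v) ->
  lam x H <= \sum_(v in D) x v * lam x (link H [set v]) + lam x [set e in H | [disjoint e & D]].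
Proof.
move=> x0.
rewrite (_ : lam x [set e in H | _] = \sum_(e in H | [disjoint e & D]) wt x e); last first.
  by rewrite /lam; apply: eq_bigl => e; rewrite inE.
rewrite (eq_bigr (fun v => \sum_(e in H | [set v] \subset e) wt x e)); last first.
  by move=> v _; rewrite sum_link wt1.
rewrite (exchange_big_dep (mem H)) /= => [|v e _ /andP[]//].
rewrite /lam (bigID (fun e => [disjoint e & D])) /= addrC lerD2r big_mkcondr /=.
apply: ler_sum => e eH; case: (boolP [disjoint e & D]) => [_|/pred0Pn [v /andP [ve vD]]] /=.
  by apply: sumr_ge0 => v _; apply: wt_ge0.
rewrite (bigD1 v) /=; last by rewrite sub1set; apply/and3P; split.
by rewrite lerDl sumr_ge0 // => w _; apply: wt_ge0.
Qed.

End Moves.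

(** * Matching numbers of shifted hypergraphs *)

Section Matchings.
Import Order.TTheory GRing.Theory Num.Theory.
Local Open Scope ring_scope.
Variables (R : realFieldType) (V : finType).
Implicit Types (x : V -> R) (e D S : {set V}) (G H P M : {set {set V}}).

Lemma subset_card (T : finType) (A : {set T}) k : (k <= #|A|)%N ->
  exists2 B : {set T}, B \subset A & #|B| = k.
Proof.
elim: k => [|k IH] kA; first by exists set0; rewrite ?sub0set ?cards0.
have [B BA cB] := IH (ltnW kA).
have : (0 < #|A :\: B|)%N by rewrite cardsD (setIidPr BA) subn_gt0 cB.
move=> /card_gt0P [v]; rewrite inE => /andP [vB vA].
by exists (v |: B); rewrite ?subUset ?sub1set ?vA // cardsU1 vB cB.
Qed.

Lemma cover_card M k S : uniform k M -> trivIset M -> M \subset powerset S ->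
  cover M \subset S /\ #|cover M| = (#|M| * k)%N.
Proof.
move=> /forall_inP uM tM /subsetP MS; split.
  by apply/bigcupsP => e /MS; rewrite inE.
rewrite -(eqP tM) (eq_bigr (fun=> k)); first by rewrite sum_nat_const.
by move=> e /uM /eqP.
Qed.

Lemma mfreeS_pred t H k f : uniform k.+1 H -> f \in H -> mfree t.+1 H -> (0 < t)%N.
Proof.
move=> /forall_inP uH fH /mfreeP h; have := h [set f].
rewrite sub1set fH cards1 ltnS; apply => //.
apply/trivIsetP => A B; rewrite !inE => /eqP -> /eqP ->; by rewrite eqxx.
Qed.

(** A matching of [t] edges that misses [u] leaves room in [S] for [k] more vertices, and these form
    with [u] a further disjoint edge. *)
Lemma mfree_star k t H S u : uniform k.+1 H -> H \subset powerset S -> mfree t.+1 H ->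
  (t.+1 * k.+1 <= #|S|)%N -> u \in S ->
  (forall e, e \subset S -> #|e| = k.+1 -> u \in e -> e \in H) ->
  mfree t [set e in H | u \notin e].
Proof.
move=> uH HS /mfreeP fH Sc uS full; apply/mfreeP => M /subsetP MH tM; rewrite ltnNge; apply/negP => tM'.
have MH' : M \subset H by apply/subsetP => e /MH; rewrite inE => /andP[].
have Mt : #|M| = t by apply/eqP; rewrite eqn_leq tM' -ltnS fH.
have [] := cover_card (S := S :\ u) (uniform_sub MH' uH) tM.
  apply/subsetP => e eM; have := MH _ eM; rewrite !inE subsetD1 => /andP [eH ->].
  by rewrite andbT; have := subsetP HS _ eH; rewrite inE.
move=> covS covc; rewrite Mt in covc.
have : (k <= #|(S :\ u) :\: cover M|)%N.
  rewrite cardsD (setIidPr covS) covc; move: Sc; rewrite (cardsD1 u S) uS mulSn; clear; lia.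
move=> /subset_card [B BS Bc].
have uB : u \notin B.
  by apply/negP => /(subsetP BS); rewrite !inE eqxx /= andbF.
have BH : u |: B \in H.
  apply: full; rewrite ?setU11 ?cardsU1 ?uB ?Bc // subUset sub1set uS.
  by apply: subset_trans BS _; apply: subset_trans (subsetDl _ _) (subsetDl _ _).
have [] := @trivIsetU1 _ (u |: B) M.
- move=> e eM; rewrite -setI_eq0 -subset0; apply/subsetP => v; rewrite !inE => /andP [/orP [/eqP ->|vB] ve].
    by have := MH _ eM; rewrite inE ve andbF.
  have := subsetP BS _ vB; rewrite !inE => /andP [+ _] => /negP [].
  by apply/bigcupP; exists e.
- exact: tM.
- apply/negP => /(subsetP MH'); have /forall_inP h := uH.
  by move=> /h; rewrite cards0.
move=> tU nU; have UH : u |: B |: M \subset H by rewrite subUset sub1set BH.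
by have := fH _ UH tU; rewrite cardsU1 nU Mt add1n ltnn.
Qed.

(** Each edge of [M] receives its own vertex of [Y], the one with the same position in the
    enumerations. Disjointness survives because [Y] avoids the cover of [M]. *)
Lemma extend_matching H M (Y : {set V}) : trivIset M -> (#|M| <= #|Y|)%N ->
  [disjoint cover M & Y] -> set0 \notin M ->
  (forall e y, e \in M -> y \in Y -> y |: e \in H) ->
  exists2 M' : {set {set V}}, M' \subset H & trivIset M' /\ #|M'| = #|M|.
Proof.
move=> tM cM dj n0 h.
have [M0|[e0 e0M]] := set_0Vmem M.
  exists set0; rewrite ?sub0set // M0 cards0; split => //.
  by apply/trivIsetP => A; rewrite inE.
have : (0 < #|Y|)%N by apply: leq_trans cM; apply/card_gt0P; exists e0.
move=> /card_gt0P [y0 y0Y].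
pose g e := nth y0 (enum Y) (index e (enum M)).
have idx e : e \in M -> (index e (enum M) < size (enum Y))%N.
  by move=> eM; rewrite -cardE; apply: leq_trans cM; rewrite cardE index_mem mem_enum.
have gY e : e \in M -> g e \in Y.
  by move=> eM; rewrite -mem_enum mem_nth // idx.
have ginj : {in M &, injective g}.
  move=> e f eM fM /eqP; rewrite nth_uniq ?idx ?enum_uniq // => /eqP E.
  by rewrite -(nth_index e0 (_ : e \in enum M)) ?mem_enum // E nth_index ?mem_enum.
have covY e v : e \in M -> v \in e -> v \notin Y.
  by move=> eM ve; rewrite (disjointFr dj) //; apply/bigcupP; exists e.
have dj2 e f : e \in M -> f \in M -> e != f -> [disjoint g e |: e & g f |: f].
  move=> eM fM ef; rewrite -setI_eq0 -subset0; apply/subsetP => v; rewrite !inE.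
  have /trivIsetP/(_ _ _ eM fM ef) := tM; rewrite -setI_eq0 => /eqP/setP/(_ v); rewrite !inE => efv.
  move=> /andP [/orP [/eqP ve|ve] /orP [/eqP vf|vf]].
  - by move: ef; rewrite (ginj e f eM fM) ?eqxx // -ve -vf.
  - by have := covY _ _ fM vf; rewrite ve gY.
  - by have := covY _ _ eM ve; rewrite vf gY.
  by rewrite ve vf in efv.
have finj : {in M &, injective (fun e => g e |: e)}.
  move=> e f eM fM /= E; apply/eqP; apply: contraT => ef.
  have := dj2 _ _ eM fM ef; rewrite E -setI_eq0 setIid => /eqP/setP/(_ (g f)).
  by rewrite !inE eqxx.
exists [set g e |: e | e in M].
  by apply/subsetP => _ /imsetP [e eM ->]; apply: h => //; apply: gY.
split; last exact: card_in_imset.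
apply/trivIsetP => _ _ /imsetP [e eM ->] /imsetP [f fM ->] ef.
by apply: dj2 => //; apply: contraNneq ef => ->.
Qed.

Lemma pred_lam_star x H S u k : (forall v, 0 <= x v) -> uniform k.+1 H ->
  H \subset powerset S ->
  lam x H <= x u * elsym x (S :\ u) k + lam x [set e in H | u \notin e].
Proof.
move=> x0 uH HS; rewrite (lam_link1 x H u) lerD2r ler_wpM2l //.
exact: link_le_elsym.
Qed.

Lemma restr_powerset H S u : H \subset powerset S ->
  [set e in H | u \notin e] \subset powerset (S :\ u).
Proof.
move=> /subsetP HS; apply/subsetP => e; rewrite !inE subsetD1 => /andP [/HS].
by rewrite inE => -> ->.
Qed.

Lemma restr_sub H (p : pred {set V}) : [set e in H | p e] \subset H.
Proof. by apply/subsetP => e; rewrite inE => /andP[]. Qed.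

(* After shifting towards heavier vertices, an edge through the two lightest vertices
   [a], [b] forces the heaviest vertex [u] to be joined to every pair, so that removing
   [u] lowers the matching number; otherwise [a] and [b] can be merged. *)
Lemma shift_step x H S t : (forall v, 0 <= x v) -> uniform 3 H ->
  H \subset powerset S -> mfree t.+1 H -> (3 * t.+1 <= #|S|)%N ->
  exists H' u a b, [/\ [/\ uniform 3 H', H' \subset powerset S, mfree t.+1 H' & lam x H <= lam x H'],
    [/\ u \in S, a \in S, b \in S & a != b],
    (forall w, w \in S -> x w <= x u /\ x b <= x w) /\
    (forall w, w \in S -> w != b -> x a <= x w) &
    mfree t [set e in H' | u \notin e] \/
    (forall e, e \in H' -> a \in e -> b \notin e) /\ mfree t.+1 (link H' [set b])].
Proof.
move=> x0 uH HS fH cS.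
have [r [rinj rx]] := rank_exists x.
have [H' [uH' HS' fH' lH sh]] := shift_exists x0 rx uH HS fH.
have [v0 v0S] : exists v, v \in S by apply/card_gt0P; move: cS; clear; lia.
have rlt v w : (r v <= r w)%N -> v != w -> (r v < r w)%N.
  by move=> h vw; rewrite ltn_neqAle h andbT; apply: contraNneq vw => /rinj ->.
have rx' v w : (r v <= r w)%N -> x w <= x v.
  by rewrite leq_eqVlt => /orP [/eqP/rinj -> //|/rx].
have [u uS umin] := arg_minnP r v0S. have {}uS : u \in S by [].
have [b bS bmax] := arg_maxnP r v0S. have {}bS : b \in S by [].
have [v1 v1S] : exists v, v \in S :\ b.
  by apply/card_gt0P; move: cS; rewrite (cardsD1 b S) bS; clear; lia.
have [a aS amax] := arg_maxnP r v1S. have {}aS : a \in S :\ b by [].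
have /andP [ab aS'] : (a != b) && (a \in S) by move: aS; rewrite !inE.
have ub : u != b.
  apply/eqP => E; have := umin _ aS'; have := bmax _ aS' => h1 h2.
  by have := rlt _ _ h1 ab; rewrite -E ltnNge h2.
have ua : u != a.
  have [v2 /setD1P [v2a /setD1P [v2b v2S]]] : exists v, v \in (S :\ b) :\ a.
    apply/card_gt0P; move: cS; rewrite (cardsD1 b S) bS (cardsD1 a (S :\ b)) aS; clear; lia.
  apply/eqP => E; have := umin _ v2S; rewrite E => h.
  have h2 : (r v2 <= r a)%N by apply: amax; apply/setD1P.
  by have := rlt _ _ h2 v2a; rewrite ltnNge h.
exists H', u, a, b; split => //.
  split=> w wS; first by split; apply: rx'; [apply: umin | apply: bmax].
  by move=> wb; apply: rx'; apply: amax; apply/setD1P.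
have [/existsP [e /and3P [eH ae be]]|/existsPn unc] :=
  boolP [exists e : {set V}, [&& e \in H', a \in e & b \in e]].
- left; apply: (mfree_star (k := 2) (S := S)) => //; first by rewrite mulnC.
  have uabH : [set u; a; b] \in H'.
    have [ue|ue] := boolP (u \in e).
      rewrite (_ : [set u; a; b] = e) //; apply/eqP; rewrite eqEcard; apply/andP; split.
        by rewrite !subUset !sub1set ue ae be.
      by rewrite (eqP (forall_inP uH' _ eH)) -setUA cardsU1 cards2 !inE negb_or ab ua ub.
    have [y ye] : exists y, y \in e :\ a :\ b.
      apply/card_gt0P; have := forall_inP uH' _ eH.
      by rewrite (cardsD1 a) ae (cardsD1 b (e :\ a)) !inE (eq_sym b) ab be /=; clear; lia.
    move: ye; rewrite !inE => /and3P [yb ya ye].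
    have yS : y \in S by have := subsetP HS' _ eH; rewrite inE => /subsetP; apply.
    have uy : u != y by apply: contraNneq ue => ->.
    have := sh _ _ _ eH ye uS ue (rlt _ _ (umin _ yS) uy).
    rewrite (_ : u |: (e :\ y) = [set u; a; b]) //.
    apply/esym/eqP; rewrite eqEcard; apply/andP; split.
      rewrite !subUset !sub1set !inE eqxx ae be.
      by rewrite ![_ == y]eq_sym yb ya !orbT.
    rewrite (_ : #|[set u; a; b]| = 3%N); last first.
      by rewrite -setUA cardsU1 cards2 !inE negb_or ab ua ub.
    have := forall_inP uH' _ eH; rewrite (cardsD1 y) ye => /eqP.
    by rewrite cardsU1 !inE negb_and ue orbT; clear; lia.
  have three u1 c d : u1 != c -> u1 != d -> c != d -> #|[set u1; c; d]| = 3%N.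
    by move=> h1 h2 h3; rewrite -setUA cardsU1 cards2 !inE negb_or h1 h2 h3.
  (* Every triple through [u] arises from [[set u; a; b]] by replacing the two lightest vertices, so
     it is enough to treat [c] and [d] ordered by rank. *)
  suff key c d : c \in S -> d \in S -> c != u -> d != u -> (r c < r d)%N -> [set u; c; d] \in H'.
    move=> f fS fc uf.
    have : #|f :\ u| = 2%N by move: fc; rewrite (cardsD1 u) uf; clear; lia.
    move=> /eqP/cards2P [c [d [cd fE]]].
    have fE' : f = [set u; c; d] by rewrite -(setD1K uf) fE setUA.
    have cf : c \in f :\ u by rewrite fE !inE eqxx.
    have df : d \in f :\ u by rewrite fE !inE eqxx orbT.
    move: cf df; rewrite !inE => /andP [cu /(subsetP fS) cS'] /andP [du /(subsetP fS) dS'].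
    have [h|h] := leqP (r c) (r d); first by rewrite fE'; apply: key => //; apply: rlt.
    rewrite fE' setUAC; exact: key.
  move=> cS' dS cu du rcd.
  have dswap f g w z : f \in H' -> z \in f -> w \in S -> w \notin f -> (r w < r z)%N ->
      w |: (f :\ z) = g -> g \in H'.
    by move=> fH1 zf wS wf rwz <-; apply: sh.
  have [db|db] := eqVneq d b.
    have [->|ca] := eqVneq c a; first by rewrite db.
    rewrite db in rcd *; have cb : c != b by apply: contraTneq rcd => ->; rewrite ltnn.
    apply: (dswap [set u; a; b] _ c a uabH) => //; rewrite ?inE ?eqxx ?orbT //.
    - by rewrite (negPf cu) (negPf ca) (negPf cb).
    - by apply: rlt ca; apply: amax; apply/setD1P.
    apply/setP => v; rewrite !inE.
    case: (eqVneq v c) => [->|vc] /=; first by rewrite orbT.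
    by case: (eqVneq v a) => [->|va] /=; rewrite ?orbF // (negPf ab) (eq_sym a) (negPf ua).
  have rda : (r d <= r a)%N by apply: amax; apply/setD1P.
  have ca : c != a by apply: contraTneq rcd => ->; rewrite ltnNge rda.
  have cb : c != b by apply: contraTneq rcd => ->; rewrite -leqNgt; apply: bmax.
  have uacH : [set u; c; a] \in H'.
    apply: (dswap [set u; a; b] _ c b uabH) => //; rewrite ?inE ?eqxx ?orbT //.
    - by rewrite (negPf cu) (negPf ca) (negPf cb).
    - by apply: rlt cb; apply: bmax.
    apply/setP => v; rewrite !inE.
    case: (eqVneq v c) => [->|vc] /=; first by rewrite orbT.
    case: (eqVneq v b) => [->|vb] /=; rewrite ?orbF //.
    by rewrite ![b == _]eq_sym (negPf ab) (negPf ub).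
  have [->//|da] := eqVneq d a.
  have dc : d != c by apply: contraTneq rcd => ->; rewrite ltnn.
  apply: (dswap [set u; c; a] _ d a uacH) => //; rewrite ?inE ?eqxx ?orbT //.
  - by rewrite (negPf du) (negPf dc) (negPf da).
  - exact: rlt.
  apply/setP => v; rewrite !inE.
  case: (eqVneq v d) => [->|vd] /=; first by rewrite orbT.
  case: (eqVneq v a) => [->|va] /=; rewrite ?orbF //.
  by rewrite ![a == _]eq_sym (negPf ca) (negPf ua).
right; have {}unc e : e \in H' -> a \in e -> b \notin e.
  by move=> eH ae; apply/negP => be; have := unc e; rewrite eH ae be.
(* Disjoint pairs in the link of [b] extend to disjoint triples of [H']: by shifting, the lightest
   vertex [b] can be replaced by any other vertex of [S], and [S] has enough vertices outside the
   pairs to give each its own. *)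
split=> //; apply/mfreeP => M0 M0L tM0; rewrite ltnNge; apply/negP => /subset_card [M MM0 cM].
have /subsetP ML := subset_trans MM0 M0L.
have tM : trivIset M by apply: trivIsetS tM0.
have uM : uniform 2 M.
  by apply: uniform_sub (link_uniform b uH'); apply/subsetP.
have [covS covc] : cover M \subset S :\ b /\ #|cover M| = (#|M| * 2)%N.
  by apply: cover_card => //; apply: subset_trans (link_powerset b HS'); apply/subsetP.
have [M' M'H [tM' cM']] : exists2 M' : {set {set V}}, M' \subset H' & trivIset M' /\ #|M'| = #|M|.
  apply: (extend_matching (Y := S :\: cover M)) => //.
  - rewrite cardsD (setIidPr (subset_trans covS (subsetDl _ _))) covc cM; move: cS; clear; lia.
  - by rewrite -setI_eq0 setDE setICA setICr setI0.
  - by apply/negP => /(forall_inP uM); rewrite cards0.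
  move=> e y eM /setDP [yS ye].
  have := ML _ eM; rewrite mem_link1 => /andP [bne beH].
  have [->//|yb] := eqVneq y b.
  have yne : y \notin e by apply: contra ye => ye; apply/bigcupP; exists e.
  have := sh _ b y beH (setU11 _ _) yS _ (rlt _ _ (bmax _ yS) yb).
  rewrite !inE (negPf yb) (negPf yne) => /(_ isT).
  by rewrite setU1K.
by have /mfreeP/(_ _ M'H tM') := fH'; rewrite cM' cM ltnn.
Qed.

Lemma graph_bound x L S t : (forall v, 0 <= x v <= 1) -> uniform 2 L ->
  L \subset powerset S -> mfree t.+1 L -> lam x L <= t%:R * tot x S.
Proof.
move=> x01; have x0 v : 0 <= x v by have /andP[] := x01 v.
have x1 v : x v <= 1 by have /andP[] := x01 v.
have [n] := ubnP #|S|; elim: n S L t => // n IH S L t Sn uL LS fL.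
have [small|big] := leqP #|S| (2 * t).+1.
  (* On at most [2 t + 1] vertices of weight at most 1 every degree is at most [2 t], and the degree
     sum counts each edge twice. *)
  suff : lam x L *+ 2 <= (t%:R * tot x S) *+ 2 by rewrite !mulr2n; lra.
  rewrite -(sum_deg x uL) -mulr_natl mulrA -natrM /tot [leLHS](bigID (mem S)) /=.
  rewrite [X in _ + X]big1 ?addr0; last first.
    move=> v vS; rewrite /lam big1 ?mulr0 // => e; rewrite mem_link1 => /andP [_ /(subsetP LS)].
    by rewrite inE subUset sub1set (negPf vS).
  rewrite mulr_sumr; apply: ler_sum => v vS; rewrite mulrC ler_wpM2r //.
  apply: le_trans (link_le_elsym (S := S) (k := 1) v x0 uL LS) _.
  rewrite elsym1; apply: le_trans (_ : \sum_(w in S :\ v) 1 <= _).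
    by apply: ler_sum => w _; apply: x1.
  rewrite sumr_const ler_nat; move: small; rewrite (cardsD1 v S) vS; clear; lia.
have [r [rinj rx]] := rank_exists x.
have [L' [uL' LS' fL' lL sh]] := shift_exists x0 rx uL LS fL.
apply: le_trans lL _.
have [v0 v0S] : exists v, v \in S by apply/card_gt0P; move: big; clear; lia.
have rlt v w : (r v <= r w)%N -> v != w -> (r v < r w)%N.
  by move=> h vw; rewrite ltn_neqAle h andbT; apply: contraNneq vw => /rinj ->.
have [u uS umin] := arg_minnP r v0S. have {}uS : u \in S by [].
have [b bS bmax] := arg_maxnP r v0S. have {}bS : b \in S by [].
have [ubL|ubL] := boolP ([set u; b] \in L').
  have t0 := mfreeS_pred uL' ubL fL'.
  have ub : u != b by have := forall_inP uL' _ ubL; rewrite cards2; case: (u == b).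
  case: t fL t0 fL' big => [_ //|t _ _ fL' big].
  have f' : mfree t.+1 [set e in L' | u \notin e].
    apply: (mfree_star (k := 1) (S := S)) => //; first by move: big; clear; lia.
    move=> f fS fc uf; have : #|f :\ u| = 1%N by move: fc; rewrite (cardsD1 u) uf; clear; lia.
    move=> /eqP/cards1P [c fE]; have fE' : f = [set u; c] by rewrite -(setD1K uf) fE.
    have : c \in f :\ u by rewrite fE inE.
    rewrite !inE => /andP [cu /(subsetP fS) cS]; have [cb|cb] := eqVneq c b.
      by rewrite fE' cb.
    have := sh _ b c ubL (set22 _ _) cS _ (rlt _ _ (bmax _ cS) cb).
    rewrite !inE (negPf cu) (negPf cb) => /(_ isT); congr (_ \in L').
    by rewrite fE'; apply/setP => v; rewrite !inE; case: (eqVneq v b) => [->|] //=;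
       rewrite ?orbF ?(eq_sym b) ?(negPf cb) ?(negPf ub) //= orbC.
  apply: le_trans (pred_lam_star u x0 uL' LS') _.
  have cSu : (#|S :\ u| < n)%N by move: Sn; rewrite (cardsD1 u S) uS.
  have := IH _ _ _ cSu (uniform_sub (restr_sub _ _) uL') (restr_powerset u LS') f'.
  rewrite elsym1 (totD1 _ uS) => h.
  have := x1 u; have := x0 u; have := tot_ge0 (S :\ u) x0 => w0 u0 u1.
  have : x u * tot x (S :\ u) <= tot x (S :\ u) by rewrite ler_piMl.
  have : 0 <= t.+1%:R * x u :> R by rewrite mulr_ge0 ?ler0n.
  rewrite mulrDr -{2}natr1 mulrDl mul1r; lra.
have LSb : L' \subset powerset (S :\ b).
  apply/subsetP => e eL; have eS : e \subset S by have := subsetP LS' _ eL; rewrite inE.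
  rewrite inE subsetD1 eS; apply/negP => be.
  have : #|e :\ b| = 1%N by have := forall_inP uL' _ eL; rewrite (cardsD1 b) be; clear; lia.
  move=> /eqP/cards1P [c eE]; have eE' : e = [set b; c] by rewrite -(setD1K be) eE.
  have : c \in e :\ b by rewrite eE inE.
  rewrite !inE => /andP [cb ce]; have [cu|cu] := eqVneq c u.
    by move: ubL; rewrite setUC -cu -eE' eL.
  have cS : c \in S by apply: (subsetP eS).
  have ub : u != b.
    apply/eqP => E; have := umin _ cS; have := bmax _ cS => h1 h2.
    by have := rlt _ _ h1 cb; rewrite -E ltnNge h2.
  have := sh _ c u eL ce uS _ (rlt _ _ (umin _ cS) _).
  rewrite eE' !inE (negPf ub) eq_sym (negPf cu) => /(_ isT isT).
  rewrite (_ : u |: _ = [set u; b]) ?(negPf ubL) //.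
  apply/setP => v; rewrite !inE; case: (eqVneq v c) => [->|] //=; rewrite ?orbF //.
  by rewrite (negPf cb) (negPf cu).
have cSb : (#|S :\ b| < n)%N by move: Sn; rewrite (cardsD1 b S) bS.
apply: le_trans (IH _ _ _ cSb uL' LSb fL') _.
by rewrite ler_wpM2l ?ler0n // totS // subsetDl.
Qed.

End Matchings.

(** * Lagrangians of 3-graphs with bounded matching number *)

Section TripleLagrangian.
Import Order.TTheory GRing.Theory Num.Theory.
Local Open Scope ring_scope.
Variables (R : realFieldType) (V : finType).
Implicit Types (x : V -> R) (e D S : {set V}) (G H P M : {set {set V}}).

Lemma mac3E n : mac R 3 n.+2 = n%:R * (n%:R + 1) / (6 * (n%:R + 2) ^+ 2).
Proof.
have E : 6 * 'C(n.+2, 3)%:R = n%:R * (n%:R + 1) * (n%:R + 2) :> R.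
  have : (3`! * 'C(n.+2, 3) = n * n.+1 * n.+2)%N.
    by rewrite mulnC bin_ffact !ffactnS ffactn0 /=; ring.
  move=> /(congr1 (fun k => k%:R : R)); rewrite !natrM => ->.
  by rewrite -!natr1; ring.
have n2 : n%:R + 2 != 0 :> R by rewrite (_ : n%:R + 2 = n.+2%:R) ?pnatr_eq0 // -!natr1; ring.
have -> : mac R 3 n.+2 = 6 * 'C(n.+2, 3)%:R / (6 * (n%:R + 2) ^+ 3).
  rewrite /mac (_ : n.+2%:R = n%:R + 2 :> R); last by rewrite -!natr1; ring.
  by field.
by rewrite E; field.
Qed.

(** A complete 3-graph without [t + 1] disjoint triples has at most [3 t + 2] vertices. *)
Definition clique3 t := mac R 3 (3 * t).+2.
(** The competitor of the clique: the maximum over [y] in [[0, 1]] of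
    [y (1 - y)^2 / 2 + clique3 t (1 - y)^3]. It models a vertex of weight [y] joined to all pairs,
    on top of a 3-graph without [t + 1] disjoint triples. *)
Definition star3 t : R :=
  2 / 3 * ((3 * t%:R + 2) ^+ 2 / ((6 * t%:R + 3) * (3 * t%:R + 4))) ^+ 2.

Lemma clique3E t : clique3 t = t%:R * (3 * t%:R + 1) / (2 * (3 * t%:R + 2) ^+ 2).
Proof.
rewrite /clique3 mac3E natrM.
by field; have : 0 <= t%:R :> R := ler0n _ _; move=> ?; apply: lt0r_neq0; lra.
Qed.

Lemma clique3_ge0 t : 0 <= clique3 t.
Proof. exact: mac_ge0. Qed.

(* With [k = 3 - 6 clique3 t] and [u = k (W - y)] this is [(u - 2 W)^2 (u + W) >= 0]. *)
Lemma star3_bound t (y W : R) : 0 <= y <= W ->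
  y * (W - y) ^+ 2 / 2 + clique3 t * (W - y) ^+ 3 <= star3 t * W ^+ 3.
Proof.
move=> /andP [y0 yW]; have T0 : 0 <= t%:R :> R := ler0n _ _.
rewrite clique3E /star3; move: t%:R T0 => T T0.
set s := 3 * T + 2; have s0 : 0 < s by rewrite /s; lra.
pose k := (6 * T + 3) * (3 * T + 4) / s ^+ 2.
have d0 : 0 < (6 * T + 3) * (3 * T + 4) by apply: mulr_gt0; lra.
have k0 : 0 < k by rewrite divr_gt0 // exprn_gt0.
have -> : s ^+ 2 / ((6 * T + 3) * (3 * T + 4)) = k^-1 by rewrite /k invf_div.
have -> : T * (3 * T + 1) / (2 * s ^+ 2) = (3 - k) / 6.
  by rewrite /k /s; field; apply: lt0r_neq0; rewrite -/s.
rewrite -subr_ge0.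
have -> : 2 / 3 * k^-1 ^+ 2 * W ^+ 3 - (y * (W - y) ^+ 2 / 2 + (3 - k) / 6 * (W - y) ^+ 3) =
  (k * (W - y) - 2 * W) ^+ 2 * (k * (W - y) + W) / (6 * k ^+ 2).
  by field; apply: lt0r_neq0.
apply: divr_ge0; last by rewrite mulr_ge0 // exprn_ge0 // ltW.
apply: mulr_ge0; first exact: sqr_ge0.
apply: addr_ge0; last by lra.
by rewrite mulr_ge0 ?subr_ge0 // ltW.
Qed.

(** The additional vertex raises the matching number by one, so the clique to compare with is that
    of [t + 1]. Over a common positive denominator the difference is a polynomial in [t] with
    positive coefficients. *)
Lemma star3_lt t : star3 t < clique3 t.+1.
Proof.
have T0 : 0 <= t%:R :> R := ler0n _ _.
rewrite clique3E /star3 -(natr1 t); move: t%:R T0 => T T0.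
rewrite -subr_gt0.
have -> : (T + 1) * (3 * (T + 1) + 1) / (2 * (3 * (T + 1) + 2) ^+ 2) -
  2 / 3 * ((3 * T + 2) ^+ 2 / ((6 * T + 3) * (3 * T + 4))) ^+ 2 =
  (9 * (3 * T + 2) ^+ 4 + 15 * (3 * T + 2) ^+ 3 - 30 * (3 * T + 2) ^+ 2 - 12 * (3 * T + 2) + 8)
  / (6 * (3 * T + 5) ^+ 2 * ((6 * T + 3) * (3 * T + 4)) ^+ 2).
  by field; repeat (apply/andP; split); apply: lt0r_neq0; lra.
apply: divr_gt0.
  have -> : 9 * (3 * T + 2) ^+ 4 + 15 * (3 * T + 2) ^+ 3 - 30 * (3 * T + 2) ^+ 2 - 12 * (3 * T + 2) + 8
   = 729 * T ^+ 4 + 2349 * T ^+ 3 + 2484 * T ^+ 2 + 1008 * T + 128 by ring.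
  have h2 := exprn_ge0 2 T0; have h3 := exprn_ge0 3 T0; have h4 := exprn_ge0 4 T0; lra.
by apply: mulr_gt0; [apply: mulr_gt0 => // |]; rewrite exprn_gt0 // ?mulr_gt0 //; lra.
Qed.

(** Dropping one vertex of the clique costs a definite amount; for [t = 0] both values vanish. *)
Lemma clique3_gap t : mac R 3 (3 * t).+1 < clique3 t \/ t = 0%N.
Proof.
case: t => [|t]; [by right|left].
have -> : (3 * t.+1).+1 = (3 * t).+2.+2 by lia.
rewrite mac3E clique3E -(natr1 (3 * t).+1) -(natr1 (3 * t)) -(natr1 t) natrM.
have T0 : 0 <= t%:R :> R := ler0n _ _; move: t%:R T0 => T T0.
rewrite -subr_gt0.
have -> : (T + 1) * (3 * (T + 1) + 1) / (2 * (3 * (T + 1) + 2) ^+ 2) -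
   (3 * T + 1 + 1) * (3 * T + 1 + 1 + 1) / (6 * (3 * T + 1 + 1 + 2) ^+ 2) =
  (T + 1) * (9 * T + 14) / (2 * (3 * T + 5) ^+ 2 * (3 * T + 4) ^+ 2).
  by field; repeat (apply/andP; split); apply: lt0r_neq0; lra.
by apply: divr_gt0; apply: mulr_gt0; rewrite ?mulr_gt0 ?exprn_gt0 //; lra.
Qed.

Lemma mfree0 H : mfree 0 H = false.
Proof.
apply/negP => /mfreeP /(_ set0 (sub0set _)); rewrite cards0 ltnn => h.
by suff : false by []; apply: h; apply/trivIsetP => A B; rewrite inE.
Qed.

Lemma star_step x H S u (c : R) : (forall v, 0 <= x v) -> uniform 3 H ->
  H \subset powerset S -> u \in S ->
  lam x [set e in H | u \notin e] <= c ->
  lam x H <= x u * (tot x S - x u) ^+ 2 / 2 + c.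
Proof.
move=> x0 uH HS uS hc; apply: le_trans (pred_lam_star u x0 uH HS) _.
rewrite lerD // -mulrA ler_wpM2l //.
by rewrite (totD1 _ uS) addrC addKr; apply: elsym2_le.
Qed.

Lemma merge_step x H S a b k0 : (forall v, 0 <= x v) -> uniform k0 H -> H \subset powerset S ->
  a \in S -> b \in S -> a != b -> (forall e, e \in H -> a \in e -> b \notin e) ->
  exists k o, [/\ (k == a) && (o == b) || (k == b) && (o == a),
    lam x H <= lam (mv x k o (x o)) [set e in H | o \notin e],
    (forall v, 0 <= mv x k o (x o) v) /\ tot (mv x k o (x o)) (S :\ o) = tot x S,
    [set e in H | o \notin e] \subset powerset (S :\ o) &
    (k != o /\ k \in S) /\ o \in S].
Proof.
move=> x0 uH HS aS bS ab unc.
have [k [o [ko hk]]] := merge_exists x0 ab unc.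
have [kS oS kno] : [/\ k \in S, o \in S & k != o].
  by case/orP: ko => /andP [/eqP -> /eqP ->]; rewrite // eq_sym.
have z : mv x k o (x o) o = 0 by rewrite /mv eq_sym (negPf kno) eqxx subrr.
exists k, o; split => //.
- by apply: le_trans (hk _ (x0 o)) _; rewrite (lam_zero _ z).
- split; first by apply: mv_ge0; rewrite // x0 lexx.
  have := tot_mv x (x o) kno kS oS; rewrite (totD1 _ oS) z add0r => ->.
  by [].
exact: restr_powerset.
Qed.

(** Induction on the number of vertices, with Maclaurin's inequality up to [3 t + 2] of them. Beyond
    that, [shift_step] either allows the heaviest vertex to be deleted with [t] lowered, where
    [star3_bound] and [star3_lt] finish, or the two lightest vertices to be merged. *)
Lemma lag3 t x H S : (forall v, 0 <= x v) -> uniform 3 H -> H \subset powerset S ->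
  mfree t.+1 H -> lam x H <= clique3 t * tot x S ^+ 3.
Proof.
have [n] := ubnP #|S|; elim: n t x H S => // n IH t x H S Sn x0 uH HS fH.
have [small|big] := leqP #|S| (3 * t).+2.
  exact: le_trans (lam_le_elsym x0 uH HS) (maclaurin' 3 x0 small).
have cS : (3 * t.+1 <= #|S|)%N by rewrite mulnS add3n.
have [H' [u [a [b [[uH' HS' fH' lH] [uS aS bS ab] _ alt]]]]] := shift_step x0 uH HS fH cS.
have cD v : v \in S -> (#|S :\ v| < n)%N by move=> vS; move: Sn; rewrite (cardsD1 v S) vS.
apply: le_trans lH _; case: alt => [fu|[unc _]].
  case: t fH fH' big cS fu => [|t] fH fH' big cS fu; first by rewrite mfree0 in fu.
  have h := IH t x _ _ (cD _ uS) x0 (uniform_sub (restr_sub _ _) uH') (restr_powerset u HS') fu.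
  apply: le_trans (star_step x0 uH' HS' uS h) _.
  have E : tot x (S :\ u) = tot x S - x u by rewrite (totD1 _ uS) addrC addKr.
  rewrite E; apply: le_trans (star3_bound t _) _; first by rewrite x0 le_tot.
  by rewrite ler_wpM2r ?exprn_ge0 ?tot_ge0 // ltW // star3_lt.
have [k [o [_ le1 [y0 E] HSo [_ oS]]]] := merge_step x0 uH' HS' aS bS ab unc.
apply: le_trans le1 _; rewrite -E; apply: IH => //; first exact: cD.
  exact: uniform_sub (restr_sub _ _) uH'.
exact: mfree_sub (restr_sub _ _) fH'.
Qed.

Lemma lag3_star t x H S u : (forall v, 0 <= x v) -> uniform 3 H -> H \subset powerset S ->
  u \in S -> mfree t.+1 [set e in H | u \notin e] -> lam x H <= star3 t * tot x S ^+ 3.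
Proof.
move=> x0 uH HS uS fu.
have h := lag3 x0 (uniform_sub (restr_sub _ _) uH) (restr_powerset u HS) fu.
apply: le_trans (star_step x0 uH HS uS h) _.
have E : tot x (S :\ u) = tot x S - x u by rewrite (totD1 _ uS) addrC addKr.
by rewrite E; apply: star3_bound; rewrite x0 le_tot.
Qed.

(** Used backwards: for a near-extremal weight no vertex [k] of [B] can be light, since the edges
    avoiding both [k] and the outside of [B] live on only [3 t + 1] vertices. *)
Lemma heavy_in t x H S (B : {set V}) k : (forall v, 0 <= x v) -> uniform 3 H -> H \subset powerset S ->
  B \subset S -> #|B| = (3 * t).+2 -> tot x S = 1 -> k \in B ->
  lam x H <= x k / 2 + mac R 3 (3 * t).+1 + tot x (S :\: B) / 2.
Proof.
move=> x0 uH HS BS Bc W1 kB.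
have l2 v : lam x (link H [set v]) <= 1 / 2.
  apply: le_trans (link_le_elsym v x0 uH HS) _; apply: le_trans (elsym2_le _ x0) _.
  rewrite ler_wpM2r ?invr_ge0 // expr_le1 // ?tot_ge0 //.
  by rewrite -W1 totS // subsetDl.
apply: le_trans (lam_hit H (k |: (S :\: B)) x0) _.
rewrite addrAC lerD //; last first.
  apply: le_trans (lam_le_elsym (S := B :\ k) x0 (uniform_sub (restr_sub _ _) uH) _) _.
    apply/subsetP => e; rewrite !inE => /andP [eH dj].
    have eS : e \subset S by have := subsetP HS _ eH; rewrite inE.
    rewrite subsetD1; apply/andP; split; last first.
      by rewrite (disjointFl dj) // setU11.
    apply/subsetP => v ve; have := disjointFr dj ve; rewrite !inE (subsetP eS) // andbT.
    by case: (v \in B); rewrite ?orbT.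
  apply: le_trans (maclaurin' 3 x0 (_ : _ <= (3 * t).+1)%N) _.
    by move: Bc; rewrite (cardsD1 k B) kB add1n => -[->].
  rewrite ler_piMr ?mac_ge0 // expr_le1 ?tot_ge0 // -W1 totS //.
  exact: subset_trans (subsetDl _ _) BS.
rewrite big_setU1 /=; last by rewrite !inE kB.
rewrite lerD //; first by have := ler_wpM2l (x0 k) (l2 k); rewrite mulrA mulr1.
rewrite /tot big_distrl /=; apply: ler_sum => v _.
by have := ler_wpM2l (x0 v) (l2 v); rewrite mulrA mulr1.
Qed.

(** The induction of [lag3] is rerun. The star alternative is too light by [lag3_star], so the two
    lightest vertices are merged. The merged vertex must then lie outside [B], so that splitting it
    again does no harm; only the case of [3 t + 3] vertices needs a direct argument. *)
Lemma lag3_stab t (eps dl : R) x H S : (0 < t)%N -> 0 < dl -> 0 <= eps ->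
  2 * dl + eps < clique3 t - mac R 3 (3 * t).+1 -> eps < dl ^+ 3 ->
  eps < clique3 t - star3 t.-1 ->
  (forall v, 0 <= x v) -> uniform 3 H -> H \subset powerset S -> mfree t.+1 H ->
  tot x S = 1 -> clique3 t - eps <= lam x H ->
  exists B : {set V}, [/\ B \subset S, #|B| = (3 * t).+2 & tot x (S :\: B) <= dl].
Proof.
move=> t0 dl0 eps0 e1 e2 e3.
have [n] := ubnP #|S|; elim: n x H S => // n IH x H S Sn x0 uH HS fH W1 near.
have [small|] := leqP #|S| (3 * t).+1.
  have := le_trans (lam_le_elsym x0 uH HS) (maclaurin' 3 x0 small).
  by rewrite W1 expr1n mulr1; move: near dl0 e1; clear; lra.
rewrite leq_eqVlt => /orP [/eqP cS|big].
  exists S; split => //; rewrite setDv /tot big_set0; exact: ltW.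
have cS : (3 * t.+1 <= #|S|)%N by rewrite mulnS add3n.
have [H' [u [a [b [[uH' HS' fH' lH] [uS aS bS ab] [mn1 mn2] alt]]]]] := shift_step x0 uH HS fH cS.
have cD v : v \in S -> (#|S :\ v| < n)%N by move=> vS; move: Sn; rewrite (cardsD1 v S) vS.
have {near} near : clique3 t - eps <= lam x H' by apply: le_trans near lH.
case: alt => [fu|[unc fb]].
  clear e1 fH fH' big cS IH; case: t t0 e3 near fu => // t _ /= e3 near fu.
  have := lag3_star x0 uH' HS' uS fu; rewrite W1 expr1n mulr1.
  by move: near e3; clear; lra.
move: big; rewrite leq_eqVlt => /orP [/eqP cS1|big].
  have [xb|xb] := lerP (x b) dl.
    exists (S :\ b); split; first exact: subsetDl.
      by move: cS1; rewrite (cardsD1 b S) bS add1n => -[].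
    rewrite setDDr setDv set0U (setIidPr _) ?sub1set //.
    by rewrite /tot big_set1.
  exfalso.
  pose S0 := (S :\ b) :\ a.
  have aSb : a \in S :\ b by rewrite !inE ab.
  have cS0 : #|S0| = (3 * t).+1.
    by move: cS1; rewrite (cardsD1 b S) bS (cardsD1 a (S :\ b)) aSb !add1n => -[].
  have lpow w z : w \in S -> z \in S -> w != z -> (forall e, e \in H' -> w \in e -> z \notin e) ->
     link H' [set w] \subset powerset ((S :\ w) :\ z).
    move=> wS zS wz un; apply/subsetP => e; rewrite mem_link1 => /andP [we wH].
    have := subsetP HS' _ wH; rewrite !inE !subsetD1 subUset => /andP [_ ->].
    rewrite we /=; have := un _ wH (setU11 _ _); rewrite !inE negb_or => /andP [] //.
  have unc' e : e \in H' -> b \in e -> a \notin e.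
    by move=> eH; apply: contraL => /(unc _ eH).
  (* The link of [b] is a graph on the [3 t + 1] vertices of [S0] without [t + 1] disjoint pairs, so
     it is not complete. Compared with the fully merged weight, the missing pair [P] together with
     [b] costs at least [dl ^+ 3], more than [eps]. *)
  have full : ~~ ([set e : {set V} | (e \subset S0) && (#|e| == 2%N)] \subset link H' [set b]).
    apply/negP => fl.
    have uL : uniform 2 [set e : {set V} | (e \subset S0) && (#|e| == 2%N)].
      by apply/forall_inP => e; rewrite inE => /andP[].
    have h01 (v : V) : 0 <= (fun=> 1 : R) v <= 1 by rewrite ler01 lexx.
    have LS0 : [set e : {set V} | (e \subset S0) && (#|e| == 2%N)] \subset powerset S0.
      by apply/subsetP => e; rewrite !inE => /andP[].
    have := graph_bound h01 uL LS0 (mfree_sub fl fb).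
    rewrite /lam (eq_bigr (fun=> 1)); last by move=> e _; rewrite /wt big1.
    rewrite /tot !sumr_const cS0 -natrM ler_nat cards_draws cS0.
    have : ('C((3 * t).+1, 2) * 2 = (3 * t).+1 * (3 * t))%N.
      by rewrite (_ : 2 = 2`!)%N // bin_ffact !ffactnS ffactn0 muln1.
    by move: t0; clear; nia.
  have [P] := subsetPn full; rewrite inE => /andP [PS /eqP Pc] PL.
  have S0S : S0 \subset S by apply: subset_trans (subsetDl _ _) (subsetDl _ _).
  have xS w : w \in S -> dl <= x w.
    by move=> /mn1 [_]; apply: le_trans; apply: ltW.
  have wP : dl ^+ 2 <= wt x P.
    rewrite -Pc -prodr_const /wt; apply: ler_prod => v vP.
    by rewrite (ltW dl0) xS // (subsetP S0S) // (subsetP PS).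
  have qb : lam x (link H' [set b]) + wt x P <= elsym x S0 2.
    have -> : lam x (link H' [set b]) + wt x P = lam x (P |: link H' [set b]).
      by rewrite /lam big_setU1 //= addrC.
    apply: lamS => //; rewrite subUset sub1set inE PS Pc eqxx /=.
    apply/subsetP => e eL; rewrite inE (forall_inP (link_uniform b uH') _ eL) andbT.
    have ba : b != a by rewrite eq_sym.
    by have := subsetP (lpow _ _ bS aS ba unc') _ eL; rewrite inE.
  have qa : lam x (link H' [set a]) <= elsym x S0 2.
    apply: lam_le_elsym => //; first exact: link_uniform.
    have -> : S0 = (S :\ a) :\ b by rewrite /S0 !setDDl setUC.
    exact: lpow.
  have qr : lam x [set e in H' | (a \notin e) && (b \notin e)] <= elsym x S0 3.
    apply: lam_le_elsym => //; first exact: uniform_sub (restr_sub _ _) uH'.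
    apply/subsetP => e; rewrite !inE => /and3P [eH ae be].
    by have := subsetP HS' _ eH; rewrite !subsetD1 inE => ->; rewrite ae be.
  have y0 : forall v, 0 <= mv x a b (x b) v by apply: mv_ge0; rewrite ?x0 ?lexx.
  have := maclaurin' (S := S :\ b) 3 y0 (_ : _ <= (3 * t).+2)%N.
  have -> : tot (mv x a b (x b)) (S :\ b) = 1.
    rewrite -W1 -(tot_mv x (x b) ab aS bS) [RHS](totD1 _ bS).
    by rewrite /mv (eq_sym b a) (negPf ab) eqxx subrr add0r.
  have eS0 k : elsym (mv x a b (x b)) S0 k = elsym x S0 k.
    apply: eq_lam => e; rewrite inE => /andP [/subsetP eS _] v /eS.
    by rewrite !inE /mv => /and3P [/negPf -> /negPf -> _].
  rewrite (elsymS _ _ aSb) -/S0 !eS0 {1}/mv eqxx expr1n mulr1.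
  move=> mc0.
  have mc := mc0 ltac:(by move: cS1; rewrite (cardsD1 b S) bS add1n => -[->]).
  move: near; rewrite (lam_two _ ab unc).
  have h1 := ler_wpM2l (x0 a) qa; have h2 := ler_wpM2l (x0 b) qb.
  have h3 : dl ^+ 3 <= x b * wt x P.
    rewrite exprS; apply: ler_pM => //; rewrite ?exprn_ge0 //; exact: ltW.
  move: mc h1 h2 h3 qr e2; rewrite -/(clique3 t) mulrDl !mulrDr; clear; lra.
have [k [o [ko le1 [y0 E] HSo [[kno kS] oS]]]] := merge_step x0 uH' HS' aS bS ab unc.
set y := mv x k o (x o) in le1 y0 E.
set H1 := [set e in H' | o \notin e] in le1 HSo.
have uH1 : uniform 3 H1 by apply: uniform_sub (restr_sub _ _) uH'.
have W1' : tot y (S :\ o) = 1 by rewrite E.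
have near1 : clique3 t - eps <= lam y H1 by apply: le_trans near le1.
have [B [BS Bc Bt]] := IH y H1 (S :\ o) (cD _ oS) y0 uH1 HSo
  (mfree_sub (restr_sub _ _) fH') W1' near1.
have yo : y o = 0 by rewrite /y /mv (eq_sym o) (negPf kno) eqxx subrr.
have oB : o \notin B by apply/negP => /(subsetP BS); rewrite !inE eqxx.
have [kB|kB] := boolP (k \in B); last first.
  exists B; split => //; first exact: subset_trans BS (subsetDl _ _).
  apply: le_trans Bt; rewrite -(tot_mv x (x o) kno) ?inE ?kS ?kB ?oS ?oB //.
  rewrite -/y (totD1 _ (_ : o \in S :\: B)) ?inE ?oS ?oB // yo add0r.
  by rewrite !setDDl setUC.
have := heavy_in y0 uH1 HSo BS Bc W1' kB.
have yk : y k <= x a *+ 2.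
  have xba : x b <= x a by have [_] := mn1 _ aS.
  by rewrite /y /mv eqxx; case/orP: ko => /andP [/eqP -> /eqP ->]; rewrite mulr2n; lra.
(* A vertex [w] outside [B] has weight at most [dl]. As [w] is not [b], the second lightest vertex
   [a] is no heavier, so the merged vertex weighs at most [2 dl], too little for a vertex of [B] by
   [heavy_in]. *)
have [w] : exists w, w \in (S :\ o) :\: B.
  apply/card_gt0P; rewrite cardsD (setIidPr BS) Bc; move: big.
  by rewrite (cardsD1 o S) oS; clear; lia.
rewrite !inE => /and3P [wB wo wS].
have wk : w != k by apply: contraNneq wB => ->.
have wb : w != b.
  by case/orP: ko => /andP [/eqP E1 /eqP E2]; [rewrite -E2 | rewrite -E1].
have := mn2 _ wS wb.
have : x w <= tot y ((S :\ o) :\: B).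
  have <- : y w = x w by rewrite /y /mv (negPf wk) (negPf wo).
  by apply: le_tot => //; rewrite !inE wB wo.
move: yk Bt near1 e1 dl0 eps0; rewrite mulr2n; clear; lra.
Qed.

End TripleLagrangian.

(** * 3-graphs with capped weights, and the degree constant *)

Section Capped.
Import Order.TTheory GRing.Theory Num.Theory.
Local Open Scope ring_scope.
Variables (R : realFieldType) (V : finType).
Implicit Types (x : V -> R) (e D S : {set V}) (G H P M : {set {set V}}).

(** At total weight [3 t + 2] the right side is the number of triples on [3 t + 2] unit weights;
    beyond it grows only quadratically, while the bound of [lag3] is cubic. The two lightest
    vertices are merged if the cap allows it; otherwise [b] is deleted and its link, a graph, is
    estimated by [graph_bound]. *)
Lemma capped3 t x H S : (forall v, 0 <= x v <= 1) -> uniform 3 H -> H \subset powerset S ->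
  mfree t.+1 H -> 2 <= tot x S -> lam x H <= t%:R * (tot x S * (tot x S - 1)) / 2.
Proof.
have [n] := ubnP #|S|; elim: n t x H S => // n IH t x H S Sn x01 uH HS fH W2.
have x0 v : 0 <= x v by have /andP[] := x01 v.
have x1 v : x v <= 1 by have /andP[] := x01 v.
have [t0|t0] := posnP t.
  by apply: le_trans (lag3 x0 uH HS fH) _; rewrite clique3E t0 !mul0r.
have t1 : 1 <= t%:R :> R by rewrite ler1n.
have [small|big] := lerP (tot x S) (3 * t%:R + 2).
  apply: le_trans (lag3 x0 uH HS fH) _; rewrite clique3E.
  have T0 : 0 <= t%:R :> R := ler0n _ _; move: t%:R T0 small => T T0 small.
  rewrite -subr_ge0.
  have -> : T * (tot x S * (tot x S - 1)) / 2 - T * (3 * T + 1) / (2 * (3 * T + 2) ^+ 2) * tot x S ^+ 3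
    = T * (tot x S * ((3 * T + 2 - tot x S) * ((3 * T + 1) * tot x S - (3 * T + 2)))) / (2 * (3 * T + 2) ^+ 2).
    by field; apply: lt0r_neq0; lra.
  have d0 : 0 <= 2 * (3 * T + 2) ^+ 2 by rewrite mulr_ge0 // sqr_ge0.
  apply: divr_ge0 => //; rewrite !mulr_ge0 //; [lra|lra|].
  have : 0 <= T * (tot x S - 1) by apply: mulr_ge0 => //; lra.
  by lra.
have cS : (3 * t.+1 <= #|S|)%N.
  suff : (3 * t).+2%:R < #|S|%:R :> R by rewrite ltr_nat; clear; lia.
  apply: lt_le_trans (_ : tot x S <= _).
    by apply: le_lt_trans big; rewrite -(natr1 (3 * t).+1) -(natr1 (3 * t)) natrM; lra.
  by rewrite -sumr_const; apply: ler_sum.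
have [H' [u [a [b [[uH' HS' fH' lH] [uS aS bS ab] [mn1 mn2] alt]]]]] := shift_step x0 uH HS fH cS.
have cD v : v \in S -> (#|S :\ v| < n)%N by move=> vS; move: Sn; rewrite (cardsD1 v S) vS.
have D1 v : v \in S -> tot x (S :\ v) = tot x S - x v.
  by move=> vS; rewrite (totD1 _ vS) addrC addKr.
have T0 : 0 <= t%:R :> R := ler0n _ _.
apply: le_trans lH _; case: alt => [fu|[unc fb]].
  case: t t0 t1 fH fH' cS big T0 fu => [//|t] _ t1 fH fH' cS big T0 fu.
  have W2' : 2 <= tot x (S :\ u) by rewrite D1 //; have := x1 u; move: big t1; clear; lra.
  have h := IH t x _ _ (cD _ uS) x01 (uniform_sub (restr_sub _ _) uH') (restr_powerset u HS') fu W2'.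
  apply: le_trans (star_step x0 uH' HS' uS h) _.
  rewrite D1 // -(natr1 t) -mulrDl ler_wpM2r ?invr_ge0 //.
  have t0 : 0 <= t%:R :> R := ler0n _ _.
  clear t1; move: (x0 u) (x1 u) W2 big t0; rewrite -(natr1 t); move: (x u) (tot x S) t%:R => y W T y0 y1 W2 WT T0'.
  have h1 : y * (W - y) ^+ 2 <= W * (W - 1).
    have h0 : 0 <= (1 - y) * (W ^+ 2 - 2 * W * (1 + y) + 1 + y + y ^+ 2).
      by clear h; apply: mulr_ge0; nra.
    have -> : y * (W - y) ^+ 2 = (W - 1) ^+ 2 - (1 - y) * (W ^+ 2 - 2 * W * (1 + y) + 1 + y + y ^+ 2).
      by ring.
    by move: h0 WT T0'; clear; rewrite expr2 !mulrBr !mulrBl; lra.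
  have h2 : T * ((W - y) * (W - y - 1)) <= T * (W * (W - 1)).
    by clear h h1; rewrite ler_wpM2l //; nra.
  by move: h1 h2; clear; lra.
have [ab1|ab1] := lerP (x a + x b) 1.
  have [k [o [ko le1 [y0 E] HSo [[kno kS] oS]]]] := merge_step x0 uH' HS' aS bS ab unc.
  apply: le_trans le1 _; rewrite -E; apply: IH => //; first exact: cD.
  - move=> v; rewrite y0 /= /mv; case: eqP => _; last first.
      by case: eqP => _; rewrite ?subrr ?ler01 ?x1.
    by case/orP: ko => /andP [/eqP -> /eqP ->]; rewrite // addrC.
  - exact: uniform_sub (restr_sub _ _) uH'.
  - exact: mfree_sub (restr_sub _ _) fH'.
  by rewrite E.
rewrite (lam_link1 x H' b).
have W2' : 2 <= tot x (S :\ b) by rewrite D1 //; have := x1 b; move: big t1; clear; lra.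
have h1 := IH t x _ _ (cD _ bS) x01 (uniform_sub (restr_sub _ _) uH') (restr_powerset b HS')
   (mfree_sub (restr_sub _ _) fH') W2'.
have h2 : lam x (link H' [set b]) <= t%:R * tot x ((S :\ b) :\ a).
  apply: graph_bound => //; first exact: link_uniform.
  apply/subsetP => e; rewrite mem_link1 => /andP [be bH].
  have := subsetP HS' _ bH; rewrite !inE !subsetD1 subUset => /andP [_ ->].
  rewrite be /=; apply/negP => ae; have := unc _ bH; rewrite !inE ae eqxx orbT.
  by move=> /(_ isT).
have aSb : a \in S :\ b by rewrite !inE ab.
have E : tot x ((S :\ b) :\ a) = tot x S - x b - x a.
  by rewrite -D1 // (totD1 _ aSb) addrC addKr.
rewrite E in h2; rewrite D1 // in h1.
have := ler_wpM2l (x0 b) h2.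
have xba : x b <= x a by have [_] := mn1 _ aS.
have h3 : 0 <= t%:R * (x b * (2 * x a + x b - 1)).
  by rewrite !mulr_ge0 //; move: xba ab1; clear; lra.
by move: h1 h3; clear; lra.
Qed.

Lemma wt_scale (c : R) x e : wt (fun v => c * x v) e = c ^+ #|e| * wt x e.
Proof. by rewrite /wt big_split /= prodr_const. Qed.

Lemma lam_scale k (c : R) x H : uniform k H -> lam (fun v => c * x v) H = c ^+ k * lam x H.
Proof.
move=> /forall_inP uH; rewrite /lam mulr_sumr; apply: eq_bigr => e /uH /eqP <-.
exact: wt_scale.
Qed.

Lemma tot_scale (c : R) x S : tot (fun v => c * x v) S = c * tot x S.
Proof. by rewrite /tot mulr_sumr. Qed.

Lemma capped3_scaled t (al : R) x H S : 0 < al -> (forall v, 0 <= x v <= al) -> uniform 3 H ->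
  H \subset powerset S -> mfree t.+1 H -> 2 * al <= tot x S ->
  lam x H <= t%:R * (al * (tot x S * (tot x S - al))) / 2.
Proof.
move=> al0 xal uH HS fH W2.
have x01 v : 0 <= al^-1 * x v <= 1.
  have /andP [h1 h2] := xal v; rewrite mulr_ge0 ?invr_ge0 ?(ltW al0) //=.
  by rewrite mulrC ler_pdivrMr // mul1r.
have aln : al != 0 by apply: lt0r_neq0.
have h := capped3 x01 uH HS fH; rewrite tot_scale (lam_scale _ _ uH) in h.
have h2 : 2 <= al^-1 * tot x S by rewrite mulrC ler_pdivlMr.
have := ler_wpM2l (exprn_ge0 3 (ltW al0)) (h h2).
have -> : al ^+ 3 * (al^-1 ^+ 3 * lam x H) = lam x H by field.
move/le_trans; apply.
by rewrite le_eqVlt; apply/orP; left; apply/eqP; field.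
Qed.

Lemma triples_exist D k : (3 * k <= #|D|)%N ->
  exists M, [/\ trivIset M, #|M| = k, uniform 3 M & cover M \subset D].
Proof.
elim: k D => [|k IH] D kD.
  exists set0; rewrite cards0 /cover big_set0 sub0set; split => //.
    by apply/trivIsetP => A; rewrite inE.
  by apply/forall_inP => e; rewrite inE.
have [A AD cA] : exists2 A : {set V}, A \subset D & #|A| = 3%N.
  by apply: subset_card; apply: leq_trans kD; rewrite mulnS leq_addr.
have [M [tM cM uM MD]] : exists M, [/\ trivIset M, #|M| = k, uniform 3 M & cover M \subset D :\: A].
  by apply: IH; rewrite cardsD (setIidPr AD) cA; move: kD; clear; lia.
have [] := @trivIsetU1 _ A M.
- move=> e eM; rewrite disjoint_sym; apply: disjointWl (_ : e \subset D :\: A) _.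
    by apply: subset_trans MD; apply: bigcup_sup.
  by rewrite -setI_eq0 setDE -setIA (setIC _ A) setICr setI0.
- exact: tM.
- by apply/negP => /(forall_inP uM); rewrite cards0.
move=> tU nU; exists (A |: M); rewrite tU cardsU1 nU cM; split => //.
  by apply/forall_inP => e; rewrite !inE => /orP [/eqP ->|/(forall_inP uM) //]; rewrite cA.
rewrite /cover bigcup_setU big_set1 subUset AD /=.
exact: subset_trans MD (subsetDl _ _).
Qed.

Definition covered G u w := [exists e in G, (u \in e) && (w \in e)].

(* [v] with [M] is a linear star with centre [v]; [KFfree] says that the [3t+1] vertices
   of such a star never form a clique of covered pairs. *)
Definition star_config t G v M := [/\ M \subset link G [set v], trivIset M & #|M| = t].

Definition KFfree t G := forall v M, star_config t G v M ->
  exists u w, [/\ u \in v |: cover M, w \in v |: cover M, u != w & ~~ covered G u w].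

(* With [T = t - 1] and [m = 3 T + 3] this is [binomial(m - 1, 3) / m ^ 3], the degree of
   every vertex of the balanced complete [m]-partite 4-graph of total weight 1; the
   Lagrangian of that 4-graph is [deg0 / 4]. *)
Definition deg0 T : R :=
  T%:R * (3 * T%:R + 1) * (3 * T%:R + 2) / (2 * (3 * T%:R + 3) ^+ 3).

(** In the balanced multipartite case a link lives on the other [3 T + 2] parts, of total weight
    [1 - 1/m]. *)
Lemma deg0E T : deg0 T = clique3 R T * (1 - (3 * T%:R + 3)^-1) ^+ 3.
Proof.
rewrite clique3E /deg0; have T0 : 0 <= T%:R :> R := ler0n _ _.
by field; apply/andP; split; apply: lt0r_neq0; lra.
Qed.

Lemma clique3_le T : clique3 R T <= 1 / 6.
Proof.
rewrite clique3E; have T0 : 0 <= T%:R :> R := ler0n _ _; move: T%:R T0 => z z0.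
rewrite ler_pdivrMr; first by nra.
by rewrite mulr_gt0 // exprn_gt0 //; lra.
Qed.

End Capped.

(** * The degree of the heaviest vertex when all pairs are covered *)

Section QuadLagrangian.
Import Order.TTheory GRing.Theory Num.Theory.
Local Open Scope ring_scope.
Variables (R : realFieldType).

Section Fixed.
Variable (V : finType).
Implicit Types (x : V -> R) (e D S : {set V}) (G H P M : {set {set V}}).

Lemma KFfree_sub t G H : G \subset H -> KFfree t H -> KFfree t G.
Proof.
move=> /subsetP GH kf v M [/subsetP ML tM cM].
have [|u [w [uc wc uw nc]]] := kf v M.
  split=> //; apply/subsetP => e /ML; rewrite !mem_link1 => /andP [->].
  exact: GH.
exists u, w; split=> //; apply: contra nc => /existsP [e /and3P [eG ue we]].
by apply/existsP; exists e; rewrite (GH _ eG) ue we.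
Qed.

Definition paircov G S := forall u w, u \in S -> w \in S -> u != w -> covered G u w.

(** Disjoint triples in the link of [v] form a star inside [S], where no pair is uncovered. *)
Lemma link_mfree t G S v : uniform 4 G -> G \subset powerset S -> KFfree t G ->
  paircov G S -> v \in S -> mfree t (link G [set v]).
Proof.
move=> uG GS kf pc vS; apply/mfreeP => M0 M0L tM0; rewrite ltnNge; apply/negP.
move=> /subset_card [M MM0 cM].
have [|u [w [uc wc uw]]] := kf v M.
  by split=> //; [apply: subset_trans M0L | apply: trivIsetS tM0].
have cS : v |: cover M \subset S.
  rewrite subUset sub1set vS; apply/bigcupsP => e eM.
  have := subsetP (link_powerset v GS) _ (subsetP M0L _ (subsetP MM0 _ eM)).
  by rewrite inE => /subset_trans; apply; apply: subsetDl.
by rewrite pc // (subsetP cS).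
Qed.

(** The capped bound with cap [1/m] and total weight [1 - 1/m]: the two available bounds on a link
    meet at [al = 1/m]. *)
Lemma deg0_cap T : deg0 R T =
  T%:R * ((3 * T%:R + 3)^-1 * (1 - (3 * T%:R + 3)^-1) * (1 - 2 * (3 * T%:R + 3)^-1)) / 2.
Proof.
rewrite /deg0; have T0 : 0 <= T%:R :> R := ler0n _ _.
by field; apply: lt0r_neq0; lra.
Qed.

(* A link of near-extremal weight cannot have total weight much above [1 - 1/m]: when the
   largest weight drops below [1/m], the capped bound decreases linearly. *)
Lemma link_normalised T x H S (al e : R) : (0 < T)%N -> 0 <= e -> 80 * e <= clique3 R T ->
  0 < al -> al <= 1 -> (forall v, 0 <= x v <= al) -> uniform 3 H -> H \subset powerset S ->
  mfree T.+1 H -> tot x S = 1 - al -> deg0 R T - e < lam x H ->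
  (clique3 R T - 80 * e) * (1 - al) ^+ 3 <= lam x H.
Proof.
move=> T0 e0 eA al0 al1 xal uH HS fH W near; apply: le_trans (ltW near).
have T1 : 1 <= T%:R :> R by rewrite ler1n.
have A6 := clique3_le R T.
have cap : 6 * al <= 1 -> lam x H <= T%:R * (al * ((1 - al) * (1 - 2 * al))) / 2.
  move=> al6; have := capped3_scaled al0 xal uH HS fH.
  rewrite W => /(_ _); rewrite (_ : 1 - al - al = 1 - 2 * al); last by ring.
  by apply; move: al6; clear; lra.
rewrite (deg0E R T); set w := 1 - (3 * T%:R + 3)^-1.
have m1 : 0 < (3 * T%:R + 3 : R)^-1 <= 6^-1.
  rewrite invr_gt0 lef_pV2 ?posrE; move: T1; clear; lra.
have w1 : 5 / 6 <= w <= 1 by move: m1; rewrite /w; clear; lra.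
(* Below [1/m <= 1/6] the expression [al (1 - al) (1 - 2 al)] grows with slope at least 1/6. A
   deficit of [2 e] therefore lets [al] fall short of [1/m] by at most [12 e]. *)
have : 1 - al <= w + 12 * e.
  have [h|h] := lerP (3 * T%:R + 3 : R)^-1 al.
    by move: h e0; rewrite /w; clear; lra.
  have al6 : 6 * al <= 1 by move: h m1; clear; lra.
  have := cap al6; move: near; rewrite deg0_cap -/w.
  have -> : w = 1 - (3 * T%:R + 3 : R)^-1 by [].
  move: (3 * T%:R + 3 : R)^-1 h m1 => b h m1 h1 h2.
  have h3 : T%:R * (b * (1 - b) * (1 - 2 * b) - al * ((1 - al) * (1 - 2 * al))) <= 2 * e.
    by move: h1 h2; clear; lra.
  have h4 : (b - al) / 6 <= b * (1 - b) * (1 - 2 * b) - al * ((1 - al) * (1 - 2 * al)).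
    rewrite -subr_ge0.
    have -> : b * (1 - b) * (1 - 2 * b) - al * ((1 - al) * (1 - 2 * al)) - (b - al) / 6 =
      (b - al) * (5 / 6 - 3 * (b + al) + 2 * (b ^+ 2 + b * al + al ^+ 2)) by field.
    apply: mulr_ge0; first by rewrite subr_ge0 ltW.
    suff : 0 <= (1 / 6 - b) * (1 / 6 - b) + (1 / 6 - al) * (1 / 6 - al) + b * al + b ^+ 2 + al ^+ 2 + b * al.
      move: h m1 al0 al6; clear; nra.
    by clear -m1 al0 al6; nra.
  have h5 : (b - al) / 6 <= T%:R * ((b - al) / 6).
    by rewrite ler_peMl // divr_ge0 // subr_ge0 ltW.
  have h6 := ler_wpM2l (ler0n R T) h4.
  by move: h3 h5 h6; clear; lra.
move: al1 al0 => al1 al0 hw.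
have [l1 l2] : 0 <= 1 - al /\ 1 - al <= 1 by move: al1 al0; clear; lra.
(* Cubing numbers in [[0, 1]] at most triples the error. In the product with [clique3 - 80 e] this
   gains at most [36 e / 6], while [80 e] times [w ^+ 3 >= 1/8] loses at least [10 e]; hence the
   constant 80. *)
have h3 : (1 - al) ^+ 3 <= w ^+ 3 + 36 * e.
  have [h|h] := lerP (1 - al) w.
    have : (1 - al) ^+ 3 <= w ^+ 3 by rewrite ler_pXn2r ?nnegrE //; move: w1; clear; lra.
    by move: e0; clear; lra.
  have : (1 - al) ^+ 3 - w ^+ 3 = (1 - al - w) * ((1 - al) ^+ 2 + (1 - al) * w + w ^+ 2) by ring.
  have : (1 - al) ^+ 2 + (1 - al) * w + w ^+ 2 <= 3 by move: l1 l2 w1; clear; nra.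
  have : 0 <= 1 - al - w by move: h; clear; lra.
  move: ((1 - al) ^+ 2 + (1 - al) * w + w ^+ 2) => q d0 q3 E; move: (1 - al) hw d0 q3 E => z hw d0 q3 E.
  have : (z - w) * q <= (z - w) * 3 by rewrite ler_wpM2l.
  by move: E hw e0; clear; lra.
have w3 : 1 / 8 <= w ^+ 3.
  have -> : 1 / 8 = (1 / 2) ^+ 3 :> R by field.
  by rewrite ler_pXn2r ?nnegrE //; move: w1; clear; lra.
have A0 : 0 <= clique3 R T - 80 * e by rewrite subr_ge0.
have := ler_wpM2l A0 h3.
have := ler_wpM2l e0 w3.
have : clique3 R T * e <= 1 / 6 * e by rewrite ler_wpM2r.
have : 0 <= e * e by rewrite mulr_ge0.
by move: e0; clear; lra.
Qed.

(** The edges that meet [S :\: B] contribute at most half the weight of that set. The others are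
    bounded by the clique on [B], and a missing triple would lower that bound by [gap ^+ 3]. *)
Lemma full_in t x H S (B : {set V}) (gap : R) : (forall v, 0 <= x v) -> uniform 3 H ->
  H \subset powerset S -> B \subset S -> #|B| = (3 * t).+2 -> tot x S = 1 ->
  0 <= gap -> (forall v, v \in B -> gap <= x v) ->
  clique3 R t + tot x (S :\: B) / 2 < lam x H + gap ^+ 3 ->
  forall P : {set V}, P \subset B -> #|P| = 3%N -> P \in H.
Proof.
move=> x0 uH HS BS Bc W1 g0 gB big P PB Pc; apply/negPn/negP => PH.
have l2 v : lam x (link H [set v]) <= 1 / 2.
  apply: le_trans (link_le_elsym v x0 uH HS) _; apply: le_trans (elsym2_le _ x0) _.
  rewrite ler_wpM2r ?invr_ge0 // expr_le1 // ?tot_ge0 //.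
  by rewrite -W1 totS // subsetDl.
have gP : gap ^+ 3 <= wt x P.
  rewrite -Pc -prodr_const /wt; apply: ler_prod => v vP.
  by rewrite g0 gB // (subsetP PB).
have h1 : lam x [set e in H | [disjoint e & S :\: B]] + wt x P <= clique3 R t.
  rewrite (_ : _ + _ = lam x (P |: [set e in H | [disjoint e & S :\: B]])); last first.
    by rewrite /lam big_setU1 /= ?inE ?(negPf PH) // addrC.
  apply: le_trans (_ : _ <= elsym x B 3) _.
    apply: lam_le_elsym => //.
      apply/forall_inP => e; rewrite !inE => /orP [/eqP ->|/andP [eH _]]; first by rewrite Pc.
      exact: (forall_inP uH).
    apply/subsetP => e; rewrite !inE => /orP [/eqP -> //|/andP [eH dj]].
    apply/subsetP => v ve; have := disjointFr dj ve.
    have eS : e \subset S by have := subsetP HS _ eH; rewrite inE.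
    by rewrite inE (subsetP eS) // andbT => /negbFE.
  have := maclaurin' (S := B) 3 x0 (_ : _ <= (3 * t).+2)%N; rewrite Bc leqnn => /(_ isT) /le_trans.
  apply; rewrite ler_piMr ?mac_ge0 // expr_le1 ?tot_ge0 // -W1; exact: totS.
have h2 : \sum_(v in S :\: B) x v * lam x (link H [set v]) <= tot x (S :\: B) / 2.
  rewrite /tot big_distrl /=; apply: ler_sum => v _.
  by have := ler_wpM2l (x0 v) (l2 v); rewrite mulrA mulr1.
by move: (lam_hit H (S :\: B) x0) h1 h2 gP big; clear; lra.
Qed.

(** [f] meets the [3 T + 2] vertices of [B] in at most two, so [T] disjoint triples of the clique
    remain beside it. *)
Lemma clique_extra T H S (B : {set V}) f : H \subset powerset S -> mfree T.+1 H ->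
  (forall P : {set V}, P \subset B -> #|P| = 3%N -> P \in H) -> #|B| = (3 * T).+2 ->
  f \in H -> #|f| = 3%N -> ~~ (f \subset B) -> False.
Proof.
move=> HS fH full Bc fH1 fc fB.
have : (3 * T <= #|B :\: f|)%N.
  have : (#|f :&: B| < 3)%N.
    rewrite -fc proper_card // properE subsetIl /=.
    by apply: contra fB; rewrite subsetI => /andP[].
  have := cardsD B f; rewrite Bc (setIC B); clear; lia.
move=> /triples_exist [M [tM cM uM MB]].
have eMB e : e \in M -> e \subset B :\: f.
  by move=> eM; apply: subset_trans MB; apply: bigcup_sup.
have [] := @trivIsetU1 _ f M.
- move=> e eM; rewrite disjoint_sym; apply: disjointWl (eMB e eM) _.
  by rewrite -setI_eq0 setDE -setIA (setIC _ f) setICr setI0.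
- exact: tM.
- by apply/negP => /(forall_inP uM); rewrite cards0.
move=> tU nU; have /mfreeP/(_ _ _ tU) := fH.
rewrite cardsU1 nU cM add1n ltnn => h; suff : false by []; apply: h.
apply/subsetP => e; rewrite !inE => /orP [/eqP -> //|eM].
apply: full; first exact: subset_trans (eMB e eM) (subsetDl _ _).
exact/eqP/(forall_inP uM).
Qed.

End Fixed.

(** A heavier link would, once normalised, contain a clique on [3 T + 2] vertices. There is a
    further vertex [u] besides these and [v]; the edge covering [u] and [v] gives a link triple
    leaving the clique, hence one disjoint triple too many. [eps] does not depend on the hypergraph,
    as the later constants must serve all orders. *)
Lemma lag4 T : (0 < T)%N -> exists2 eps : R, 0 < eps &
  forall (V : finType) (G : {set {set V}}) (S : {set V}) (x : V -> R) v,
  uniform 4 G -> G \subset powerset S -> KFfree T.+1 G -> paircov G S ->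
  (3 * T + 4 <= #|S|)%N -> (forall w, 0 <= x w) -> (forall w, w \notin S -> x w = 0) ->
  tot x S = 1 -> v \in S -> (forall w, w \in S -> x w <= x v) ->
  lam x (link G [set v]) <= deg0 R T - eps.
Proof.
move=> T0.
have [gap0|E] := clique3_gap R T; last by rewrite E in T0.
have T1 : 1 <= T%:R :> R by rewrite ler1n.
pose gap := clique3 R T - mac R 3 (3 * T).+1.
have {}gap0 : 0 < gap by rewrite subr_gt0.
have A6 := clique3_le R T.
have mac0 := mac_ge0 R 3 (3 * T).+1.
have gap6 : gap <= 1 / 6 by move: A6 mac0; rewrite /gap; clear; lra.
have st0 : 0 < clique3 R T - star3 R T.-1.
  by rewrite subr_gt0; case: T T0 {T1 gap gap0 A6 mac0 gap6} => // T _; apply: star3_lt.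
have A0 : 0 < clique3 R T.
  by move: gap0 mac0; rewrite /gap; clear; lra.
have D0 : 0 < deg0 R T by rewrite divr_gt0 ?mulr_gt0 ?exprn_gt0 //; move: T1; clear; lra.
(* Chosen so that the weight [dl] lost outside [B] costs less than a missing triple of weight
   [gap ^+ 3 = 2 dl]. Below, [e0 < dl ^+ 3] is what [lag3_stab] asks for, and the division by 80
   comes from [link_normalised]. *)
pose dl := gap ^+ 3 / 2.
have g3 : gap ^+ 3 <= gap / 36.
  have : gap ^+ 2 <= 1 / 36 by move: gap0 gap6; clear; nra.
  by move=> /(ler_wpM2l (ltW gap0)); rewrite -exprS; clear; lra.
have dl0 : 0 < dl by rewrite divr_gt0 // exprn_gt0.
have dlg : dl <= gap / 72 by rewrite /dl; move: g3; clear; lra.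
have dl1 : dl ^+ 3 <= dl / 36.
  have : dl ^+ 2 <= 1 / 36 by move: dl0 dlg gap6; clear; nra.
  by move=> /(ler_wpM2l (ltW dl0)); rewrite -exprS; clear; lra.
have dl30 : 0 < dl ^+ 3 by rewrite exprn_gt0.
pose e0 := Num.min (dl ^+ 3) (Num.min (clique3 R T - star3 R T.-1) (deg0 R T)) / 2.
have e00 : 0 < e0 by rewrite /e0 divr_gt0 // !lt_min dl30 st0 D0.
have [e1 [e2 e3]] : e0 < dl ^+ 3 /\ (e0 < clique3 R T - star3 R T.-1 /\ e0 < deg0 R T).
  have := e00; rewrite /e0; set q := Num.min _ _ => q0.
  have : q <= Num.min (dl ^+ 3) (Num.min (clique3 R T - star3 R T.-1) (deg0 R T)) by [].
  rewrite !le_min => /and3P [q1 q2 q3].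
  by move: q0 q1 q2 q3; clear; split; [|split]; lra.
exists (e0 / 80); first by rewrite divr_gt0.
move=> V G S x v uG GS kf pc cS x0 xS W1 vS mx; rewrite leNgt; apply/negP => near.
set H := link G [set v] in near.
have uH : uniform 3 H by apply: link_uniform.
have HS : H \subset powerset (S :\ v) by apply: link_powerset.
have fH : mfree T.+1 H by apply: link_mfree pc vS.
have Wv : tot x (S :\ v) = 1 - x v by rewrite -W1 (totD1 _ vS) addrC addKr.
have xv0 : 0 < x v.
  rewrite lt_neqAle x0 andbT; apply/eqP => E.
  have : tot x S = 0.
    by rewrite /tot big1 // => w wS; apply/le_anti; rewrite x0 E mx.
  by rewrite W1 => /eqP; rewrite oner_eq0.
have xv1 : x v <= 1 by rewrite -W1 le_tot.
have xal w : 0 <= x w <= x v.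
  by rewrite x0 /=; have [/mx //|/xS ->] := boolP (w \in S).
have norm := link_normalised (e := e0 / 80) T0 _ _ xv0 xv1 xal uH HS fH Wv near.
have {norm} norm : (clique3 R T - e0) * (1 - x v) ^+ 3 <= lam x H.
  rewrite (_ : e0 = 80 * (e0 / 80)); last by field.
  by apply: norm; move: e00 e1 dl1 dlg gap6 mac0; rewrite /gap; clear; lra.
have [xv1'|xv1'] := eqVneq (x v) 1.
  have : lam x H <= 0.
    apply: le_trans (lag3 x0 uH HS fH) _; rewrite Wv xv1' subrr expr0n /= mulr0.
    exact: lexx.
  by move: near e3 e00; clear; lra.
have W0 : 0 < 1 - x v by rewrite subr_gt0 lt_neqAle xv1' xv1.
pose y w := (1 - x v)^-1 * x w.
have y0 w : 0 <= y w by rewrite mulr_ge0 // invr_ge0 ltW.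
have Wy : tot y (S :\ v) = 1 by rewrite /y tot_scale Wv mulVf // lt0r_neq0.
have ly : clique3 R T - e0 <= lam y H.
  by rewrite (lam_scale _ _ uH) exprVn mulrC ler_pdivlMr // exprn_gt0.
have dg : 2 * dl + e0 < clique3 R T - mac R 3 (3 * T).+1.
  by move: e1 dl1 dlg gap0; rewrite -/gap; clear; lra.
have [B [BS Bc Bt]] := lag3_stab T0 dl0 (ltW e00) dg e1 e2 y0 uH HS fH Wy ly.
have yB w : w \in B -> gap <= y w.
  move=> wB; have := heavy_in y0 uH HS BS Bc Wy wB.
  by move: ly Bt e1 dl1 dlg gap0; rewrite /gap; clear; lra.
have full := full_in y0 uH HS BS Bc Wy (ltW gap0) yB.
have {}full (P : {set V}) : P \subset B -> #|P| = 3%N -> P \in H.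
  apply: full; have -> : gap ^+ 3 = 2 * dl by rewrite /dl; field.
  by move: ly Bt e1 dl1 dl0; clearbody dl; clear; lra.
have [u] : exists u, u \in (S :\ v) :\: B.
  apply/card_gt0P; rewrite cardsD (setIidPr BS) Bc; move: cS.
  by rewrite (cardsD1 v S) vS; clear; lia.
rewrite !inE => /and3P [uB uv uS].
have /existsP [e /and3P [eG ue ve]] := pc _ _ uS vS uv.
have fH1 : e :\ v \in H by rewrite mem_link1 !inE eqxx setD1K.
apply: (clique_extra HS fH full Bc fH1).
  exact/eqP/(forall_inP uH).
by apply/subsetPn; exists u; rewrite ?inE ?uv.
Qed.

End QuadLagrangian.

(** * Degrees, general moves of weight, and vertices of low degree *)

Section Bound.
Import Order.TTheory GRing.Theory Num.Theory.
Local Open Scope ring_scope.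

Section Generic.
Variables (R : realFieldType) (V : finType).
Implicit Types (x : V -> R) (e D S : {set V}) (G H P M : {set {set V}}).

Definition deg x G v := lam x (link G [set v]).

Lemma mac4E T : mac R 4 (3 * T + 3) = deg0 R T / 4.
Proof.
have E : 24 * 'C(3 * T + 3, 4)%:R = (3 * T%:R) * (3 * T%:R + 1) * (3 * T%:R + 2) * (3 * T%:R + 3) :> R.
  have : (4`! * 'C(3 * T + 3, 4) = 3 * T * (3 * T).+1 * (3 * T).+2 * (3 * T).+3)%N.
    by rewrite mulnC bin_ffact addn3 !ffactnS ffactn0 /=; ring.
  move=> /(congr1 (fun k => k%:R : R)); rewrite !natrM => ->.
  by rewrite -(natr1 (3 * T).+2) -(natr1 (3 * T).+1) -(natr1 (3 * T)) natrM; ring.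
have T0 : 0 <= T%:R :> R := ler0n _ _.
rewrite /mac natrD natrM /deg0.
have -> : 'C(3 * T + 3, 4)%:R = (3 * T%:R) * (3 * T%:R + 1) * (3 * T%:R + 2) * (3 * T%:R + 3) / 24 :> R.
  by rewrite -E; field.
by field; apply: lt0r_neq0; lra.
Qed.

Lemma deg0_ge0 T : 0 <= deg0 R T.
Proof. by rewrite (deg0E R) mulr_ge0 ?clique3_ge0 // exprn_ge0 // subr_ge0 invf_le1; have : 0 <= T%:R :> R := ler0n _ _; lra. Qed.

Lemma deg0_le T : deg0 R T <= 1 / 6.
Proof.
apply: le_trans (clique3_le R T); rewrite deg0E ler_piMr ?clique3_ge0 //.
have T0 : 0 <= T%:R :> R := ler0n _ _.
have m0 : 0 < (3 * T%:R + 3 : R) by lra.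
have i0 : 0 < (3 * T%:R + 3 : R)^-1 by rewrite invr_gt0.
have i1 : (3 * T%:R + 3 : R)^-1 <= 1 by rewrite invf_le1 //; lra.
by apply: exprn_ile1; move: i0 i1; clear; lra.
Qed.

Lemma disjoint2 e u v : [disjoint e & [set u; v]] = (u \notin e) && (v \notin e).
Proof. by rewrite disjoint_sym disjoints_subset subUset !sub1set !inE. Qed.

Lemma link_link1 H u v : u != v -> link (link H [set u]) [set v] = link H [set u; v].
Proof.
move=> uv; apply/setP => e; rewrite !mem_link1 !inE disjoint2 (negPf uv) /=.
by rewrite setUA; case: (u \in e); case: (v \in e).
Qed.

(** In contrast to [lam_mv], edges through both vertices are allowed; they produce the quadratic
    term. *)
Lemma lam_mv_gen x H k o s : k != o ->
  lam (mv x k o s) H =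
  lam x H + s * (deg x H k - deg x H o) - s ^+ 2 * lam x (link H [set k; o]).
Proof.
move=> ko; have ok : o != k by rewrite eq_sym.
have four (z : V -> R) : lam z H = z k * (z o * lam z (link H [set k; o]) +
    lam z [set e in link H [set k] | o \notin e]) +
   (z o * lam z [set e in link H [set o] | k \notin e] + lam z [set e in H | (k \notin e) && (o \notin e)]).
  rewrite (lam_link1 z H k) (lam_link1 z (link H [set k]) o) link_link1 //.
  rewrite (lam_link1 z [set e in H | _] o); congr (_ + (_ * _ + _)).
    congr lam; apply/setP => e; rewrite mem_link1 !inE (disjoint_sym e) disjoints1 (negPf ko) /=.
    by case: (o \in e); case: (k \in e); rewrite ?andbF ?andbT.
  by congr lam; apply/setP => e; rewrite !inE andbA.
have dk : deg x H k = x o * lam x (link H [set k; o]) + lam x [set e in link H [set k] | o \notin e].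
  by rewrite /deg (lam_link1 x (link H [set k]) o) link_link1.
have do_ : deg x H o = x k * lam x (link H [set k; o]) + lam x [set e in link H [set o] | k \notin e].
  by rewrite /deg (lam_link1 x (link H [set o]) k) link_link1 // setUC.
have mvE e : k \notin e -> o \notin e -> {in e, mv x k o s =1 x}.
  move=> ke oe v ve; rewrite /mv; case: eqP => [E|_]; first by rewrite -E ve in ke.
  by case: eqP => [E|//]; rewrite -E ve in oe.
rewrite (four (mv x k o s)) (four x) dk do_.
rewrite (eq_lam (x := mv x k o s) (y := x) (H := link _ [set k; o])); last first.
  by move=> e; rewrite inE disjoint2 => /andP [/andP [ke oe] _]; apply: mvE.
rewrite (eq_lam (x := mv x k o s) (y := x) (H := [set _ in link _ [set k] | _])); last first.
  by move=> e; rewrite inE mem_link1 => /andP [/andP [ke _] oe]; apply: mvE.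
rewrite (eq_lam (x := mv x k o s) (y := x) (H := [set _ in link _ [set o] | _])); last first.
  by move=> e; rewrite inE mem_link1 => /andP [/andP [oe _] ke]; apply: mvE.
rewrite (eq_lam (x := mv x k o s) (y := x) (H := [set _ in H | _])); last first.
  by move=> e; rewrite inE => /and3P [_ ke oe]; apply: mvE.
by rewrite /mv eqxx (negPf ok) eqxx; ring.
Qed.

Lemma link_card k H D : uniform k H -> uniform (k - #|D|) (link H D).
Proof.
move=> /forall_inP uH; apply/forall_inP => e; rewrite inE => /andP [dj /uH].
by rewrite cardsU setIC (disjoint_setI0 dj) cards0 subn0 => /eqP <-; rewrite addKn.
Qed.

Lemma lam_le1 k x H : (forall v, 0 <= x v) -> uniform k H -> tot x [set: V] = 1 -> lam x H <= 1.
Proof.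
move=> x0 uH W1.
have HT : H \subset powerset [set: V] by apply/subsetP => e _; rewrite inE subsetT.
apply: le_trans (lam_le_elsym x0 uH HT) _.
apply: le_trans (maclaurin' k x0 (leqnn _)) _; rewrite W1 expr1n mulr1 /mac.
have [n0|n0] := posnP #|[set: V]|.
  by rewrite n0 bin0n; case: k {uH} => [|k]; rewrite ?expr0 ?divr1 ?mul0r ?ler01.
rewrite ler_pdivrMr ?exprn_gt0 ?ltr0n // mul1r -natrX ler_nat.
move: #|_| {n0} => n; apply: leq_trans (_ : n ^_ k <= _)%N.
  by rewrite -bin_ffact leq_pmulr // fact_gt0.
elim: k {uH} => [|k IH]; first by rewrite ffactn0.
by rewrite ffactnSr expnSr leq_mul // leq_subr.
Qed.

(** Suppose the low-degree vertices weigh more than [y0 = 2 eta / eta1], and remove weight [y0] from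
    them proportionally. Then [lam] drops by at most [y0 (4 l0 - eta1)], while the upper bound drops
    by [4 l0 y0] up to second order. The difference [eta1 y0 = 2 eta] exceeds the initial deficit
    [eta] by enough to cover the second-order term. *)
Lemma low_degree x G (l0 eta eta1 : R) : uniform 4 G ->
  (forall y : V -> R, (forall v, 0 <= y v) -> lam y G <= l0 * tot y [set: V] ^+ 4) ->
  0 <= l0 <= 1 / 24 -> 0 < eta -> 0 < eta1 -> eta < eta1 ^+ 2 ->
  (forall v, 0 <= x v) -> tot x [set: V] = 1 -> l0 - eta <= lam x G ->
  tot x [set v | deg x G v < 4 * l0 - eta1] <= 2 * eta / eta1.
Proof.
move=> uG bd /andP [l00 l01] eta0 eta10 ee x0 W1 near.
set Z := [set v | _]; rewrite leNgt; apply/negP => big.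
pose y0 := 2 * eta / eta1.
have y00 : 0 < y0 by rewrite divr_gt0 // mulr_gt0.
have zp : 0 < tot x Z by apply: lt_trans big.
have z1 : tot x Z <= 1 by rewrite -W1 totS // subsetT.
pose s := y0 / tot x Z.
have s0 : 0 <= s by rewrite divr_ge0 // ltW.
have s1 : s <= 1 by rewrite ler_pdivrMr // mul1r ltW.
pose y v := if v \in Z then (1 - s) * x v else x v.
have yp v : 0 <= y v by rewrite /y; case: ifP => _ //; rewrite mulr_ge0 // subr_ge0.
have Wy : tot y [set: V] = 1 - y0.
  have -> : y0 = s * tot x Z by rewrite /s divfK // lt0r_neq0.
  rewrite -W1 /tot mulr_sumr (big_setID Z) [in RHS](big_setID Z) /= setTI.
  rewrite (eq_bigr (fun v => x v - s * x v)); last first.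
    by move=> v vZ; rewrite /y vZ; ring.
  rewrite sumrB [X in _ + X = _](eq_bigr x); first by ring.
  by move=> v; rewrite inE /y => /andP [/negPf ->].
have E : \sum_(e in G) wt x e *+ #|e :&: Z| = \sum_(v in Z) x v * deg x G v.
  have := sum_wt_link x G [set [set v] | v in Z].
  rewrite big_imset /=; last by move=> u v _ _; apply: set1_inj.
  under eq_bigr => v _ do rewrite wt1.
  move=> ->; apply: eq_bigr => e _; congr (_ *+ _).
  rewrite -(card_imset _ (@set1_inj V)); apply: eq_card => D.
  rewrite !inE; apply/imsetP/andP => [[v + ->]|[/imsetP [v vZ ->]]].
    by rewrite inE => /andP [ve vZ]; rewrite sub1set ve imset_f.
  by rewrite sub1set => ve; exists v; rewrite // inE ve.
have low : lam x G - s * (\sum_(v in Z) x v * deg x G v) <= lam y G.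
  rewrite -E mulr_sumr /lam -sumrB; apply: ler_sum => e eG.
  have -> : wt y e = (1 - s) ^+ #|e :&: Z| * wt x e.
    rewrite /wt (big_setID Z) [in RHS](big_setID Z) /= mulrA; congr (_ * _).
      rewrite -prodr_const -big_split /=; apply: eq_bigr => v.
      by rewrite inE /y => /andP [_ ->].
    by apply: eq_bigr => v; rewrite inE /y => /andP [/negPf ->].
  rewrite -mulr_natl mulrA -{1}[wt x e]mul1r -mulrBl ler_wpM2r ?wt_ge0 //.
  elim: #|_| => [|n IH]; first by rewrite mulr0 subr0.
  rewrite exprS; apply: le_trans (_ : (1 - s) * (1 - s * n%:R) <= _); last first.
    by rewrite ler_wpM2l // subr_ge0.
  have : 0 <= s * s * n%:R by apply: mulr_ge0; [apply: mulr_ge0 | apply: ler0n].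
  by rewrite -(natr1 n); clear; lra.
have zdeg : \sum_(v in Z) x v * deg x G v <= tot x Z * (4 * l0 - eta1).
  rewrite /tot big_distrl /=; apply: ler_sum => v; rewrite inE => /ltW.
  exact: ler_wpM2l.
have := bd y yp; rewrite Wy => up.
have E2 : s * (tot x Z * (4 * l0 - eta1)) = y0 * (4 * l0 - eta1).
  by rewrite mulrA /s divfK // lt0r_neq0.
have h1 := ler_wpM2l s0 zdeg; rewrite E2 in h1.
have y01 : y0 <= 1 by apply: le_trans (ltW big) z1.
have h2 : (1 - y0) ^+ 4 <= 1 - 4 * y0 + 6 * y0 ^+ 2.
  rewrite -subr_ge0 (_ : _ - _ = y0 ^+ 3 * (4 - y0)); last by ring.
  by rewrite mulr_ge0 ?exprn_ge0 ?(ltW y00) //; move: y01; clear; lra.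
have h3 := ler_wpM2l l00 h2.
have h4 : l0 * y0 ^+ 2 <= 1 / 24 * y0 ^+ 2 by rewrite ler_wpM2r // sqr_ge0.
have h5 : eta1 * y0 = 2 * eta by rewrite /y0; field; apply: lt0r_neq0.
have h6 : y0 ^+ 2 = 4 * eta * (eta / eta1 ^+ 2) by rewrite /y0; field; apply: lt0r_neq0.
have h7 : eta / eta1 ^+ 2 < 1 by rewrite ltr_pdivrMr ?exprn_gt0 // mul1r.
have h8 : 4 * eta * (eta / eta1 ^+ 2) < 4 * eta by rewrite gtr_pMr // mulr_gt0.
by move: near low up h1 h3 h4 h5 h6 h8; clearbody y0; clear; lra.
Qed.

End Generic.

End Bound.

(** * The Lagrangian bound for star-clique-free 4-graphs with rational weights *)

Section GridBound.
Import Order.TTheory GRing.Theory Num.Theory.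
Local Open Scope ring_scope.

Definition rest (V : finType) (G : {set {set V}}) (S : {set V}) : {set {set V}} :=
  [set e in G | e \subset S].

Section Rest.
Variables (R : realFieldType) (V : finType).
Implicit Types (x : V -> R) (e D S : {set V}) (G H P M : {set {set V}}).

Lemma rest_powerset G S : rest G S \subset powerset S.
Proof. by apply/subsetP => e; rewrite !inE => /andP[]. Qed.

Lemma rest_sub G S : rest G S \subset G.
Proof. exact: restr_sub. Qed.

Lemma lam_rest x G S : (forall v, v \notin S -> x v = 0) -> lam x (rest G S) = lam x G.
Proof.
move=> xS; rewrite [RHS](lamID x G (fun e => e \subset S)) -/(rest G S).
rewrite [X in _ + X]/lam [X in _ + X]big1 ?addr0 // => e; rewrite inE => /andP [_ /subsetPn [v ve vS]].
by rewrite /wt (bigD1 v) //= xS // mul0r.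
Qed.

Lemma tot_rest x S : (forall v, v \notin S -> x v = 0) -> tot x S = tot x [set: V].
Proof.
move=> xS; rewrite /tot [RHS](big_setID S) /= setTI [X in _ + X]big1 ?addr0 //.
by move=> v; rewrite inE => /andP [/xS].
Qed.

Lemma sum_deg_tot k x G : uniform k G -> \sum_v x v * deg x G v = k%:R * lam x G.
Proof. by move=> uG; rewrite /deg (sum_deg x uG) mulr_natl. Qed.

End Rest.

(** Among integer weights of total [N] there is a maximum, and one of minimal support has all pairs
    of its support covered. On at most [3 T + 3] vertices Maclaurin's inequality applies. Otherwise
    [lag4] bounds the degree of the heaviest vertex, and moves of a single unit bound all other
    degrees by it up to [1/N <= eps]. *)
Lemma grid_bound (R : realFieldType) T : (0 < T)%N -> exists2 eps : R, 0 < eps &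
  forall (V : finType) (G : {set {set V}}), uniform 4 G -> KFfree T.+1 G ->
  forall N (k : V -> nat), 1 <= eps * N%:R -> (\sum_v k v = N)%N ->
  lam (fun v => (k v)%:R) G <= deg0 R T / 4 * N%:R ^+ 4.
Proof.
move=> T0; have [eps eps0 lag] := lag4 R T0; exists eps => // V G uG kf N k epsN kN.
have N0 : (0 < N)%N.
  by case: N epsN {kN} => [|//]; rewrite mulr0 ler10.
have NR : 0 < N%:R :> R by rewrite ltr0n.
pose P (g : {ffun V -> 'I_N.+1}) := (\sum_v g v == N)%N.
pose val (g : {ffun V -> 'I_N.+1}) := lam (fun v => (g v)%:R : R) G.
pose g0 : {ffun V -> 'I_N.+1} := [ffun v => inord (k v)].
have g0E v : g0 v = k v :> nat.
  rewrite ffunE inordK // ltnS -kN (bigD1 v) //=; exact: leq_addr.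
have Pg0 : P g0 by apply/eqP; rewrite -[RHS]kN; apply: eq_bigr => v _; rewrite g0E.
have [g1 Pg1 max1] := arg_maxP val Pg0.
apply: le_trans (_ : val g1 <= _).
  apply: le_trans (max1 _ Pg0); rewrite le_eqVlt; apply/orP; left; apply/eqP.
  by apply: eq_lam => e _ v _; rewrite g0E.
pose supp (g : {ffun V -> 'I_N.+1}) := [set v | (0 < g v)%N].
pose Q g := P g && (val g1 <= val g).
have Qg1 : Q g1 by rewrite /Q Pg1 lexx.
have [g /andP [Pg vg] min1] := arg_minnP (fun g => #|supp g|) Qg1.
apply: (le_trans vg).
have maxg g' : P g' -> val g' <= val g by move=> /max1 h; apply: (le_trans _ vg).
pose S := supp g.
pose y v : R := (g v)%:R.
have y0 v : 0 <= y v by rewrite ler0n.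
have yS v : v \notin S -> y v = 0 by rewrite inE -eqn0Ngt /y => /eqP ->.
have totN : tot y [set: V] = N%:R.
  rewrite /tot -(eqP (Pg : P g)) natr_sum; apply: eq_bigl => v; by rewrite inE.
have tyS : tot y S = N%:R by rewrite (tot_rest yS).
have uGS : uniform 4 (rest G S) by apply: uniform_sub (rest_sub _ _) uG.
have kfS : KFfree T.+1 (rest G S) by apply: KFfree_sub (rest_sub _ _) kf.
have mvg a b (s : nat) : a != b -> (s <= g b)%N -> exists2 g' : {ffun V -> 'I_N.+1}, P g' &
    (forall v, (g' v)%:R = mv y a b s%:R v).
  move=> ab sb.
  pose h v := if v == a then (g a + s)%N else if v == b then (g b - s)%N else g v.
  have hs : (\sum_v h v = N)%N.
    have ba : b != a by rewrite eq_sym.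
    have E : (\sum_(v | (v != a) && (v != b)) h v = \sum_(v | (v != a) && (v != b)) g v)%N.
      by apply: eq_bigr => v /andP [va vb]; rewrite /h (negPf va) (negPf vb).
    rewrite -[RHS](eqP (Pg : P g)) (bigD1 a) //= (bigD1 b) //= E.
    rewrite [RHS](bigD1 a) //= [in RHS](bigD1 b) //= /h eqxx (negPf ba) eqxx.
    by rewrite -addnA (addnA s) subnKC.
  exists [ffun v => inord (h v)].
    apply/eqP; rewrite -[RHS]hs; apply: eq_bigr => v _; rewrite ffunE inordK // ltnS -hs (bigD1 v) //=.
    exact: leq_addr.
  move=> v; rewrite ffunE inordK; last first.
    by rewrite ltnS -hs (bigD1 v) //=; apply: leq_addr.
  rewrite /h /mv; case: eqP => _; first by rewrite natrD.
  by case: eqP => _ //; rewrite natrB.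
have pc : paircov (rest G S) S.
  move=> a b aS bS ab; case: (boolP (covered (rest G S) a b)) => // unc; exfalso.
  have unc' e : e \in rest G S -> a \in e -> b \notin e.
    move=> eG ae; apply/negP => be; move/negP: unc; apply.
    by apply/existsP; exists e; rewrite eG ae be.
  have [a1 [b1 [ko le1 [z0 E] _ [[kno kS] oS]]]] :=
    merge_step y0 uGS (rest_powerset _ _) aS bS ab unc'.
  have [g' Pg' g'E] := mvg _ _ _ kno (leqnn _).
  have vE : val g' = lam (mv y a1 b1 (y b1)) G.
    by apply: eq_lam => e _ v _; rewrite g'E.
  have Qg' : Q g'.
    rewrite /Q Pg' /=; apply: (le_trans vg); rewrite vE /val -/y -(lam_rest _ yS).
    apply: le_trans le1 _; apply: lamS => //.
    exact: subset_trans (restr_sub _ _) (rest_sub _ _).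
  have := min1 _ Qg'; rewrite leqNgt => /negP; apply.
  rewrite [X in (_ < X)%N](cardsD1 b1) oS add1n ltnS; apply: subset_leq_card.
  apply/subsetP => v; rewrite !inE => gv.
  have vE' := g'E v; have [vb|vb] := eqVneq v b1.
    move: vE'; rewrite vb /mv eq_sym (negPf kno) eqxx subrr => /eqP; rewrite pnatr_eq0 => /eqP E0.
    by rewrite vb E0 in gv.
  have [va|va] := eqVneq v a1; first by rewrite va; move: kS; rewrite inE.
  move: vE'; rewrite /mv (negPf va) (negPf vb) => /eqP; rewrite eqr_nat => /eqP <-.
  exact: gv.
rewrite /val -/y -(lam_rest _ yS).
have [small|big] := leqP #|S| (3 * T + 3).
  apply: le_trans (lam_le_elsym y0 uGS (rest_powerset _ _)) _.
  by rewrite -mac4E -tyS; apply: maclaurin'.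
have [v vS vmax] : exists2 v, v \in S & forall w, w \in S -> y w <= y v.
  have [v1 v1S] : exists v, v \in S by apply/card_gt0P; move: big; clear; lia.
  have [v vS vm] := arg_maxnP (fun v => g v : nat) v1S.
  by exists v => // w wS; rewrite ler_nat; apply: vm.
have Nn0 : N%:R != 0 :> R by rewrite lt0r_neq0.
pose z w := N%:R^-1 * y w.
have z0 w : 0 <= z w by rewrite mulr_ge0 // invr_ge0 ltW.
have tz : tot z S = 1 by rewrite tot_scale tyS mulVf.
have zS w : w \notin S -> z w = 0 by rewrite /z => /yS ->; rewrite mulr0.
have tz1 : tot z [set: V] = 1 by rewrite -(tot_rest zS).
have lg := lag V (rest G S) S z v uGS (rest_powerset _ _) kfS pc.
have {lg} lg : deg z (rest G S) v <= deg0 R T - eps.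
  apply: lg => //; first by rewrite -addnS in big *.
  by move=> w wS; rewrite /z; apply: ler_wpM2l; [rewrite invr_ge0 ltW | apply: vmax].
have gv : (0 < g v)%N by move: vS; rewrite inE.
(* Moving one unit from [v] to [w] cannot increase the maximum; the quadratic term of the move is
   responsible for the slack [1/N]. *)
have opt w : deg z (rest G S) w <= deg z (rest G S) v + N%:R^-1.
  have [->|wv] := eqVneq w v; first by rewrite lerDl invr_ge0 ltW.
  have [wS|wS] := boolP (w \in S); last first.
    rewrite (_ : deg z (rest G S) w = 0); first by rewrite addr_ge0 ?invr_ge0 ?lam_ge0 // ltW.
    rewrite /deg /lam big1 // => e; rewrite mem_link1 inE subUset sub1set (negPf wS).
    by rewrite /= !andbF.
  have [g' Pg' g'E] := mvg w v 1%N wv gv.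
  have := maxg _ Pg'; rewrite /val -/y.
  rewrite (eq_lam (x := fun v0 => (g' v0)%:R) (y := mv y w v 1)); last by move=> e _ u _; rewrite g'E.
  have mvS u : u \notin S -> mv y w v 1 u = 0.
    move=> uS; rewrite /mv; case: eqP => [E|_]; first by rewrite E wS in uS.
    by case: eqP => [E|_]; [rewrite E vS in uS | apply: yS].
  rewrite -(lam_rest _ yS) -(lam_rest _ mvS) => le1.
  have le2 : lam (mv z w v N%:R^-1) (rest G S) <= lam z (rest G S).
    have -> : lam (mv z w v N%:R^-1) (rest G S) = lam (fun u => N%:R^-1 * mv y w v 1 u) (rest G S).
      apply: eq_lam => e _ u _; rewrite /mv /z; case: eqP => _; first by rewrite mulrDr mulr1.
      by case: eqP => _ //; rewrite mulrBr mulr1.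
    by rewrite !(lam_scale _ _ uGS) ler_wpM2l // exprn_ge0 // invr_ge0 ltW.
  move: le2; rewrite lam_mv_gen // -addrA gerDl expr2 -mulrA -mulrBr pmulr_rle0 ?invr_gt0 //.
  have c1 : lam z (link (rest G S) [set w; v]) <= 1.
    exact: lam_le1 z0 (link_card _ uGS) tz1.
  have c2 : N%:R^-1 * lam z (link (rest G S) [set w; v]) <= N%:R^-1.
    by rewrite ler_piMr // invr_ge0 ltW.
  by move: c2; clear; lra.
have e1 : N%:R^-1 <= eps by rewrite -[N%:R^-1]mul1r ler_pdivrMr.
have : 4 * lam z (rest G S) <= deg0 R T.
  rewrite -(sum_deg_tot z uGS).
  apply: le_trans (_ : \sum_w z w * deg0 R T <= _).
    apply: ler_sum => w _; apply: ler_wpM2l => //; apply: le_trans (opt w) _.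
    by move: lg e1; clear; lra.
  rewrite -mulr_suml (_ : \sum_w z w = 1) ?mul1r //.
  by rewrite -tz1 /tot; apply: eq_bigl => w; rewrite inE.
rewrite (lam_scale _ _ uGS) => le4.
have n4 : 0 < N%:R ^+ 4 :> R by rewrite exprn_gt0.
have := ler_wpM2r (ltW n4) le4.
have -> : 4 * (N%:R^-1 ^+ 4 * lam y (rest G S)) * N%:R ^+ 4 = 4 * lam y (rest G S) by field.
by clear; lra.
Qed.

Lemma rat_grid (V : finType) (x : V -> rat) : (forall v, 0 <= x v) ->
  exists (D : nat) (k : V -> nat), (0 < D)%N /\ forall v, D%:R * x v = (k v)%:R.
Proof.
move=> x0; pose D := (\prod_v `|denq (x v)|)%N; exists D.
have kE v : exists k : nat, D%:R * x v == k%:R.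
  rewrite /D (bigD1 v) //=; set q := (\prod_(i | _) _)%N.
  exists (q * `|numq (x v)|)%N; apply/eqP; rewrite !natrM mulrAC mulrC; congr (_ * _).
  rewrite -{2}(divq_num_den (x v)).
  have d0 : `|denq (x v)|%:R = (denq (x v))%:~R :> rat.
    by rewrite natr_absz gtr0_norm // denq_gt0.
  have n0 : `|numq (x v)|%:R = (numq (x v))%:~R :> rat.
    by rewrite natr_absz ger0_norm // numq_ge0.
  by rewrite d0 n0 mulrC divfK // intr_eq0 denq_neq0.
exists (fun v => xchoose (kE v)); split.
  by rewrite prodn_gt0 // => v; rewrite absz_gt0 denq_neq0.
by move=> v; apply/eqP/(xchooseP (kE v)).
Qed.

(** Homogeneity reduces rational weights to integer ones; the additional factor [K] makes the total
    large enough for [grid_bound]. *)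
Lemma kf_bound T (V : finType) (G : {set {set V}}) (x : V -> rat) : (0 < T)%N -> uniform 4 G ->
  KFfree T.+1 G -> (forall v, 0 <= x v) ->
  lam x G <= deg0 rat T / 4 * tot x [set: V] ^+ 4.
Proof.
move=> T0 uG kf x0; have [eps eps0 gb] := grid_bound rat T0.
have [D [k [D0 kE]]] := rat_grid x0.
pose N0 := (\sum_v k v)%N.
have N0E : N0%:R = D%:R * tot x [set: V].
  rewrite /N0 natr_sum /tot mulr_sumr; apply: eq_big => [v|v _]; first by rewrite inE.
  by rewrite kE.
have DR : 0 < D%:R :> rat by rewrite ltr0n.
have [E0|Np] := posnP N0.
  have xz v : x v = 0.
    have : k v = 0%N by apply/eqP; rewrite -leqn0 -E0 /N0 (bigD1 v) //= leq_addr.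
    by move=> h; have := kE v; rewrite h => /eqP; rewrite mulf_eq0 (gt_eqF DR) => /eqP.
  have -> : lam x G = 0.
    rewrite /lam big1 // => e eG; have [v ve] : exists v, v \in e.
      by apply/card_gt0P; rewrite (eqP (forall_inP uG _ eG)).
    by rewrite /wt (bigD1 v) //= xz mul0r.
  apply: mulr_ge0; last by apply: exprn_ge0; apply: tot_ge0.
  by apply: divr_ge0 => //; apply: deg0_ge0.
pose K := Num.bound eps^-1.
have KE : eps^-1 < K%:R by apply: archi_boundP; rewrite invr_ge0 ltW.
have Kp : 1 <= eps * K%:R.
  by rewrite mulrC -ler_pdivrMr // div1r ltW.
have KR : 0 < K%:R :> rat by apply: lt_trans KE; rewrite invr_gt0.
have := gb V G uG kf (K * N0)%N (fun v => K * k v)%N.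
rewrite natrM mulrA -big_distrr => /(_ _ erefl) h.
have {}h : lam (fun v => (K * k v)%:R) G <= deg0 rat T / 4 * (K%:R * N0%:R) ^+ 4.
  apply: h; apply: le_trans Kp _; rewrite ler_peMr ?mulr_ge0 ?ler1n //; exact: ltW.
have E : lam (fun v => (K * k v)%:R) G = lam (fun v => K%:R * D%:R * x v) G.
  by apply: eq_lam => e _ v _; rewrite natrM -mulrA kE.
rewrite E (lam_scale _ _ uG) N0E in h.
have KD : 0 < (K%:R * D%:R) ^+ 4 :> rat by rewrite exprn_gt0 // mulr_gt0.
rewrite -(ler_pM2l KD); apply: (le_trans h).
by rewrite le_eqVlt; apply/orP; left; apply/eqP; ring.
Qed.

End GridBound.

(** * Complete multipartite hypergraphs given by colourings *)

Section Rainbow.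
Import Order.TTheory GRing.Theory Num.Theory.
Local Open Scope ring_scope.
Variables (R : realFieldType) (V C : finType).
Implicit Types (x : V -> R) (e A S : {set V}) (G H P M : {set {set V}}) (psi : V -> C) (D J : {set C}).

(** The complete multipartite [k]-graph on the colour classes indexed by [D]: its edges are the
    rainbow [k]-sets. *)
Definition rbow psi k D : {set {set V}} :=
  [set e : {set V} | [&& #|e| == k, psi @: e \subset D & #|psi @: e| == #|e|]].

Definition pw x psi i : R := tot x (psi @^-1: [set i]).

Lemma rbowP psi k D e : reflect [/\ #|e| = k, (forall v, v \in e -> psi v \in D) & {in e &, injective psi}]
  (e \in rbow psi k D).
Proof.
rewrite inE; apply: (iffP and3P) => [[/eqP ek /subsetP eD /imset_injP inj]|[ek eD inj]].
  by split=> // v ve; apply: eD; apply: imset_f.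
split; [exact/eqP| |exact/imset_injP].
by apply/subsetP => _ /imsetP [v ve ->]; apply: eD.
Qed.

Lemma uniform_rbow psi k D : uniform k (rbow psi k D).
Proof. by apply/forall_inP => e; rewrite inE => /and3P[]. Qed.

Lemma rbow_sub psi k D J : D \subset J -> rbow psi k D \subset rbow psi k J.
Proof.
move=> /subsetP DJ; apply/subsetP => e /rbowP [ek eD inj]; apply/rbowP; split=> // v /eD.
exact: DJ.
Qed.

Lemma link_rbow psi k D v : psi v \in D ->
  link (rbow psi k.+1 D) [set v] = rbow psi k (D :\ psi v).
Proof.
move=> vD; apply/setP => e; rewrite mem_link1; apply/andP/rbowP => [[ve /rbowP [ek eD inj]]|[ek eD inj]].
  have eve w : w \in e -> w \in v |: e by move=> we; rewrite inE we orbT.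
  split.
  - by move: ek; rewrite cardsU1 ve add1n => -[].
  - move=> w we; rewrite !inE eD ?eve // andbT; apply: contraNneq ve => E.
    by have -> : v = w by apply: inj; rewrite ?setU11 ?eve // E.
  - by move=> u w ue we; apply: inj; apply: eve.
have ve : v \notin e by apply/negP => /eD; rewrite !inE eqxx.
split=> //; apply/rbowP; split.
- by rewrite cardsU1 ve ek.
- by move=> w; rewrite !inE => /orP [/eqP -> //|/eD]; rewrite inE => /andP[].
move=> u w; rewrite !inE => /orP [/eqP ->|ue] /orP [/eqP ->|we] // E.
- by have := eD _ we; rewrite !inE E eqxx.
- by have := eD _ ue; rewrite !inE E eqxx.
exact: inj.
Qed.

(** Splitting off a colour class follows the recursion [elsymS], the class playing the role of a
    single vertex. *)
Lemma lam_rbow x psi k D : lam x (rbow psi k D) = elsym (pw x psi) D k.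
Proof.
have [n] := ubnP #|D|; elim: n k D => // n IH [|k] D Dn.
  rewrite elsym0 /lam (_ : rbow psi 0 D = [set set0]) ?big_set1 ?wt0 //.
  apply/setP => e; rewrite !inE cards_eq0; case: eqVneq => [->|] //=.
  by rewrite imset0 sub0set !cards0.
have [D0|[i iD]] := set_0Vmem D.
  rewrite D0 elsym_set0 /lam big1 // => e /rbowP [ek eD _].
  have [v ve] : exists v, v \in e by apply/card_gt0P; rewrite ek.
  by have := eD _ ve; rewrite inE.
have Di : (#|D :\ i| < n)%N by move: Dn; rewrite (cardsD1 i D) iD.
rewrite (elsymS _ _ iD) -!IH //.
rewrite (lamID x _ (fun e => psi @: e \subset D :\ i)); congr (_ + _).
  congr lam; apply/setP => e; rewrite !inE subsetD1.
  by case: (#|e| == _) => //=; case: (_ \subset D); case: (_ == _); rewrite ?andbF ?andbT.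
rewrite /pw /tot big_distrl /=.
rewrite (eq_bigr (fun v => wt x [set v] * lam x (link (rbow psi k.+1 D) [set v]))); last first.
  by move=> v; rewrite !inE => /eqP vi; rewrite wt1 link_rbow vi.
have := sum_wt_link x (rbow psi k.+1 D) [set [set v] | v in psi @^-1: [set i]].
rewrite big_imset /=; last by move=> u v _ _; apply: set1_inj.
move=> ->; rewrite [RHS](bigID (fun e => psi @: e \subset D :\ i)) /= [X in _ = X + _]big1 ?add0r.
  rewrite /lam; apply: eq_big => [e|e]; rewrite inE // => /andP [/rbowP [ek eD inj] eDi].
  have [v ve vi] : exists2 v, v \in e & psi v = i.
    move: eDi => /subsetPn [_ /imsetP [v ve ->]]; rewrite !inE eD // andbT negbK => /eqP E.
    by exists v.
  rewrite (_ : [set _ in _ | _] = [set [set v]]) ?cards1 //.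
  apply/setP => A; rewrite !inE; apply/andP/eqP => [[/imsetP [w]]|->].
    rewrite !inE => /eqP wi ->; rewrite sub1set => we; congr [set _].
    by apply: inj => //; rewrite wi.
  by rewrite sub1set; split=> //; apply: imset_f; rewrite !inE vi.
move=> e /andP [_ /subsetP eDi]; rewrite (_ : [set _ in _ | _] = set0) ?cards0 //.
apply/setP => A; rewrite !inE; apply/negbTE/negP => /andP [/imsetP [w]].
rewrite !inE => /eqP wi ->; rewrite sub1set => we.
by have := eDi _ (imset_f psi we); rewrite !inE wi eqxx.
Qed.

Lemma tot_pw x psi : tot (pw x psi) [set: C] = tot x [set: V].
Proof.
rewrite /tot (eq_bigl predT); last by move=> i; rewrite inE.
rewrite [RHS](eq_bigl predT); last by move=> i; rewrite inE.
rewrite [RHS](partition_big psi predT) //=; apply: eq_bigr => i _.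
by rewrite /pw /tot; apply: eq_bigl => v; rewrite !inE.
Qed.

Lemma pw_ge0 x psi i : (forall v, 0 <= x v) -> 0 <= pw x psi i.
Proof. exact: tot_ge0. Qed.

Lemma lam_le1' k x H : (forall v, 0 <= x v) -> uniform k H -> tot x [set: V] <= 1 -> lam x H <= 1.
Proof.
move=> x0 uH W1.
have HT : H \subset powerset [set: V] by apply/subsetP => e _; rewrite inE subsetT.
apply: le_trans (lam_le_elsym x0 uH HT) _.
apply: le_trans (maclaurin' k x0 (leqnn _)) _.
have t0 : 0 <= tot x [set: V] by apply: tot_ge0.
apply: le_trans (_ : mac R k #|[set: V]| * 1 <= _).
  by rewrite ler_wpM2l ?mac_ge0 // exprn_ile1.
rewrite mulr1 /mac; have [n0|n0] := posnP #|[set: V]|.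
  by rewrite n0 bin0n; case: k {uH} => [|k]; rewrite ?expr0 ?divr1 ?mul0r ?ler01.
rewrite ler_pdivrMr ?exprn_gt0 ?ltr0n // mul1r -natrX ler_nat.
move: #|_| {n0} => n; apply: leq_trans (_ : n ^_ k <= _)%N.
  by rewrite -bin_ffact leq_pmulr // fact_gt0.
elim: k {uH} => [|k IH]; first by rewrite ffactn0.
by rewrite ffactnSr expnSr leq_mul // leq_subr.
Qed.

Lemma elsym_card (W : finType) (x : W -> R) (S : {set W}) : elsym x S #|S| = wt x S.
Proof.
rewrite /elsym /lam (_ : [set _ | _] = [set S]) ?big_set1 //.
apply/setP => e; rewrite !inE; apply/andP/eqP => [[eS /eqP E]|->]; last by rewrite subxx.
by apply/eqP; rewrite eqEcard eS E leqnn.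
Qed.

(* A union bound over the transversals of the sets [P j], [j \in J], weighted by the
   product weight: if the bad sets are light, some transversal [A] avoids them all. *)
Lemma transversal x psi J (P : C -> {set V}) (D : {set V}) (Bad : {set {set V}}) :
  (forall v, 0 <= x v) -> tot x [set: V] <= 1 ->
  (forall i v, v \in P i -> psi v = i) ->
  \sum_(e in Bad) wt x (e :\: D) < \prod_(j in J) tot x (P j) ->
  exists A : {set V}, [/\ A \in rbow psi #|J| J, forall v, v \in A -> v \in P (psi v) &
    forall e : {set V}, e \in Bad -> ~~ (e \subset A :|: D)].
Proof.
move=> x0 W1 Ppsi small.
(* With the weight restricted to the allowed sets, the rainbow [#|J|]-sets have total weight equal
   to the product of the weights of the [P j]. *)
pose y v := if v \in P (psi v) then x v else 0.
have y0 v : 0 <= y v by rewrite /y; case: ifP.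
have yx v : 0 <= y v <= x v by rewrite y0 /= /y; case: ifP => _.
have Wy : tot y [set: V] <= 1.
  by apply: le_trans W1; apply: ler_sum => v _; have /andP[] := yx v.
have full : lam y (rbow psi #|J| J) = \prod_(j in J) tot x (P j).
  rewrite lam_rbow elsym_card; apply: eq_bigr => j _.
  rewrite /pw /tot big_mkcond [RHS]big_mkcond /=; apply: eq_bigr => v _.
  rewrite !inE /y; case: eqP => [->|h] //.
  by case: ifP => // /Ppsi.
pose B := [set A in rbow psi #|J| J | [exists e in Bad, e \subset A :|: D]].
have : lam y B <= \sum_(e in Bad) wt x (e :\: D).
  apply: le_trans (_ : \sum_(e in Bad) wt y (e :\: D) * lam y (link (rbow psi #|J| J) (e :\: D)) <= _).
    rewrite (eq_bigr (fun e => \sum_(A in rbow psi #|J| J | e :\: D \subset A) wt y A)); last first.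
      by move=> e _; rewrite sum_link.
    rewrite (exchange_big_dep (mem (rbow psi #|J| J))) /=; last by move=> e A _ /andP[].
    rewrite /lam /B big_mkcond [leRHS]big_mkcond /=; apply: ler_sum => A _; rewrite inE.
    case: ifP => /=; last by move=> _; case: ifP => // _; apply: sumr_ge0 => e _; apply: wt_ge0.
    move=> /andP [-> /existsP [e /andP [eB eA]]].
    rewrite (bigD1 e) /=; last by rewrite eB /= subDset setUC.
    by rewrite lerDl sumr_ge0 // => f _; apply: wt_ge0.
  apply: ler_sum => e _; apply: le_trans (le_wt _ yx); rewrite ler_piMr ?wt_ge0 //.
  exact: lam_le1' y0 (link_card _ (uniform_rbow _ _ _)) Wy.
move=> /le_lt_trans /(_ small); rewrite -full.
rewrite [X in _ < X](lamID y _ (fun A => [exists e in Bad, e \subset A :|: D])) -/B ltrDl.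
set L := [set A in _ | _] => Lp.
have [A AL Ap] : exists2 A, A \in L & 0 < wt y A.
  have [/existsP [A /andP [AL Ap]]|h] := boolP [exists A : {set V}, (A \in L) && (0 < wt y A)].
    by exists A.
  move: Lp; rewrite ltNge sumr_le0 // => A AL; rewrite leNgt; apply: contra h => Ap.
  by apply/existsP; exists A; rewrite AL.
move: AL; rewrite inE => /andP [AR /existsPn nb]; exists A; split => //.
  move=> v vA; apply: contraLR Ap => nv; rewrite /wt (bigD1 v) //= /y (negPf nv) mul0r.
  by rewrite ltxx.
by move=> e eB; have := nb e; rewrite eB.
Qed.

(** Markov's inequality, each edge of [M] having at most [2 ^ k] subsets. *)
Lemma sum_low x M q (s : R) k : (forall v, 0 <= x v) -> 0 < s -> uniform k M ->
  lam x [set p : {set V} | (#|p| == q) && (s <= lam x (link M p))] <= (2 ^ k)%:R * lam x M / s.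
Proof.
move=> x0 s0 uM; rewrite ler_pdivlMr // /lam mulr_suml.
set P := [set p | _].
apply: le_trans (_ : \sum_(p in P) wt x p * lam x (link M p) <= _).
  apply: ler_sum => p; rewrite inE => /andP [_ h]; rewrite ler_wpM2l ?wt_ge0 //.
rewrite sum_wt_link mulr_sumr; apply: ler_sum => e eM.
rewrite -[leLHS]mulr_natl ler_wpM2r ?wt_ge0 // ler_nat.
rewrite -(eqP (forall_inP uM _ eM)) -card_powerset; apply: subset_leq_card.
by apply/subsetP => p; rewrite !inE => /andP[].
Qed.

Lemma lamU x G H : (forall v, 0 <= x v) -> lam x (G :|: H) <= lam x G + lam x H.
Proof.
move=> x0; rewrite /lam (big_setID G) /=.
rewrite (_ : (G :|: H) :&: G = G); last by apply/setIidPr/subsetUl.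
rewrite lerD2l; apply: (lamS x0); apply/subsetP => e; rewrite !inE.
by case: (e \in G).
Qed.

End Rainbow.

(** * Near-optimal part weights are nearly equal *)

Section Balance.
Import Order.TTheory GRing.Theory Num.Theory.
Local Open Scope ring_scope.
Variables (R : realFieldType).

Lemma mac4_clique3 T : (0 < T)%N ->
  mac R 4 (3 * T).+2 = clique3 R T * (3 * T%:R - 1) / (4 * (3 * T%:R + 2)).
Proof.
move=> T0; have t0 : 0 <= T%:R :> R := ler0n _ _.
have E : 4 * 'C((3 * T).+2, 4)%:R = (3 * T%:R - 1) * 'C((3 * T).+2, 3)%:R :> R.
  have := mul_bin_left (3 * T).+2 3 => /(congr1 (fun k => k%:R : R)).
  rewrite !natrM => ->; congr (_ * _); rewrite natrB; last by move: T0; clear; lia.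
  by rewrite -(natr1 (3 * T).+1) -(natr1 (3 * T)) natrM; ring.
have n2 : (3 * T).+2%:R = 3 * T%:R + 2 :> R.
  by rewrite -(natr1 (3 * T).+1) -(natr1 (3 * T)) natrM; ring.
have n0 : 3 * T%:R + 2 != 0 :> R by apply: lt0r_neq0; lra.
rewrite /clique3 /mac n2.
have -> : 'C((3 * T).+2, 4)%:R = (3 * T%:R - 1) * 'C((3 * T).+2, 3)%:R / 4 :> R.
  by rewrite -E; field.
by field.
Qed.

(* With [1 - y i = w (m - 1) / m], [m = 3 T + 3], splitting off the part [i] gives
   [elsym y 4 <= lam0 w^3 (4 - 3 w) <= lam0 (1 - (w - 1)^2)]. *)
Lemma balance (C : finType) T (y : C -> R) (th : R) i : (0 < T)%N -> #|C| = (3 * T + 3)%N ->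
  (forall j, 0 <= y j) -> tot y [set: C] = 1 -> 0 <= th ->
  deg0 R T / 4 - deg0 R T / 4 * th ^+ 2 <= elsym y [set: C] 4 ->
  (1 - y i) * (3 * T%:R + 3) <= (3 * T%:R + 2) * (1 + th).
Proof.
move=> T0 cC y0 W1 th0 near; have t1 : 1 <= T%:R :> R by rewrite ler1n.
have yi1 : y i <= 1 by rewrite -W1 le_tot // inE.
have cCi : (#|[set: C] :\ i| <= (3 * T).+2)%N.
  by have := cardsD1 i [set: C]; rewrite inE cardsT cC; clear; lia.
have Wi : tot y ([set: C] :\ i) = 1 - y i.
  by rewrite -W1 (totD1 _ (in_setT i)) addrC addKr.
move: near; rewrite (elsymS _ _ (in_setT i)).
have := maclaurin' 4 y0 cCi; have := maclaurin' 3 y0 cCi; rewrite Wi mac4_clique3 // -/(clique3 R T).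
move=> /(ler_wpM2l (y0 i)) h3 h4 near.
pose m : R := 3 * T%:R + 3.
have m0 : m - 1 != 0 by apply: lt0r_neq0; rewrite /m; move: t1; clear; lra.
have m0' : m != 0 by apply: lt0r_neq0; rewrite /m; move: t1; clear; lra.
pose w := (1 - y i) * m / (m - 1).
have w0 : 0 <= w.
  by rewrite /w divr_ge0 ?mulr_ge0 ?subr_ge0 //; rewrite /m; move: t1; clear; lra.
have zE : 1 - y i = w * (m - 1) / m by rewrite /w; field; rewrite m0 m0'.
have D0 : 0 < deg0 R T.
  by rewrite /deg0 divr_gt0 ?mulr_gt0 ?exprn_gt0 //; move: t1; clear; lra.
have AE : clique3 R T = deg0 R T * (m / (m - 1)) ^+ 3.
  rewrite (deg0E R T) -/m; field; by rewrite m0 m0'.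
have up : deg0 R T / 4 - deg0 R T / 4 * th ^+ 2 <= deg0 R T / 4 * (w ^+ 3 * (4 - 3 * w)).
  apply: (le_trans near); apply: le_trans (lerD h4 h3) _.
  have -> : y i = 1 - w * (m - 1) / m by rewrite -zE; ring.
  have -> : 1 - (1 - w * (m - 1) / m) = w * (m - 1) / m by ring.
  have -> : 3 * T%:R - 1 = m - 4 by rewrite /m; ring.
  have -> : 3 * T%:R + 2 = m - 1 by rewrite /m; ring.
  rewrite AE le_eqVlt; apply/orP; left; apply/eqP; field; by rewrite m0 m0'.
have {}up : (w - 1) ^+ 2 <= th ^+ 2.
  have d4 : 0 < deg0 R T / 4 by rewrite divr_gt0.
  rewrite -(ler_pM2l d4).
  have h : 0 <= deg0 R T / 4 * ((w - 1) ^+ 2 * (3 * w ^+ 2 + 2 * w)).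
    apply: mulr_ge0; first exact: ltW.
    apply: mulr_ge0; first exact: sqr_ge0.
    by apply: addr_ge0; apply: mulr_ge0 => //; apply: sqr_ge0.
  have E : w ^+ 3 * (4 - 3 * w) = 1 - (w - 1) ^+ 2 - (w - 1) ^+ 2 * (3 * w ^+ 2 + 2 * w) by ring.
  by move: up h; rewrite E; move: (deg0 R T / 4) => d; clear; lra.
have w1 : w <= 1 + th.
  have [h|h] := lerP w 1; first by move: th0 h; clear; lra.
  have w10 : 0 <= w - 1 by rewrite subr_ge0 ltW.
  by move: up; rewrite ler_pXn2r ?nnegrE // lerBlDl.
have -> : (1 - y i) * (3 * T%:R + 3) = (3 * T%:R + 2) * w.
  by rewrite zE -/m (_ : 3 * T%:R + 2 = m - 1); [field | rewrite /m; ring].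
by rewrite ler_wpM2l //; move: t1; clear; lra.
Qed.

End Balance.

(** * Spanning stars in cliques and near-cliques *)

Section Stars.
Variable (V : finType).
Implicit Types (e A S : {set V}) (G H P M : {set {set V}}).

Lemma add_triple M e : uniform 3 M -> trivIset M -> #|e| = 3 ->
  [disjoint e & cover M] ->
  [/\ uniform 3 (e |: M), trivIset (e |: M), #|e |: M| = #|M|.+1 & cover (e |: M) = e :|: cover M].
Proof.
move=> uM tM ec dj; have [] := @trivIsetU1 _ e M.
- move=> f fM; apply: disjointWr dj; exact: bigcup_sup.
- exact: tM.
- by apply/negP => /(forall_inP uM); rewrite cards0.
move=> tU nU; split=> //; last by rewrite /cover bigcup_setU big_set1.
  by apply/forall_inP => f; rewrite !inE => /orP [/eqP ->|/(forall_inP uM) //]; rewrite ec.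
by rewrite cardsU1 nU.
Qed.

Lemma triples_cover A k : #|A| = (3 * k)%N ->
  exists M, [/\ uniform 3 M, trivIset M, #|M| = k & cover M = A].
Proof.
move=> cA; have [|M [tM cM uM MA]] := @triples_exist V A k; first by rewrite cA.
exists M; split=> //; apply/eqP; rewrite eqEcard MA cA /=.
have [] := cover_card (S := A) uM tM; last by move=> _ ->; rewrite cM mulnC.
by apply/subsetP => e eM; rewrite inE; apply: subset_trans MA; apply: bigcup_sup.
Qed.

(** [a] and [b] go into different triples [a |: P] and [b |: Q], and the centre is a third vertex,
    so no edge of the star contains both. *)
Lemma star_of_near_clique T G (A : {set V}) a b : (0 < T)%N -> #|A| = (3 * T + 4)%N ->
  a \in A -> b \in A -> a != b ->
  (forall e, e \subset A -> #|e| = 4 -> ~~ ((a \in e) && (b \in e)) -> e \in G) ->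
  exists v M, star_config T.+1 G v M /\ v |: cover M = A.
Proof.
move=> T0 cA aA bA ab full.
have bAa : b \in A :\ a by rewrite !inE eq_sym ab.
have [v vA] : exists v, v \in A :\ a :\ b.
  by apply/card_gt0P; move: cA; rewrite (cardsD1 a) aA (cardsD1 b (A :\ a)) bAa; clear -T0; lia.
have c1 : #|A :\ a :\ b :\ v| = (3 * T + 1)%N.
  by move: cA; rewrite (cardsD1 a) aA (cardsD1 b (A :\ a)) bAa (cardsD1 v (A :\ a :\ b)) vA; clear; lia.
have [P PA cP] : exists2 P : {set V}, P \subset A :\ a :\ b :\ v & #|P| = 2.
  by apply: subset_card; rewrite c1; clear -T0; lia.
have [Q QA cQ] : exists2 Q : {set V}, Q \subset (A :\ a :\ b :\ v) :\: P & #|Q| = 2.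
  by apply: subset_card; rewrite cardsD (setIidPr PA) c1 cP; clear -T0; lia.
have [M [uM tM cM MA]] : exists M, [/\ uniform 3 M, trivIset M, #|M| = T.-1 &
    cover M = ((A :\ a :\ b :\ v) :\: P) :\: Q].
  apply: triples_cover; rewrite cardsD (setIidPr QA) cardsD (setIidPr PA) c1 cP cQ; clear -T0; lia.
have inA w : w \in A :\ a :\ b :\ v = [&& w != v, w != b, w != a & w \in A] by rewrite !inE.
have PAw w : w \in P -> [&& w != v, w != b, w != a & w \in A] by move=> /(subsetP PA); rewrite inA.
have QAw w : w \in Q -> (w \notin P) && [&& w != v, w != b, w != a & w \in A].
  by move=> /(subsetP QA); rewrite inE inA.
have MAw w : w \in cover M = [&& w \notin Q, w \notin P, w != v, w != b, w != a & w \in A].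
  by rewrite MA in_setD in_setD inA.
have bQ : b \notin Q by apply/negP => /QAw; rewrite eqxx !andbF.
have aP : a \notin P by apply/negP => /PAw; rewrite eqxx !andbF.
have [uM1 tM1 cM1 MA1] : [/\ uniform 3 ((b |: Q) |: M), trivIset ((b |: Q) |: M),
   #|(b |: Q) |: M| = #|M|.+1 & cover ((b |: Q) |: M) = (b |: Q) :|: cover M].
  apply: add_triple => //; first by rewrite cardsU1 bQ cQ.
  rewrite -setI_eq0 -subset0; apply/subsetP => w; rewrite in_setI MAw !inE.
  by case/andP => /orP [/eqP ->|wQ] => [|/andP [/negP []]] //; rewrite eqxx !andbF.
have [uM2 tM2 cM2 MA2] : [/\ uniform 3 ((a |: P) |: (b |: Q |: M)), trivIset ((a |: P) |: (b |: Q |: M)),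
   #|(a |: P) |: (b |: Q |: M)| = #|(b |: Q) |: M|.+1 & cover ((a |: P) |: (b |: Q |: M)) = (a |: P) :|: cover (b |: Q |: M)].
  apply: add_triple => //; first by rewrite cardsU1 aP cP.
  rewrite MA1 -setI_eq0 -subset0; apply/subsetP => w; rewrite in_setI !in_setU MAw !in_set1 in_set0.
  case/andP => /orP [/eqP ->|wP].
    rewrite (negPf ab) eqxx !andbF !orbF /= => /QAw; by rewrite eqxx !andbF.
  rewrite wP /= ?andbF orbF => /orP [/eqP E|/QAw]; last by rewrite wP.
  by have := PAw _ wP; rewrite E eqxx !andbF.
exists v, ((a |: P) |: (b |: Q |: M)).
have cov : v |: cover ((a |: P) |: (b |: Q |: M)) = A.
  apply/eqP; rewrite eqEsubset MA2 MA1; apply/andP; split.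
    have vA' : v \in A by move: vA; rewrite !inE => /and3P[].
    have PA' : P \subset A by apply/subsetP => w /PAw /and4P[].
    have QA' : Q \subset A by apply/subsetP => w /QAw /andP [_ /and4P[]].
    have MA' : cover M \subset A by apply/subsetP => w; rewrite MAw => /and5P [_ _ _ _ /andP[]].
    by rewrite !subUset !sub1set aA bA vA' PA' QA' MA'.
  apply/subsetP => w wA; rewrite !in_setU MAw !in_set1 wA.
  by do 3! [case: (_ == _); rewrite ?orbT //=]; case: (w \in P); case: (w \in Q).
split=> //; split=> //; last by rewrite cM2 cM1 cM prednK.
apply/subsetP => e eM; rewrite mem_link1.
have eA : e \subset A :\ v.
  apply/subsetP => w we; have wc : w \in cover ((a |: P) |: (b |: Q |: M)).
    by apply/bigcupP; exists e.
  rewrite in_setD1 -cov in_setU1 wc orbT andbT; apply: contraTneq wc => ->.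
  rewrite MA2 MA1 !in_setU MAw !in_set1 eqxx !andbF orbF.
  have /and3P [vb va _] : [&& v != b, v != a & v \in A] by move: vA; rewrite !inE.
  rewrite (negPf va) (negPf vb) /= negb_or; apply/andP; split; apply/negP.
    by move=> /PAw; rewrite eqxx.
  by move=> /QAw; rewrite eqxx andbF.
have ve : v \notin e by apply/negP => /(subsetP eA); rewrite !inE eqxx.
rewrite ve /=; apply: full.
- have vA' : v \in A by move: vA; rewrite !inE => /and3P[].
  by rewrite subUset sub1set vA' /=; apply: subset_trans eA (subsetDl _ _).
- by rewrite cardsU1 ve (eqP (forall_inP uM2 _ eM)).
have /and3P [vb va _] : [&& v != b, v != a & v \in A] by move: vA; rewrite !inE.
rewrite !in_setU1 ![_ == v]eq_sym (negPf va) (negPf vb) /=; apply/negP => /andP [ae be].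
move: eM; rewrite !in_setU1 => /or3P [/eqP E|/eqP E|eM].
- move: be; rewrite E in_setU1 eq_sym (negPf ab) => /PAw; by rewrite eqxx !andbF.
- move: ae; rewrite E in_setU1 (negPf ab) => /QAw; by rewrite eqxx !andbF.
have : a \in cover M by apply/bigcupP; exists e.
by rewrite MAw eqxx !andbF.
Qed.

(** The centre is taken in [P], so that [u |: P] is the only edge of the star through [u] and all
    others lie in the clique. *)
Lemma star_of_clique T G (A P : {set V}) u : #|A| = (3 * T + 3)%N -> u \notin A ->
  P \subset A -> #|P| = 3 -> u |: P \in G ->
  (forall e, e \subset A -> #|e| = 4 -> e \in G) ->
  exists v M, star_config T.+1 G v M /\ v |: cover M = u |: A.
Proof.
move=> cA uA PA cP uP full.
have [v vP] : exists v, v \in P by apply/card_gt0P; rewrite cP.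
have vA := subsetP PA _ vP.
have vu : v != u by apply: contraNneq uA => <-.
have [M [uM tM cM MA]] : exists M, [/\ uniform 3 M, trivIset M, #|M| = T & cover M = A :\: P].
  by apply: triples_cover; rewrite cardsD (setIidPr PA) cA cP; clear; lia.
have MAw w : w \in cover M = (w \notin P) && (w \in A) by rewrite MA in_setD.
have uPv : u \notin P :\ v by apply: contra uA => /setD1P [_ /(subsetP PA)].
have [uM1 tM1 cM1 MA1] : [/\ uniform 3 ((u |: (P :\ v)) |: M), trivIset ((u |: (P :\ v)) |: M),
   #|(u |: (P :\ v)) |: M| = #|M|.+1 & cover ((u |: (P :\ v)) |: M) = (u |: (P :\ v)) :|: cover M].
  apply: add_triple => //; first by rewrite cardsU1 uPv; move: cP; rewrite (cardsD1 v) vP !add1n => -[->].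
  rewrite -setI_eq0 -subset0; apply/subsetP => w; rewrite in_setI MAw in_setU1 in_setD1 inE.
  case/andP => /orP [/eqP ->|/andP [_ wP]]; first by rewrite (negPf uA) andbF.
  by rewrite wP.
exists v, ((u |: (P :\ v)) |: M).
have cov : v |: cover ((u |: (P :\ v)) |: M) = u |: A.
  apply/setP => w; rewrite MA1 !in_setU MAw !in_set1 in_setD1.
  case: (eqVneq w v) => [->|wv] /=; first by rewrite vA orbT.
  case: (eqVneq w u) => [//|wu] /=; case: (boolP (w \in P)) => //= wP.
  by rewrite (subsetP PA).
split=> //; split=> //; last by rewrite cM1 cM.
apply/subsetP => e eM; rewrite mem_link1.
move: (eM); rewrite in_setU1 => /orP [/eqP ->|eM'].
  rewrite in_setU1 in_setD1 eqxx (negPf vu) /=.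
  by rewrite setUCA setD1K.
have ec w : w \in e -> w \in A :\: P.
  by move=> we; rewrite -MA; apply/bigcupP; exists e.
have ve : v \notin e by apply/negP => /ec; rewrite inE vP.
rewrite ve /=; apply: full; last by rewrite cardsU1 ve (eqP (forall_inP uM _ eM')).
rewrite subUset sub1set vA; apply/subsetP => w /ec; by rewrite inE => /andP[].
Qed.

End Stars.

(** * Properly colouring the vertices of high degree *)

Section Extend.
Import Order.TTheory GRing.Theory Num.Theory.
Local Open Scope ring_scope.
Variables (R : realFieldType) (V C : finType).
Implicit Types (x : V -> R) (e A S : {set V}) (G H P M : {set {set V}}) (psi : V -> C) (D J : {set C}).

Definition cod x G u w := lam x (link G [set u; w]).

(* No star has all pairs of its vertex set of weighted codegree at least [kap]; one pair
   [a], [b] may be covered by a single edge instead, which meets the star only in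
   [a], [b] when [h] holds. *)
Definition norich T G x (kap : R) (h : bool) := forall v M a b,
  star_config T.+1 G v M -> a \in v |: cover M -> b \in v |: cover M -> a != b ->
  (kap <= cod x G a b \/ exists2 e0, e0 \in G &
     [/\ a \in e0, b \in e0 & h -> e0 :&: (v |: cover M) \subset [set a; b]]) ->
  (forall u w, u \in v |: cover M -> w \in v |: cover M -> u != w ->
     [set u; w] != [set a; b] -> kap <= cod x G u w) -> False.

Lemma linkD G H (D0 : {set V}) : link (G :\: H) D0 = link G D0 :\: link H D0.
Proof.
apply/setP => e; rewrite !inE; case: [disjoint e & D0] => //=.
Qed.

Lemma lamD_ge x G H : (forall v, 0 <= x v) -> lam x G - lam x H <= lam x (G :\: H).
Proof.
move=> x0; rewrite lerBlDr; apply: le_trans (lamU _ _ x0); apply: lamS => //.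
by apply/subsetP => e eG; rewrite !inE eG; case: (e \in H).
Qed.

Lemma lam_link_ge x G (D0 : {set V}) : (forall v, 0 <= x v) ->
  wt x D0 * lam x (link G D0) <= lam x G.
Proof.
move=> x0; rewrite -sum_link /lam [leRHS](bigID (fun e => D0 \subset e)) /= lerDl.
by apply: sumr_ge0 => e _; apply: wt_ge0.
Qed.

Lemma sumU_le (phi : {set V} -> R) (P Q : {set {set V}}) : (forall e, 0 <= phi e) ->
  \sum_(e in P :|: Q) phi e <= \sum_(e in P) phi e + \sum_(e in Q) phi e.
Proof.
move=> p0; rewrite (big_setID P) /=.
rewrite (_ : (P :|: Q) :&: P = P); last by apply/setIidPr/subsetUl.
rewrite lerD2l (_ : (P :|: Q) :\: P = Q :\: P); last first.
  by apply/setP => e; rewrite !inE; case: (e \in P).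
by rewrite [leRHS](big_setID P) /= lerDr sumr_ge0.
Qed.

Lemma totU_le x A S : (forall v, 0 <= x v) -> tot x (A :|: S) <= tot x A + tot x S.
Proof.
move=> x0; rewrite /tot (big_setID A) /=.
rewrite (_ : (A :|: S) :&: A = A); last by apply/setIidPr/subsetUl.
rewrite lerD2l; apply: totS => //; apply/subsetP => v; rewrite !inE.
by case: (v \in A).
Qed.

Section Fixed.
Variables (T : nat) (G : {set {set V}}) (x : V -> R) (psi : V -> C) (kap : R) (h : bool).
Variables (be rho eta xh : R).
Hypothesis T0 : (0 < T)%N.
Hypothesis uG : uniform 4 G.
Hypothesis x0 : forall v, 0 <= x v.
Hypothesis W1 : tot x [set: V] = 1.
Hypothesis cC : #|C| = (3 * T + 3)%N.
Hypothesis nr : norich T G x kap h.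
Hypothesis be0 : 0 < be.
Hypothesis yb : forall i, be <= pw x psi i.
Hypothesis kb : kap <= be ^+ 2 / 2.
Hypothesis rho0 : 0 < rho.
Hypothesis eta0 : 0 <= eta.

(** [Mis] holds the rainbow 4-sets missing from [G]. [MisA i a] holds the triples that the link of
    [a] would contain if [G] were complete multipartite and [a] lay in part [i], but does not
    contain. *)
Let Mis := rbow psi 4 [set: C] :\: G.
Let MisA i a := rbow psi 3 (~: [set i]) :\: link G [set a].
(** The vertex [a] behaves like a member of part [i], whatever its colour. *)
Definition typ a i := lam x (MisA i a) <= rho.

Hypothesis misE : lam x Mis <= eta.
Hypothesis xhE : forall e0, e0 \in G -> h -> tot x e0 <= xh.
Hypothesis xh0 : 0 <= xh.

Lemma th0 : 0 < be ^+ 2 / 2. Proof. by rewrite divr_gt0 // exprn_gt0. Qed.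

Lemma elsym2_be D : (2 <= #|D|)%N -> be ^+ 2 <= elsym (pw x psi) D 2.
Proof.
move=> /subset_card [P PD Pc].
apply: le_trans (_ : wt (pw x psi) P <= _).
  by rewrite -Pc -prodr_const /wt; apply: ler_prod => i _; rewrite (ltW be0) yb.
rewrite /elsym /lam (bigD1 P) /=; last by rewrite inE PD Pc eqxx.
by rewrite lerDl sumr_ge0 // => e _; apply: wt_ge0 => i; apply: pw_ge0.
Qed.

Lemma cardCD (D : {set C}) : (#|D| + #|~: D| = 3 * T + 3)%N.
Proof. by rewrite cardsC cC. Qed.

(** The rainbow completions of [p] weigh at least [be ^+ 2], and a codegree below [kap] accounts for
    at most half of that. *)
Lemma pair_low p : p \in rbow psi 2 [set: C] -> lam x (link G p) < kap ->
  be ^+ 2 / 2 <= lam x (link Mis p).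
Proof.
move=> /rbowP [/eqP/cards2P [u [w [uw ->]]] _ inj] low.
have puw : psi w != psi u.
  by apply: contraNneq uw => E; apply/eqP/inj; rewrite ?inE ?eqxx ?orbT.
have E : link (rbow psi 4 [set: C]) [set u; w] = rbow psi 2 ([set: C] :\ psi u :\ psi w).
  by rewrite -link_link1 // !link_rbow // !inE puw.
rewrite linkD; apply: le_trans (lamD_ge _ _ x0); rewrite E lam_rbow.
have c2 : (2 <= #|[set: C] :\ psi u :\ psi w|)%N.
  have := cardsD1 (psi u) [set: C]; rewrite (cardsD1 (psi w) ([set: C] :\ psi u)) !inE puw cardsT cC.
  by move: T0; clear -T0; lia.
by move: (elsym2_be c2) low kb; lra.
Qed.

Lemma single_low i a w : w != a -> psi w != i -> cod x G a w < kap ->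
  be ^+ 2 / 2 <= lam x (link (MisA i a) [set w]).
Proof.
move=> wa wi low; rewrite linkD; apply: le_trans (lamD_ge _ _ x0).
rewrite link_rbow ?inE // lam_rbow link_link1 1?eq_sym //.
have c2 : (2 <= #|~: [set i] :\ psi w|)%N.
  have := cardCD [set i]; rewrite cards1 (cardsD1 (psi w) (~: [set i])) !inE wi.
  by move: T0; clear -T0; lia.
by move: (elsym2_be c2) low kb; rewrite /cod; lra.
Qed.

(** The link of [a] has no triple through [a], so all rainbow triples through [a] off colour [i]
    count as missing. *)
Lemma typ_weight a i : typ a i -> psi a != i -> x a <= rho / be ^+ 2.
Proof.
move=> ta ai; rewrite ler_pdivlMr ?exprn_gt0 //; apply: le_trans ta.
apply: le_trans (lam_link_ge (MisA i a) [set a] x0); rewrite wt1 ler_wpM2l //.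
rewrite linkD; apply: le_trans (lamD_ge _ _ x0).
rewrite link_rbow ?inE // lam_rbow (_ : link (link G [set a]) [set a] = set0); last first.
  by apply/setP => e; rewrite !mem_link1 setU11 /= andbF inE.
rewrite /lam big_set0 subr0; apply: elsym2_be.
have := cardCD [set i]; rewrite cards1 (cardsD1 (psi a) (~: [set i])) !inE ai.
by move: T0; clear -T0; lia.
Qed.

Hypothesis small1 : eta + 2 * rho + 16 * eta / (be ^+ 2 / 2) + 2 * (8 * rho / (be ^+ 2 / 2))
  < (be / 2) ^+ (3 * T + 2).
Hypothesis rho_be : 2 * (rho / be ^+ 2) + xh <= be / 2.

Lemma rbow_subset k q D A e : A \in rbow psi k D -> e \subset A -> #|e| = q ->
  e \in rbow psi q D.
Proof.
move=> /rbowP [_ AD inj] /subsetP eA eq; apply/rbowP; split=> //; first by move=> v /eA /AD.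
by move=> u w /eA uA /eA wA; apply: inj.
Qed.

Lemma rbow_pair_low : lam x [set p in rbow psi 2 [set: C] | lam x (link G p) < kap] <=
  16 * eta / (be ^+ 2 / 2).
Proof.
have uM : uniform 4 Mis by apply: uniform_sub (uniform_rbow psi 4 [set: C]); apply: subsetDl.
apply: le_trans (_ : (2 ^ 4)%:R * lam x Mis / (be ^+ 2 / 2) <= _).
  apply: le_trans (sum_low 2 x0 th0 uM); apply: lamS => //.
  apply/subsetP => p; rewrite !inE => /andP [pr low].
  rewrite pair_low ?inE // andbT; by case/and3P: pr.
rewrite ler_wpM2r ?invr_ge0 ?(ltW th0) // ler_wpM2l //.
Qed.

(** A suitable transversal of the parts other than [i] forms with [a] and [b] a set in which every
    4-set not containing both is an edge and every pair except [a], [b] has large codegree. The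
    remaining pair is covered by [e0], and a star spanning this set contradicts [norich]. *)
Lemma two_typical a b i e0 : a != b -> typ a i -> typ b i -> e0 \in G -> a \in e0 -> b \in e0 -> False.
Proof.
move=> ab ta tb e0G ae0 be0'.
(* When [h] holds, the transversal must also avoid [e0], so that this edge meets the star only in
   [a] and [b]. *)
pose E0 : {set V} := if h then e0 else set0.
pose P j : {set V} := (psi @^-1: [set j]) :\: ([set a; b] :|: E0).
pose J : {set C} := ~: [set i].
have cJ : #|J| = (3 * T + 2)%N by have := cardCD [set i]; rewrite cards1 -/J; clear -T0; lia.
pose out (e : {set V}) := (a \notin e) && (b \notin e).
pose B4 := [set e in Mis | out e].
pose M3 c := [set e in MisA i c | out e].
pose B3 c : {set {set V}} := [set c |: e | e : {set V} in M3 c].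
pose B2 := [set p in [set p in rbow psi 2 [set: C] | lam x (link G p) < kap] | out p].
pose Wc c := [set w | [&& w != a, w != b, psi w != i & cod x G c w < kap]].
pose B1 c : {set {set V}} := [set [set c; w] | w in Wc c].
(* The obstructions are missing rainbow 4-sets, triples missing from the links of [a] and [b], and
   pairs of low codegree, either inside the transversal or with one end in [a] or [b]. They account
   for the terms of [small1]. *)
pose Bad := B4 :|: (B3 a :|: (B3 b :|: (B2 :|: (B1 a :|: B1 b)))).
have outE e : out e -> e :\: [set a; b] = e.
  move=> /andP [ae be']; apply/setDidPl; rewrite -setI_eq0 -subset0.
  apply/subsetP => w; rewrite !inE => /andP [we /orP [/eqP E|/eqP E]].
    by rewrite -E we in ae.
  by rewrite -E we in be'.
pose phi (e : {set V}) := wt x (e :\: [set a; b]).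
have phi0 e : 0 <= phi e by apply: wt_ge0.
have cab c : c \in [set a; b] -> typ c i by rewrite !inE => /orP [/eqP ->|/eqP ->].
have s3 c : c \in [set a; b] -> \sum_(e in B3 c) phi e <= rho.
  move=> cD; have oc e : out e -> c \notin e.
    by move=> /andP [ae be']; move: cD; rewrite !inE => /orP [/eqP ->|/eqP ->].
  rewrite /B3 big_imset /=; last first.
    move=> e f; rewrite !inE => /andP [_ /oc ce] /andP [_ /oc cf] E.
    by rewrite -(setU1K ce) E setU1K.
  apply: le_trans (cab c cD); rewrite -/(MisA i c).
  apply: le_trans (lamS x0 (restr_sub _ out)); rewrite -/(M3 c).
  apply: ler_sum => e; rewrite inE => /andP [_ oe]; rewrite /phi.
  by rewrite setDUl (outE _ oe) (_ : [set c] :\: _ = set0) ?set0U //; apply/eqP; rewrite setD_eq0 sub1set.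
have s1 c : c \in [set a; b] -> \sum_(e in B1 c) phi e <= 8 * rho / (be ^+ 2 / 2).
  move=> cD; rewrite /B1 big_imset /=; last first.
    move=> u w; rewrite !inE => /and4P [ua ub _ _] /and4P [wa wb _ _] E.
    have : u \in [set c; w] by rewrite -E !inE eqxx orbT.
    rewrite !inE => /orP [/eqP uc|/eqP //].
    by move: cD; rewrite -uc !inE (negPf ua) (negPf ub).
  have uMA : uniform 3 (MisA i c) by apply: uniform_sub (uniform_rbow psi 3 (~: [set i])); apply: subsetDl.
  apply: le_trans (_ : (2 ^ 3)%:R * lam x (MisA i c) / (be ^+ 2 / 2) <= _); last first.
    by rewrite ler_wpM2r ?invr_ge0 ?(ltW th0) // ler_wpM2l //; apply: cab.
  apply: le_trans (sum_low 1 x0 th0 uMA).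
  apply: le_trans (_ : lam x [set [set w] | w in Wc c] <= _).
    rewrite /lam big_imset /=; last by move=> u w _ _; apply: set1_inj.
    apply: ler_sum => w; rewrite !inE => /and4P [wa wb _ _]; rewrite /phi.
    rewrite setDUl (_ : [set c] :\: _ = set0) ?set0U; last by apply/eqP; rewrite setD_eq0 sub1set.
    rewrite (_ : [set w] :\: _ = [set w]) ?lexx //; apply/setDidPl.
    by rewrite disjoints1 !inE negb_or wa wb.
  apply: lamS => //; apply/subsetP => _ /imsetP [w wW ->].
  move: wW; rewrite inE => /and4P [wa wb wi low]; rewrite inE cards1 eqxx /=; apply: single_low => //.
  by move: cD; rewrite !inE => /orP [/eqP ->|/eqP ->].
have sB : \sum_(e in Bad) phi e < (be / 2) ^+ (3 * T + 2).
  apply: le_lt_trans small1.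
  have aD : a \in [set a; b] by rewrite !inE eqxx.
  have bD : b \in [set a; b] by rewrite !inE eqxx orbT.
  have s4 : \sum_(e in B4) phi e <= eta.
    apply: le_trans misE; apply: le_trans (lamS x0 (restr_sub _ out)).
    by apply: ler_sum => e; rewrite inE => /andP [_ oe]; rewrite /phi outE.
  have s2 : \sum_(e in B2) phi e <= 16 * eta / (be ^+ 2 / 2).
    apply: le_trans rbow_pair_low; apply: le_trans (lamS x0 (restr_sub _ out)).
    by apply: ler_sum => e; rewrite inE => /andP [_ oe]; rewrite /phi outE.
  have u1 := sumU_le B4 (B3 a :|: (B3 b :|: (B2 :|: (B1 a :|: B1 b)))) phi0.
  have u2 := sumU_le (B3 a) (B3 b :|: (B2 :|: (B1 a :|: B1 b))) phi0.
  have u3 := sumU_le (B3 b) (B2 :|: (B1 a :|: B1 b)) phi0.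
  have u4 := sumU_le B2 (B1 a :|: B1 b) phi0.
  have u5 := sumU_le (B1 a) (B1 b) phi0.
  have v1 := s3 a aD; have v2 := s3 b bD; have v3 := s1 a aD; have v4 := s1 b bD.
  apply: (le_trans u1); apply: le_trans (lerD s4 (le_trans u2 (lerD v1 (le_trans u3 (lerD v2 (le_trans u4 (lerD s2 (le_trans u5 (lerD v3 v4))))))))) _.
  by rewrite le_eqVlt; apply/orP; left; apply/eqP; ring.
have totP j : j \in J -> be / 2 <= tot x (P j).
  rewrite !inE => ji.
  have single c : typ c i -> tot x ([set c] :&: psi @^-1: [set j]) <= rho / be ^+ 2.
    move=> tc; have [cj|cj] := eqVneq (psi c) j.
      rewrite (_ : _ :&: _ = [set c]); last by apply/setIidPl; rewrite sub1set !inE cj.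
      by rewrite /tot big_set1; apply: typ_weight tc _; rewrite cj.
    rewrite (_ : _ :&: _ = set0) ?[tot _ _]big_set0 ?divr_ge0 ?(ltW rho0) ?exprn_ge0 ?(ltW be0) //.
    by apply/setP => w; rewrite !inE; apply/negP => /andP [/eqP ->]; rewrite (negPf cj).
  have e1 : tot x E0 <= xh.
    rewrite /E0; case: ifP => hh; first exact: xhE.
    by rewrite [tot _ _]big_set0.
  have : be <= tot x (P j) + (rho / be ^+ 2 + (rho / be ^+ 2 + xh)).
    apply: le_trans (yb j) _; rewrite /pw.
    apply: le_trans (_ : tot x (P j :|: (([set a] :&: psi @^-1: [set j]) :|:
       (([set b] :&: psi @^-1: [set j]) :|: E0))) <= _).
      apply: totS => //; apply/subsetP => w; rewrite !inE => ->; rewrite !andbT.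
      by case: (w == a); case: (w == b); case: (w \in E0).
    apply: le_trans (totU_le _ _ x0) _; rewrite lerD2l.
    apply: le_trans (totU_le _ _ x0) _; apply: lerD; first exact: single.
    apply: le_trans (totU_le _ _ x0) _; apply: lerD; [exact: single | exact: e1].
  by move: rho_be; lra.
have prodP : (be / 2) ^+ (3 * T + 2) <= \prod_(j in J) tot x (P j).
  rewrite -cJ -prodr_const; apply: ler_prod => j jJ; rewrite totP // andbT.
  by rewrite divr_ge0 // ltW.
have W1' : tot x [set: V] <= 1 by rewrite W1.
have Ppsi j v : v \in P j -> psi v = j by rewrite !inE => /andP [_ /eqP].
have [A [AR AP nb]] := transversal x0 W1' Ppsi (lt_le_trans sB prodP).
have nbF e : e \in Bad -> e \subset A :|: [set a; b] -> False.
  by move=> /nb /negP.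
have Ares w : w \in A -> [/\ w != a, w != b, w \notin E0 & psi w != i].
  move=> wA; have := AP _ wA; rewrite !inE !negb_or => /andP [/andP [/andP [-> ->] ->] _].
  by have /rbowP [_ /(_ _ wA) + _] := AR; rewrite !inE.
have Aout (e : {set V}) : e \subset A -> out e.
  move=> /subsetP eA; apply/andP; split; apply/negP => /eA /Ares []; by rewrite eqxx.
have inCA c w : c \in [set a; b] -> w \in A -> kap <= cod x G c w.
  move=> cD wA; have [wa wb _ wi] := Ares _ wA; rewrite leNgt; apply/negP => low.
  apply: (nbF [set c; w]); last by rewrite subUset !sub1set; apply/andP; split; rewrite in_setU ?cD ?wA ?orbT.
  have : [set c; w] \in B1 c by apply: imset_f; rewrite inE wa wb wi low.
  rewrite /Bad !in_setU; by move: cD; rewrite !inE => /orP [] /eqP -> ->; rewrite ?orbT.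
have inAA u w : u \in A -> w \in A -> u != w -> kap <= cod x G u w.
  move=> uA wA uw; rewrite leNgt; apply/negP => low.
  have sA : [set u; w] \subset A by rewrite subUset !sub1set uA wA.
  apply: (nbF [set u; w]); last exact: subset_trans sA (subsetUl _ _).
  have : [set u; w] \in B2.
    rewrite inE Aout // andbT inE low andbT.
    apply: rbow_subset sA _; last by rewrite cards2 uw.
    exact: (subsetP (rbow_sub psi _ (subsetT J))) AR.
  by rewrite /Bad !in_setU => ->; rewrite !orbT.
pose C0 := a |: (b |: A).
have aA : a \notin A by apply/negP => /Ares []; rewrite eqxx.
have bA : b \notin A by apply/negP => /Ares []; rewrite eqxx.
have cA : #|A| = (3 * T + 2)%N by have /rbowP [-> _ _] := AR.
have cC0 : #|C0| = (3 * T + 4)%N.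
  by rewrite /C0 !cardsU1 !inE negb_or ab aA bA cA; clear; lia.
have aC : a \in C0 by rewrite !inE eqxx.
have bC : b \in C0 by rewrite !inE eqxx orbT.
have one c (e : {set V}) : c \in [set a; b] -> e \subset A -> #|e| = 3%N -> c |: e \in G.
  move=> cD eA ec; apply/negPn/negP => ceG.
  have oe := Aout _ eA.
  have ce : c \notin e.
    by move: oe => /andP [ae be']; move: cD; rewrite !inE => /orP [/eqP ->|/eqP ->].
  have : c |: e \in B3 c.
    apply: imset_f; rewrite inE oe andbT inE mem_link1 ce (negPf ceG) /=.
    exact: rbow_subset AR eA ec.
  move=> cB; apply: (nbF (c |: e)); last first.
    by rewrite subUset sub1set in_setU cD orbT (subset_trans eA (subsetUl _ _)).
  by move: cD; rewrite /Bad !in_setU !in_set1 => /orP [] /eqP E; move: cB; rewrite E => ->; rewrite ?orbT.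
have full (e : {set V}) : e \subset C0 -> #|e| = 4%N -> ~~ ((a \in e) && (b \in e)) -> e \in G.
  move=> eC ec; have [ae|ae] := boolP (a \in e).
    move=> /= be'; rewrite -(setD1K ae); apply: one; rewrite ?inE ?eqxx //.
      apply/subsetP => w; rewrite !inE => /andP [wa we]; move: (subsetP eC _ we).
      by rewrite !inE (negPf wa) /= => /orP [/eqP E|//]; rewrite -E we in be'.
    by move: ec; rewrite (cardsD1 a) ae add1n => -[].
  move=> _; have [be'|be'] := boolP (b \in e).
    rewrite -(setD1K be'); apply: one; rewrite ?inE ?eqxx ?orbT //.
      apply/subsetP => w; rewrite !inE => /andP [wb we]; move: (subsetP eC _ we).
      by rewrite !inE (negPf wb) /= => /orP [/eqP E|//]; rewrite -E we in ae.
    by move: ec; rewrite (cardsD1 b) be' add1n => -[].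
  have eA : e \subset A.
    apply/subsetP => w we; move: (subsetP eC _ we); rewrite !inE => /or3P [/eqP E|/eqP E|//].
      by rewrite -E we in ae.
    by rewrite -E we in be'.
  apply/negPn/negP => eG; apply: (nbF e); last exact: subset_trans eA (subsetUl _ _).
  rewrite /Bad in_setU inE Aout // andbT in_setD eG.
  rewrite (rbow_subset (subsetP (rbow_sub psi _ (subsetT J)) _ AR) eA ec); by [].
have [v [M [conf core]]] := star_of_near_clique T0 cC0 aC bC ab full.
apply: (nr conf (a := a) (b := b)); rewrite ?core //.
  right; exists e0 => //; split=> // hh; apply/subsetP => w; rewrite !inE => /andP [we].
  move=> /or3P [->|->|/Ares [_ _]] //; rewrite ?orbT //.
  by rewrite /E0 hh we.
move=> u w; rewrite /C0 !inE => uC wC uw ne.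
case/or3P: uC => [/eqP E1|/eqP E1|uA]; case/or3P: wC => [/eqP E2|/eqP E2|wA].
- by rewrite E1 E2 eqxx in uw.
- by rewrite E1 E2 eqxx in ne.
- by apply: inCA => //; rewrite E1 !inE eqxx.
- by rewrite E1 E2 setUC eqxx in ne.
- by rewrite E1 E2 eqxx in uw.
- by apply: inCA => //; rewrite E1 !inE eqxx orbT.
- by rewrite /cod setUC; apply: inCA => //; rewrite E2 !inE eqxx.
- by rewrite /cod setUC; apply: inCA => //; rewrite E2 !inE eqxx orbT.
exact: inAA.
Qed.

(** For each possible trace [D] of [P] on [e], the remainders are distinct edges of the link of [D],
    which has weight at most 1. *)
Lemma sum_rem k (L : {set {set V}}) e : uniform k L ->
  \sum_(P in L) wt x (P :\: e) <= (2 ^ #|e|)%:R.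
Proof.
move=> uL; rewrite (partition_big (fun P : {set V} => P :&: e) (mem (powerset e))) /=; last first.
  by move=> P _; rewrite inE subsetIr.
rewrite -card_powerset -sumr_const; apply: ler_sum => D _.
apply: le_trans (_ : lam x (link L D) <= _); last first.
  exact: lam_le1 x0 (link_card _ uL) W1.
pose Q := [set P : {set V} in L | P :&: e == D].
rewrite (eq_bigl (mem Q)); last by move=> P; rewrite !inE.
rewrite -(big_imset (h := fun P : {set V} => P :\: e) (wt x)) /=.
  apply: (lamS x0); apply/subsetP => _ /imsetP [P PQ ->].
  move: PQ; rewrite inE => /andP [PL /eqP PD].
  rewrite inE -PD setID PL andbT -setI_eq0 -subset0; apply/subsetP => v.
  by rewrite !inE => /andP [/andP [/negPf ->]]; rewrite andbF.
move=> P P'; rewrite !inE => /andP [_ /eqP PD] /andP [_ /eqP PD'] E.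
by rewrite -(setID P e) PD -PD' E setID.
Qed.

Lemma wt_swap (P e : {set V}) : wt x P * wt x (e :\: P) = wt x e * wt x (P :\: e).
Proof.
rewrite -!wtU.
- by congr wt; apply/setP => v; rewrite !inE; case: (v \in P); case: (v \in e).
- by rewrite -setI_eq0 setDE setICA setICr setI0.
by rewrite -setI_eq0 setDE setICA setICr setI0.
Qed.

(** Averaging over [L] yields a link triple [Q] outside of which the bad sets have small weight. A
    transversal of the remaining [3 T] parts completes [Q] to a clique meeting all parts; attaching
    [u] through the edge [u |: Q] gives a forbidden star. *)
Lemma all_parts u (P : C -> {set V}) (L : {set {set V}}) (c2 tau : R) : 0 <= c2 ->
  (forall j w, w \in P j -> [/\ psi w = j, w != u & kap <= cod x G u w]) ->
  (forall j, c2 <= tot x (P j)) -> L \subset link G [set u] ->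
  (forall e, e \in L -> e \in rbow psi 3 [set: C] /\ forall w, w \in e -> w \in P (psi w)) ->
  tau <= lam x L -> 16 * (eta + 16 * eta / (be ^+ 2 / 2)) < tau * c2 ^+ (3 * T) -> False.
Proof.
move=> c20 Pp Pt LG Lp Lt small2.
have uL : uniform 3 L by apply: uniform_sub LG (link_uniform u uG).
pose B2 := [set p in rbow psi 2 [set: C] | lam x (link G p) < kap].
pose Bad := Mis :|: B2.
have Bad_card e : e \in Bad -> (#|e| <= 4)%N.
  rewrite !inE => /orP [/andP [_ /and3P [/eqP -> _ _]] //|/andP [/and3P [/eqP -> _ _] _] //].
have Bad_lam : lam x Bad <= eta + 16 * eta / (be ^+ 2 / 2).
  apply: le_trans (lamU _ _ x0) _; exact: lerD misE rbow_pair_low.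
have [Q QL Qs] : exists2 Q, Q \in L & \sum_(e in Bad) wt x (e :\: Q) < c2 ^+ (3 * T).
  case: (boolP [exists Q in L, \sum_(e in Bad) wt x (e :\: Q) < c2 ^+ (3 * T)]).
    by move=> /existsP [Q /andP [QL Qs]]; exists Q.
  move=> /existsPn nQ; exfalso.
  (* The sum over [Q] is exchanged with the sum over bad sets by [wt_swap]; a bad set has at most
     four vertices, so [sum_rem] contributes a factor of at most [2 ^ 4]. *)
  have : tau * c2 ^+ (3 * T) <= 16 * lam x Bad.
    apply: le_trans (_ : lam x L * c2 ^+ (3 * T) <= _).
      by rewrite ler_wpM2r // exprn_ge0.
    rewrite /lam mulr_suml.
    apply: le_trans (_ : \sum_(Q in L) wt x Q * (\sum_(e in Bad) wt x (e :\: Q)) <= _).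
      apply: ler_sum => Q QL; rewrite ler_wpM2l ?wt_ge0 //.
      by have := nQ Q; rewrite QL /= -leNgt.
    under eq_bigr => Q _ do rewrite mulr_sumr.
    rewrite exchange_big mulr_sumr /=; apply: ler_sum => e eB.
    under eq_bigr => Q _ do rewrite wt_swap.
    rewrite -mulr_sumr mulrC ler_wpM2r ?wt_ge0 //.
    apply: le_trans (sum_rem e uL) _; rewrite (_ : 16 = (2 ^ 4)%:R) // ler_nat.
    by rewrite leq_exp2l // Bad_card.
  by rewrite leNgt => /negP; apply; apply: le_lt_trans small2; rewrite ler_wpM2l.
have [Qr QP] := Lp _ QL.
have /rbowP [Qc _ Qinj] := Qr.
have uQ : u \notin Q by apply/negP => /QP /Pp [_]; rewrite eqxx.
pose J := ~: (psi @: Q).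
have cJ : #|J| = (3 * T)%N.
  have := cardCD (psi @: Q); rewrite (card_in_imset Qinj) Qc -/J; clear; lia.
have W1' : tot x [set: V] <= 1 by rewrite W1.
have Ppsi j v : v \in P j -> psi v = j by case/Pp.
have prodP : c2 ^+ (3 * T) <= \prod_(j in J) tot x (P j).
  by rewrite -cJ -prodr_const; apply: ler_prod => j jJ; rewrite c20 Pt.
have [A [AR AP nb]] := transversal x0 W1' Ppsi (lt_le_trans Qs prodP).
have nbF e : e \in Bad -> e \subset A :|: Q -> False by move=> /nb /negP.
have /rbowP [cA AJ Ainj] := AR.
pose A' := A :|: Q.
have AQ w : w \in A -> w \notin Q.
  by move=> /AJ; rewrite inE; apply: contra => wQ; apply: imset_f.
have dAQ : [disjoint A & Q].
  by rewrite -setI_eq0 -subset0; apply/subsetP => w; rewrite !inE => /andP [/AQ /negPf ->].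
have cA' : #|A'| = (3 * T + 3)%N.
  by rewrite cardsU (disjoint_setI0 dAQ) cards0 subn0 cA cJ Qc.
have A'P w : w \in A' -> w \in P (psi w) by rewrite inE => /orP [/AP|/QP].
have uA' : u \notin A' by apply/negP => /A'P /Pp [_]; rewrite eqxx.
have A'r : A' \in rbow psi (3 * T + 3) [set: C].
  apply/rbowP; split=> //.
  move=> v w /setUP [vA|vQ] /setUP [wA|wQ] E.
  - exact: Ainj.
  - by have := AJ _ vA; rewrite inE E imset_f.
  - by have := AJ _ wA; rewrite inE -E imset_f.
  exact: Qinj.
have full (e : {set V}) : e \subset A' -> #|e| = 4%N -> e \in G.
  move=> eA ec; apply/negPn/negP => eG; apply: (nbF e) => //.
  by rewrite in_setU in_setD eG (rbow_subset A'r eA ec).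
have uQG : u |: Q \in G by have := subsetP LG _ QL; rewrite mem_link1 => /andP[].
have [v [M [conf core]]] := star_of_clique cA' uA' (subsetUr A Q) Qc uQG full.
have [w wQ] : exists w, w \in Q by apply/card_gt0P; rewrite Qc.
have wA : w \in A' by rewrite inE wQ orbT.
have rich a b : a \in u |: A' -> b \in u |: A' -> a != b -> kap <= cod x G a b.
  rewrite !in_setU1 => /orP [/eqP ->|aA] /orP [/eqP ->|bA] ab.
  - by rewrite eqxx in ab.
  - by have [_ _] := Pp _ _ (A'P _ bA).
  - by have [_ _] := Pp _ _ (A'P _ aA); rewrite /cod setUC.
  rewrite leNgt; apply/negP => low; apply: (nbF [set a; b]); last by rewrite subUset !sub1set aA bA.
  rewrite in_setU; apply/orP; right; rewrite inE low andbT.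
  by apply: rbow_subset A'r _ _; rewrite ?subUset ?sub1set ?aA ?bA // cards2 ab.
have uC : u \in u |: A' by rewrite setU11.
have wC : w \in u |: A' by rewrite in_setU1 wA orbT.
have uw : u != w by apply: contraNneq uQ => ->.
apply: (nr conf (a := u) (b := w)); rewrite ?core //; first by left; apply: rich.
by move=> a b aC bC ab _; apply: rich.
Qed.

Let Atyp := [set a | ~~ (lam x (MisA (psi a) a) <= rho)].

Lemma tot_atyp : tot x Atyp <= 16 * eta / rho.
Proof.
have uM : uniform 4 Mis by apply: uniform_sub (uniform_rbow psi 4 [set: C]); apply: subsetDl.
apply: le_trans (_ : (2 ^ 4)%:R * lam x Mis / rho <= _); last first.
  by rewrite ler_wpM2r ?invr_ge0 ?(ltW rho0) // ler_wpM2l.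
apply: le_trans (sum_low 1 x0 rho0 uM).
apply: le_trans (_ : lam x [set [set w] | w in Atyp] <= _).
  rewrite /lam big_imset /=; last by move=> u w _ _; apply: set1_inj.
  by apply: ler_sum => w _; rewrite wt1.
apply: lamS => //; apply/subsetP => _ /imsetP [a aA ->].
rewrite inE cards1 eqxx /= linkD link_rbow ?inE // setTD.
by move: aA; rewrite inE -ltNge => /ltW.
Qed.

(** A link triple that repeats a colour must contain an atypical vertex: otherwise two vertices
    typical for the same part would share an edge, against [two_typical]. *)
Lemma nonrainbow_link u :
  lam x [set e in link G [set u] | e \notin rbow psi 3 [set: C]] <= 16 * eta / rho.
Proof.
apply: le_trans tot_atyp; set N := [set e in _ | _].
have uN : uniform 3 N by apply: uniform_sub (restr_sub _ _) (link_uniform u uG).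
apply: le_trans (lam_hit N Atyp x0) _; rewrite [X in _ + X](_ : _ = 0) ?addr0.
  by apply: ler_sum => v _; rewrite ler_piMr //; apply: lam_le1 (link_uniform v uN) W1.
rewrite /lam big1 // => e; rewrite !inE -!andbA => /and4P [ue eG nr3 dj]; exfalso.
have ec : #|e| = 3%N by apply/eqP/(forall_inP (link_uniform u uG)); rewrite inE ue.
have /imset_injP ninj : #|psi @: e| != #|e|.
  by move: nr3; rewrite ec eqxx subsetT.
apply: ninj => b c be' ce bc; apply/eqP; apply: contraT => nbc; exfalso.
have tA w : w \in e -> typ w (psi w).
  by move=> we; have := disjointFr dj we; rewrite inE => /negbFE.
apply: (two_typical nbc (tA _ be') _ eG); rewrite ?inE ?be' ?ce ?orbT // bc.
exact: tA.
Qed.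

Variables (eta1 om rp tau : R).
Hypothesis omE : forall i, clique3 R T * (1 - pw x psi i) ^+ 3 <= deg0 R T + om.
Hypothesis rp0 : 0 < rp.
Hypothesis small_typ : om + eta1 + 16 * eta / rho + rp <= rho.
Hypothesis kap_rp : 0 <= kap <= rp / 2.
Hypothesis tauE : tau <= deg0 R T - eta1 - 16 * eta / rho - kap.
Hypothesis small2 : 16 * (eta + 16 * eta / (be ^+ 2 / 2)) < tau * (rp / 2) ^+ (3 * T).

(** If some part meets little of the link, the large degree leaves no room for many missing triples
    off that part. Otherwise every part contains neighbours of large codegree with total weight at
    least [rp / 2], which [all_parts] excludes. *)
Lemma typical_exists u : deg0 R T - eta1 <= deg x G u -> exists i, typ u i.
Proof.
move=> du; set L0 := link G [set u] in du *.
have uL0 : uniform 3 L0 by apply: link_uniform.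
pose Vi i : {set V} := psi @^-1: [set i].
pose t i := lam x [set e in L0 | ~~ [disjoint e & Vi i]].
have h1 := nonrainbow_link u.
have [/existsP [i ti]|/existsPn all] := boolP [exists i, t i <= rp].
  exists i; rewrite /typ.
  have E : lam x (MisA i u) = elsym (pw x psi) (~: [set i]) 3 - lam x (rbow psi 3 (~: [set i]) :&: L0).
    rewrite -lam_rbow (lamID x (rbow psi 3 (~: [set i])) (fun e => e \in L0)).
    rewrite (_ : [set _ in _ | _ \in L0] = rbow psi 3 (~: [set i]) :&: L0); last by apply/setP => e; rewrite !inE.
    rewrite [X in _ = X - _]addrC addrK; congr lam; apply/setP => e; rewrite /MisA -/L0 in_setD [RHS]inE.
    by rewrite andbC.
  have up : lam x L0 <= lam x (rbow psi 3 (~: [set i]) :&: L0) + (16 * eta / rho + rp).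
    apply: le_trans (_ : _ <= lam x (rbow psi 3 (~: [set i]) :&: L0) +
       (lam x [set e in L0 | e \notin rbow psi 3 [set: C]] + t i)) _; last first.
      by rewrite lerD2l; apply: lerD.
    apply: le_trans (_ : _ <= lam x ((rbow psi 3 (~: [set i]) :&: L0) :|:
      ([set e in L0 | e \notin rbow psi 3 [set: C]] :|: [set e in L0 | ~~ [disjoint e & Vi i]]))) _.
      apply: lamS => //; apply/subsetP => e eL; rewrite !in_setU in_setI eL andbT ![_ \in [set _ in _ | _]]inE eL /=.
      have [er|//] := boolP (e \in rbow psi 3 [set: C]); last by rewrite orbT.
      have [dj|] := boolP [disjoint e & Vi i]; last by rewrite !orbT.
      apply/orP; left; have /rbowP [ec _ inj] := er; apply/rbowP; split=> // v ve.
      by have := disjointFr dj ve; rewrite !inE => ->.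
    apply: le_trans (lamU _ _ x0) _; rewrite lerD2l; exact: lamU.
  have mcl : elsym (pw x psi) (~: [set i]) 3 <= clique3 R T * (1 - pw x psi i) ^+ 3.
    have c2 : (#|~: [set i]| <= (3 * T).+2)%N.
      by have := cardCD [set i]; rewrite cards1; clear; lia.
    apply: le_trans (maclaurin' 3 _ c2) _; first by move=> j; apply: pw_ge0.
    have -> : tot (pw x psi) (~: [set i]) = 1 - pw x psi i.
      rewrite -[1]W1 -(tot_pw x psi) (totD1 _ (in_setT i)) addrC addKr setTD.
      by [].
    exact: lexx.
  have := omE i; move: du; rewrite E /deg -/L0 => du om_i.
  by move: small_typ; move: up mcl om_i du; lra.
exfalso; pose P j : {set V} := [set w | [&& psi w == j, w != u & kap <= cod x G u w]].
have /andP [k0 krp] := kap_rp.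
have Pp j w : w \in P j -> [/\ psi w = j, w != u & kap <= cod x G u w].
  by rewrite inE => /and3P [/eqP].
have link_le w : lam x (link L0 [set w]) <= 1.
  exact: lam_le1 x0 (link_uniform w uL0) W1.
have low w : (w == u) || (cod x G u w < kap) -> lam x (link L0 [set w]) <= kap.
  case: (eqVneq w u) => [-> _|wu /= lw].
    rewrite (_ : link L0 [set u] = set0) ?[lam _ _]big_set0 //.
    by apply/setP => e; rewrite !mem_link1 setU11 /= andbF inE.
  by rewrite link_link1 1?eq_sym // ltW.
have sumlow (S0 : {set V}) : (forall w, w \in S0 -> (w == u) || (cod x G u w < kap)) ->
   \sum_(w in S0) x w * lam x (link L0 [set w]) <= kap.
  move=> hS; apply: le_trans (_ : \sum_(w in S0) x w * kap <= _).
    by apply: ler_sum => w wS; rewrite ler_wpM2l // low // hS.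
  rewrite -mulr_suml -/(tot x S0) ler_piMl // -W1; exact: totS.
have Pt j : rp / 2 <= tot x (P j).
  have tj : rp < t j by have := all j; rewrite -ltNge.
  suff : t j <= tot x (P j) + kap by move: tj krp; lra.
  rewrite /t; apply: le_trans (lam_hit _ (Vi j) x0) _.
  rewrite [X in _ + X](_ : _ = 0) ?addr0; last first.
    by rewrite /lam big1 // => e; rewrite !inE -andbA => /and3P [_ /negP h3 /h3].
  apply: le_trans (_ : \sum_(w in Vi j) x w * lam x (link L0 [set w]) <= _).
    apply: ler_sum => w _; rewrite ler_wpM2l //; apply: lamS => //.
    by apply/subsetP => e; rewrite mem_link1 => /andP [we /setIdP [wL _]]; rewrite mem_link1 we.
  rewrite (big_setID (P j)) /=; apply: lerD.
    rewrite (_ : Vi j :&: P j = P j); last first.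
      by apply/setIidPr/subsetP => w; rewrite !inE => /and3P[].
    by apply: ler_sum => w _; rewrite ler_piMr.
  apply: sumlow => w; rewrite !inE => /andP [h3 /eqP E]; move: h3.
  by rewrite E eqxx /= negb_and negbK ltNge.
pose L := [set e in L0 | (e \in rbow psi 3 [set: C]) && [forall w in e, w \in P (psi w)]].
apply: (all_parts (u := u) (P := P) (L := L) (c2 := rp / 2) (tau := tau)) => //.
- by rewrite divr_ge0 // ltW.
- exact: restr_sub.
- by move=> e; rewrite inE => /and3P [_ er /forall_inP h3].
apply: (le_trans tauE).
suff : lam x L0 <= lam x L + (16 * eta / rho + kap) by move: du; rewrite /deg -/L0; lra.
pose U := [set w | (w == u) || (cod x G u w < kap)].
apply: le_trans (_ : _ <= lam x (L :|: ([set e in L0 | e \notin rbow psi 3 [set: C]] :|: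
   [set e in L0 | ~~ [disjoint e & U]]))) _.
  apply: lamS => //; apply/subsetP => e eL; rewrite !in_setU ![_ \in [set _ in _ | _]]inE eL /=.
  have [er|] := boolP (e \in rbow psi 3 [set: C]); last by rewrite orbT.
  have [dj|] := boolP [disjoint e & U]; last by rewrite !orbT.
  apply/orP; left; apply/forall_inP => w we; have := disjointFr dj we.
  by rewrite !inE eqxx /= => /negbT; rewrite negb_or -leNgt.
apply: le_trans (lamU _ _ x0) _; rewrite lerD2l.
apply: le_trans (lamU _ _ x0) _; apply: lerD => //.
apply: le_trans (lam_hit _ U x0) _; rewrite [X in _ + X](_ : _ = 0) ?addr0; last first.
  by rewrite /lam big1 // => e; rewrite !inE -andbA => /and3P [_ /negP h3 /h3].
apply: le_trans (_ : \sum_(w in U) x w * lam x (link L0 [set w]) <= _).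
  apply: ler_sum => w _; rewrite ler_wpM2l //; apply: lamS => //.
  by apply/subsetP => e; rewrite mem_link1 => /andP [we /setIdP [wL _]]; rewrite mem_link1 we.
by apply: sumlow => w; rewrite inE.
Qed.

(** A vertex is given a part for which it is typical, not its old colour. Vertices typical for no
    part, necessarily of low degree, get the arbitrary colour [i0]. *)
Theorem extend_colouring : exists chi : V -> C, forall e u w, e \in G ->
  u \in e -> w \in e -> deg0 R T - eta1 <= deg x G u -> deg0 R T - eta1 <= deg x G w ->
  chi u = chi w -> u = w.
Proof.
have [i0 _] : exists i : C, i \in C by apply/card_gt0P; rewrite cC; clear; lia.
exists (fun u => odflt i0 [pick i | lam x (MisA i u) <= rho]) => e u w eG ue we du dw.
have tp v : deg0 R T - eta1 <= deg x G v -> typ v (odflt i0 [pick i | lam x (MisA i v) <= rho]).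
  move=> /typical_exists [i ti]; case: pickP => [j //|/(_ i)]; by rewrite /typ in ti; rewrite ti.
move=> E; apply/eqP; apply: contraT => uw; exfalso.
have tw := tp _ dw; rewrite -E in tw.
exact: two_typical uw (tp _ du) tw eG ue we.
Qed.

End Fixed.
End Extend.

(** * Constants for the colour extension *)

Section Stability.
Import Order.TTheory GRing.Theory Num.Theory.
Local Open Scope ring_scope.

Definition cross (V C : finType) (G : {set {set V}}) (psi : V -> C) := G :&: rbow psi 4 [set: C].

(** The hypergraph and the vertex type are quantified inside, so the constants do not depend on the
    order. *)
Definition extends (R : realFieldType) T (eta1 kap xh eta : R) :=
  forall (V C : finType) (G : {set {set V}}) (x : V -> R) (psi : V -> C) (h : bool),
  uniform 4 G -> (forall v, 0 <= x v) -> tot x [set: V] = 1 -> #|C| = (3 * T + 3)%N ->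
  norich T G x kap h -> (forall e0, e0 \in G -> h -> tot x e0 <= xh) ->
  deg0 R T / 4 - eta <= lam x (cross G psi) ->
  exists chi : V -> C, forall e u w, e \in G -> u \in e -> w \in e ->
    deg0 R T - eta1 <= deg x G u -> deg0 R T - eta1 <= deg x G w -> chi u = chi w -> u = w.

Lemma elsym4_le (R : realFieldType) T (C : finType) (y : C -> R) : #|C| = (3 * T + 3)%N ->
  (forall i, 0 <= y i) -> tot y [set: C] = 1 -> elsym y [set: C] 4 <= deg0 R T / 4.
Proof.
move=> cC y0 W1; rewrite -mac4E.
have := maclaurin' (S := [set: C]) (N := 3 * T + 3) 4 y0; rewrite cardsT cC W1 expr1n mulr1.
by apply; apply: leqnn.
Qed.

Lemma balance_low (R : realFieldType) (C : finType) T (y : C -> R) (th : R) i : (0 < T)%N ->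
  #|C| = (3 * T + 3)%N -> (forall j, 0 <= y j) -> tot y [set: C] = 1 -> 0 <= th ->
  deg0 R T / 4 - deg0 R T / 4 * th ^+ 2 <= elsym y [set: C] 4 ->
  (3 * T%:R + 3)^-1 - th <= y i.
Proof.
move=> T0 cC y0 W1 th0 near; have := balance i T0 cC y0 W1 th0 near.
have t0 : 0 <= T%:R :> R := ler0n _ _.
have m0 : 0 < (3 * T%:R + 3 : R) by lra.
rewrite -ler_pdivlMr // => b1.
have E : (3 * T%:R + 2) * (1 + th) / (3 * T%:R + 3) = 1 - (3 * T%:R + 3)^-1 + th - th / (3 * T%:R + 3) :> R.
  by field; apply: lt0r_neq0.
rewrite E in b1; have : 0 <= th / (3 * T%:R + 3) by rewrite divr_ge0 // ltW.
by move: b1; clear; lra.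
Qed.

Lemma extend_constants (R : realFieldType) T (e1 : R) : (0 < T)%N -> 0 < e1 ->
  exists eta1 kap xh eta : R, [/\ 0 < eta1 <= e1, 0 < kap, 0 < xh, 0 < eta &
    extends T eta1 kap xh eta].
Proof.
move=> T0 e10; have t1 : 1 <= T%:R :> R by rewrite ler1n.
pose m : R := 3 * T%:R + 3.
have m6 : 6 <= m by rewrite /m; lra.
(* Half of the optimal part weight [1/m]; the other half leaves room for the imbalance
   [th <= be]. *)
have [be beE] : exists z, z = (2 * m)^-1 by eexists.
have m20 : 0 < 2 * m by lra.
have be0 : 0 < be by rewrite beE invr_gt0.
have be1 : be <= 1 / 12.
  by rewrite div1r beE lef_pV2 ?posrE //; lra.
have mE : m^-1 = be + be.
  by rewrite beE; field; apply: lt0r_neq0; lra.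
have [q qE] : exists z, z = be ^+ 2 / 2 by eexists.
have q0 : 0 < q by rewrite qE divr_gt0 // exprn_gt0.
have q1 : q <= 1.
  have : be ^+ 2 <= 1 by rewrite expr_le1 ?(ltW be0) //; lra.
  by rewrite qE; lra.
have [B BE] : exists z, z = (be / 2) ^+ (3 * T + 2) by eexists.
have B0 : 0 < B by rewrite BE exprn_gt0 // divr_gt0.
have B1 : B <= be / 2.
  rewrite BE addn2 exprS ler_piMr ?(ltW (divr_gt0 _ _)) //.
  by rewrite expr_le1 // ?divr_ge0 ?(ltW be0) //; lra.
have D6 := deg0_le R T.
have D0 : 0 < deg0 R T.
  by rewrite /deg0 divr_gt0 ?mulr_gt0 ?exprn_gt0 //; lra.
have [D DE] : exists z, z = deg0 R T by eexists.
rewrite -DE in D6 D0 *.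
have [rho rhoE] : exists z, z = B * q * D / 100 by eexists.
have rho0 : 0 < rho by rewrite rhoE divr_gt0 // !mulr_gt0.
have rq : rho / q <= B / 600.
  have -> : rho / q = B * (D / 100) by rewrite rhoE; field; apply: lt0r_neq0.
  by rewrite ler_wpM2l ?(ltW B0) //; move: D6; clear; lra.
have rD : rho <= D / 100.
  have -> : rho = B * q * (D / 100) by rewrite rhoE; field.
  rewrite ler_piMl ?divr_ge0 ?(ltW D0) // mulr_ile1 ?(ltW B0) ?(ltW q0) //.
  by move: B1 be1; clear; lra.
have rrq : rho <= rho / q.
  by rewrite ler_pdivlMr // ler_piMr // ltW.
pose eta1 := Num.min e1 (rho / 8).
pose th := Num.min be (rho / 16).
have r8 : 0 < rho / 8 by rewrite divr_gt0.
have r16 : 0 < rho / 16 by rewrite divr_gt0.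
have eta10 : 0 < eta1 by rewrite lt_min e10.
have th0 : 0 < th by rewrite lt_min be0.
have [eta11 eta12] : eta1 <= e1 /\ eta1 <= rho / 8 by split; rewrite ge_min lexx ?orbT.
have [th1 th2] : th <= be /\ th <= rho / 16 by split; rewrite ge_min lexx ?orbT.
clearbody th eta1.
have [c cE] : exists z, z = D / 2 * (rho / 16) ^+ (3 * T) by eexists.
have c0 : 0 < c by rewrite cE mulr_gt0 ?exprn_gt0 // divr_gt0.
(* The four bounds serve, in this order, the transversal of [two_typical], the atypical vertices,
   the balance of the parts and the averaging of [all_parts]. *)
pose eta := Num.min (Num.min rho (rho ^+ 2 / 128)) (Num.min (D / 4 * th ^+ 2) (q * c / 300)).
have eta0 : 0 < eta.
  have p1 : 0 < rho ^+ 2 / 128 by apply: divr_gt0 => //; apply: exprn_gt0.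
  have p2 : 0 < D / 4 * th ^+ 2 by apply: mulr_gt0; [apply: divr_gt0 | apply: exprn_gt0].
  have p3 : 0 < q * c / 300 by apply: divr_gt0 => //; apply: mulr_gt0.
  by rewrite !lt_min rho0 p1 p2 p3.
have : eta <= Num.min (Num.min rho (rho ^+ 2 / 128)) (Num.min (D / 4 * th ^+ 2) (q * c / 300)) by [].
rewrite !le_min => /andP [/andP [h1 h2] /andP [h3 h4]]; clearbody eta.
exists eta1, (rho / 16), (be / 4), eta; split=> //; first by rewrite eta10 eta11.
  by rewrite divr_gt0.
move=> V C G x psi h uG x0 W1 cC nr xhE near; rewrite -DE in near *.
have y0 i : 0 <= pw x psi i by apply: pw_ge0.
have Wy : tot (pw x psi) [set: C] = 1 by rewrite tot_pw.
have split4 : lam x (rbow psi 4 [set: C]) =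
    lam x (cross G psi) + lam x (rbow psi 4 [set: C] :\: G).
  rewrite (lamID x (rbow psi 4 [set: C]) (fun e => e \in G)); congr (_ + _); congr lam.
    by apply/setP => e; rewrite !inE andbC.
  by apply/setP => e; rewrite !inE andbC.
have misE : lam x (rbow psi 4 [set: C] :\: G) <= eta.
  have := elsym4_le cC y0 Wy; rewrite -lam_rbow split4 -DE.
  by move: near; clear; lra.
have near4 : D / 4 - D / 4 * th ^+ 2 <= elsym (pw x psi) [set: C] 4.
  rewrite -lam_rbow split4.
  have : 0 <= lam x (rbow psi 4 [set: C] :\: G) by apply: lam_ge0.
  by move: near h3; clear; lra.
have near4' : deg0 R T / 4 - deg0 R T / 4 * th ^+ 2 <= elsym (pw x psi) [set: C] 4.
  by rewrite -DE.
have yb i : be <= pw x psi i.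
  have := balance_low i T0 cC y0 Wy (ltW th0) near4'; rewrite -/m mE.
  by move: th1; clear; lra.
have omE i : clique3 R T * (1 - pw x psi i) ^+ 3 <= D + 2 * th.
  have yi1 : pw x psi i <= 1 by rewrite -Wy le_tot // inE.
  have m0 : 0 < m by move: m6; clear; lra.
  have bal : 1 - pw x psi i <= (1 - m^-1) * (1 + th).
    have := balance i T0 cC y0 Wy (ltW th0) near4'; rewrite -/m -ler_pdivlMr // => /le_trans; apply.
    by rewrite le_eqVlt; apply/orP; left; apply/eqP; rewrite /m; field; apply: lt0r_neq0; move: t1; clear; lra.
  apply: le_trans (_ : clique3 R T * ((1 - m^-1) * (1 + th)) ^+ 3 <= _).
    rewrite ler_wpM2l ?clique3_ge0 // lerXn2r ?nnegrE ?subr_ge0 //.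
    rewrite mulr_ge0 //; last by move: th0; clear; lra.
    by rewrite mE; move: be1; clear; lra.
  rewrite exprMn mulrA -[clique3 R T * _](deg0E R T) -DE.
  have th12 : th <= 1 / 12 by move: th1 be1; clear; lra.
  have : (1 + th) ^+ 3 <= 1 + 4 * th.
    rewrite -subr_ge0 (_ : _ - _ = th * (1 - 3 * th - th ^+ 2)); last by ring.
    by apply: mulr_ge0; [exact: ltW | move: th0 th12; clear; nra].
  move=> /(ler_wpM2l (ltW D0)) hh; apply: (le_trans hh).
  have : D * th <= 1 / 6 * th by rewrite ler_wpM2r // ltW.
  by move: th0; clear; lra.
have eq1 : eta / q <= rho / q by rewrite ler_pM2r // invr_gt0.
have eq2 : eta / rho <= rho / 128.
  by rewrite ler_pdivrMr // (_ : rho / 128 * rho = rho ^+ 2 / 128) //; ring.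
rewrite DE; have r16' : rho / 8 / 2 = rho / 16 by field.
apply: (@extend_colouring R V C T G x psi (rho / 16) h be rho eta (be / 4) T0 uG x0 W1 cC nr
  be0 yb _ rho0 misE xhE _ _ _ eta1 (2 * th) (rho / 8) (D / 2)) => //; rewrite -?qE -?DE -?BE //.
- have : rho <= q.
    rewrite rhoE -mulrA mulrAC ler_piMl ?(ltW q0) //.
    by rewrite mulrC mulr_ile1 //; move: B0 B1 be1 D0 D6; clear; lra.
  by move: rho0; clear; lra.
- by rewrite divr_ge0 // ltW.
- rewrite -!mulrA; move: eq1 rq rrq B0 h1; move: (rho / q) => z.
  rewrite -[eta / q]/(eta * q^-1); move: (eta * q^-1) => z'; clear; lra.
- have -> : 2 * (rho / be ^+ 2) = rho / q by rewrite qE; field; apply: lt0r_neq0.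
  by move: rq B1 be0; clear; lra.
- by move: eq2 th2 eta12 rho0; rewrite -mulrA; clear; lra.
- by rewrite r16' lexx ltW.
- by move: eq2 eta12 rho0 rD D0; rewrite -[16 * eta / rho]mulrA; clear; lra.
rewrite r16' -cE -[16 * eta / q]mulrA.
have e2 : eta / q <= c / 300.
  by rewrite ler_pdivrMr // (_ : c / 300 * q = q * c / 300) //; field.
have e3 : eta <= eta / q by rewrite ler_pdivlMr // ler_piMr // ltW.
by move: e2 e3 c0; clear; lra.
Qed.

End Stability.

(** * Stability for star-clique-free hypergraphs *)

Section Symmetrization.
Import Order.TTheory GRing.Theory Num.Theory.
Local Open Scope ring_scope.

(** A pair of positive codegree is covered, so all pairs of the star would be covered. *)
Lemma KFfree_norich (R : realFieldType) (V : finType) T (G : {set {set V}}) (x : V -> R) kap :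
  0 < kap -> KFfree T.+1 G -> norich T G x kap false.
Proof.
move=> k0 kf v M a b conf aC bC ab hab rich.
have [u [w [uC wC uw /negP nc]]] := kf _ _ conf; apply: nc.
have codc c d : kap <= cod x G c d -> covered G c d.
  move=> kc; have [E|[e]] := set_0Vmem (link G [set c; d]).
    by move: kc; rewrite /cod E /lam big_set0 leNgt k0.
  rewrite inE => /andP [_ eG]; apply/existsP; exists ([set c; d] :|: e).
  by rewrite eG !inE !eqxx !orbT.
have [E|ne] := eqVneq [set u; w] [set a; b]; last by apply: codc; apply: rich.
have uab : u \in [set a; b] by rewrite -E !inE eqxx.
have wab : w \in [set a; b] by rewrite -E !inE eqxx orbT.
have : covered G a b.
  case: hab => [/codc //|[e0 e0G [ae be _]]].
  by apply/existsP; exists e0; rewrite e0G ae be.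
move=> /existsP [e /and3P [eG ae be]]; apply/existsP; exists e; rewrite eG.
by move: uab wab; rewrite !inE => /orP [/eqP ->|/eqP ->] /orP [/eqP ->|/eqP ->]; rewrite ?ae ?be.
Qed.

Lemma inj_colouring (V : finType) (S : {set V}) n : (#|S| <= n.+1)%N ->
  exists psi : V -> 'I_n.+1, {in S &, injective psi}.
Proof.
move=> Sn; exists (fun v => inord (index v (enum S))) => u w uS wS E.
have idx v : v \in S -> (index v (enum S) < n.+1)%N.
  by move=> vS; apply: leq_trans Sn; rewrite cardE index_mem mem_enum.
have := congr1 (@nat_of_ord _) E; rewrite !inordK ?idx // => E2.
by rewrite -(nth_index u (_ : u \in enum S)) ?mem_enum // E2 nth_index ?mem_enum.
Qed.

Lemma degree_le1 (R : realFieldType) (V : finType) k (G : {set {set V}}) (x : V -> R) v :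
  uniform k.+1 G -> (forall v, 0 <= x v) -> tot x [set: V] = 1 -> deg x G v <= 1.
Proof. by move=> uG x0 W1; apply: lam_le1 x0 (link_uniform v uG) W1. Qed.

(** Induction on the size of the support. If all its pairs are covered, near-optimality leaves at
    most [3 T + 3] vertices, and these get distinct colours. Otherwise an uncovered pair is merged
    completely, the induction hypothesis colours the result, and the colouring is carried back. *)
Lemma stability T : (0 < T)%N ->
  exists eta1 kap xh eta etaS : rat,
  [/\ 0 < eta1, 0 < kap, 0 < xh, 0 < eta & extends T eta1 kap xh eta] /\
  [/\ 0 < etaS, etaS < eta1 ^+ 2 &
   forall (V : finType) (G : {set {set V}}) (x : V -> rat), uniform 4 G -> KFfree T.+1 G ->
     (forall v, 0 <= x v) -> tot x [set: V] = 1 -> deg0 rat T / 4 - etaS <= lam x G ->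
     exists psi : V -> 'I_(3 * T + 3), deg0 rat T / 4 - eta / 2 <= lam x (cross G psi)].
Proof.
move=> T0; have t1 : 1 <= T%:R :> rat by rewrite ler1n.
have := lag4 rat T0; rewrite /reverse_coercion => -[eps eps0 lag].
have e10 : 0 < eps / 2 by rewrite divr_gt0.
have [eta1 [kap [xh [eta [/andP [eta10 eta1eps] k0 xh0 eta0 ext]]]]] := extend_constants T0 e10.
have [D DE] : exists z, z = deg0 rat T by eexists.
have D0 : 0 < D.
  by rewrite DE /deg0 divr_gt0 ?mulr_gt0 ?exprn_gt0 //; move: t1; clear; lra.
have D6 : D <= 1 / 6 by rewrite DE deg0_le.
pose r := Num.min (eta / 8) (Num.min (1 / 8) (D / (4 * T%:R))).
have r0 : 0 < r by rewrite !lt_min !divr_gt0 //; rewrite mulr_gt0 //; move: t1; clear; lra.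
have : r <= Num.min (eta / 8) (Num.min (1 / 8) (D / (4 * T%:R))) by [].
rewrite !le_min => /andP [r1 /andP [r3 r4]]; clearbody r.
pose s := Num.min (Num.min (r * eta1 / 2) (eta1 ^+ 2 / 2)) (Num.min (eta / 8) (D / 16)).
have s0 : 0 < s.
  have p1 : 0 < r * eta1 / 2 by apply: divr_gt0 => //; apply: mulr_gt0.
  have p2 : 0 < eta1 ^+ 2 / 2 by apply: divr_gt0 => //; apply: exprn_gt0.
  by rewrite !lt_min p1 p2 !divr_gt0.
have : s <= Num.min (Num.min (r * eta1 / 2) (eta1 ^+ 2 / 2)) (Num.min (eta / 8) (D / 16)) by [].
rewrite !le_min => /andP [/andP [s1 s2] /andP [s3 s4]]; clearbody s.
have s2' : s < eta1 ^+ 2.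
  by have : 0 < eta1 ^+ 2 by [apply: exprn_gt0]; move: s2; clear; lra.
have zs : 2 * s / eta1 <= r by rewrite ler_pdivrMr //; move: s1; clear; lra.
exists eta1, kap, xh, eta, s; split=> //; split=> //.
move=> V G x uG kf.
have l01 : 0 <= deg0 rat T / 4 <= 1 / 24.
  by rewrite -DE; move: D0 D6; clear; lra.
have bd := fun y (y0 : forall v, 0 <= y v) => kf_bound T0 uG kf y0.
have lowdeg y : (forall v, 0 <= y v) -> tot y [set: V] = 1 -> deg0 rat T / 4 - s <= lam y G ->
    tot y [set v | deg y G v < deg0 rat T - eta1] <= r.
  move=> y0 W1 near; apply: le_trans zs.
  have := low_degree uG bd l01 s0 eta10 s2' y0 W1 near.
  by rewrite (_ : 4 * (deg0 rat T / 4) = deg0 rat T) //; field.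
have [n] := ubnP #|[set v | 0 < x v]|; elim: n x => // n IH x Sn x0 W1 near.
set S := [set v | 0 < x v] in Sn.
have xS v : v \notin S -> x v = 0.
  by rewrite inE -leNgt => h; apply/le_anti; rewrite h x0.
have lS := lam_rest G xS; have tS := tot_rest xS; rewrite W1 in tS.
have uGS : uniform 4 (rest G S) by apply: uniform_sub (rest_sub _ _) uG.
have kfS : KFfree T.+1 (rest G S) by apply: KFfree_sub (rest_sub _ _) kf.
have [pc|] := boolP [forall u in S, forall w in S, (u != w) ==> covered (rest G S) u w].
  have {}pc : paircov (rest G S) S.
    by move=> u w uS wS uw; have /forall_inP/(_ _ wS)/implyP := forall_inP pc _ uS; apply.
  have [small|big] := leqP #|S| (3 * T + 3).
    have [psi inj] : exists psi : V -> 'I_(3 * T + 3), {in S &, injective psi}.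
      by rewrite addn3 in small *; apply: inj_colouring.
    exists psi; apply: le_trans (_ : lam x (rest G S) <= _).
      by rewrite lS; apply: le_trans near; rewrite lerD2l lerN2; move: s3 eta0; clear; lra.
    apply: lamS => //; apply/subsetP => e; rewrite [e \in rest _ _]inE => /andP [eG eS].
    rewrite in_setI eG; apply/rbowP; split=> //; first exact/eqP/(forall_inP uG).
    by move=> u w ue we; apply: inj; apply: (subsetP eS).
  exfalso.
  have [v1 v1S] : exists v, v \in S by apply/card_gt0P; move: big; clear; lia.
  have [v vS vmax] : exists2 v, v \in S & forall w, w \in S -> x w <= x v.
    have [v vS vm] := arg_maxP x v1S; by exists v => // w wS; apply: vm.
  have xmax w : x w <= x v.
    by have [/vmax //|/xS ->] := boolP (w \in S).
  (* A vertex heavier than [r] cannot lie in the set of low-degree vertices, so its degree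
     contradicts [lag4]. If all weights are at most [r], the capped bound is too small for a vertex
     of at least average degree. *)
  have [hv|hv] := lerP (x v) r; last first.
    have dv : deg0 rat T - eta1 <= deg x G v.
      rewrite leNgt; apply/negP => low.
      have := lowdeg x x0 W1 near; rewrite leNgt => /negP; apply; apply: (lt_le_trans hv).
      by apply: le_tot => //; rewrite inE.
    have lg : deg x (rest G S) v <= deg0 rat T - eps.
      by apply: lag (rest_powerset _ _) kfS pc _ x0 xS tS vS vmax => //; rewrite -addnS in big *.
    have E : deg x G v = deg x (rest G S) v.
      rewrite /deg [LHS](lamID x (link G [set v]) (fun e => e \subset S)).
      rewrite [X in _ + X](_ : _ = 0) ?addr0; last first.
        rewrite /lam big1 // => e; rewrite inE => /andP [_ /subsetPn [w we wS]].
        by rewrite /wt (bigD1 w) //= xS // mul0r.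
      congr lam; apply/setP => e; rewrite inE !mem_link1 inE subUset sub1set vS /= andbA.
      by [].
    by move: dv lg; rewrite E; move: eta1eps eps0; clear; lra.
  have [u uS du] : exists2 u, u \in S & 4 * lam x (rest G S) <= deg x (rest G S) u.
    have [/existsP [u /andP [uS du]]|/existsPn nd] :=
      boolP [exists u, (u \in S) && (4 * lam x (rest G S) <= deg x (rest G S) u)].
      by exists u.
    have : \sum_w x w * deg x (rest G S) w < \sum_w x w * (4 * lam x (rest G S)).
      rewrite (bigD1 v) //= [ltRHS](bigD1 v) //=; apply: ltr_leD.
        rewrite ltr_pM2l; last by move: vS; rewrite inE.
        by have := nd v; rewrite vS /= -ltNge.
      apply: ler_sum => w _; have [wS|/xS ->] := boolP (w \in S); last by rewrite !mul0r.
      rewrite ler_wpM2l //; have := nd w; rewrite wS /= -ltNge; exact: ltW.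
    rewrite (sum_deg_tot x uGS) -mulr_suml (_ : \sum_w x w = 1) ?mul1r ?ltxx //.
    by rewrite -W1 /tot; apply: eq_bigl => w; rewrite inE.
  have W : tot x (S :\ u) = 1 - x u by rewrite -tS (totD1 _ uS) addrC addKr.
  have xv0 : 0 < x v by move: vS; rewrite inE.
  have fH : mfree T.+1 (link (rest G S) [set u]) by apply: link_mfree (rest_powerset _ _) kfS pc uS.
  have xal w : 0 <= x w <= x v by rewrite x0 xmax.
  have := capped3_scaled xv0 xal (link_uniform u uGS) (link_powerset u (rest_powerset G S)) fH.
  rewrite W => /(_ _) cap.
  have {}cap : deg x (rest G S) u <= T%:R * (x v * ((1 - x u) * (1 - x u - x v))) / 2.
    by apply: cap; have := xmax u; move: hv r3; clear; lra.
  have h1 : (1 - x u) * (1 - x u - x v) <= 1.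
    by have := xmax u; have := x0 u; have := x0 v; move: hv r3; clear; nra.
  have h2 : x v * ((1 - x u) * (1 - x u - x v)) <= r.
    by apply: le_trans hv; rewrite ler_piMr // ltW.
  have h3 : T%:R * (x v * ((1 - x u) * (1 - x u - x v))) <= D / 4.
    apply: le_trans (_ : T%:R * r <= _); first by rewrite ler_wpM2l // ler0n.
    apply: le_trans (ler_wpM2l (ler0n _ T) r4) _.
    rewrite le_eqVlt; apply/orP; left; apply/eqP; field.
    by apply: lt0r_neq0; move: t1; clear; lra.
  move: near du; rewrite -lS -DE.
  by move: cap h3 s4 D0; clear; lra.
rewrite negb_forall => /existsP [a]; rewrite negb_imply => /andP [aS].
rewrite negb_forall => /existsP [b]; rewrite negb_imply => /andP [bS].
rewrite negb_imply => /andP [ab unc].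
have unc' e : e \in rest G S -> a \in e -> b \notin e.
  move=> eG ae; apply/negP => be; move/negP: unc; apply.
  by apply/existsP; exists e; rewrite eG ae be.
have [k [o [ko hk]]] := merge_exists x0 ab unc'.
have [kS oS kno] : [/\ k \in S, o \in S & k != o].
  by case/orP: ko => /andP [/eqP -> /eqP ->]; rewrite // eq_sym.
have xo0 : 0 < x o by move: oS; rewrite inE.
pose y q := mv x k o q.
have yE q : 0 <= q <= x o -> [/\ forall v, 0 <= y q v, tot (y q) [set: V] = 1,
    (forall v, v \notin S -> y q v = 0) & deg0 rat T / 4 - s <= lam (y q) G].
  move=> /andP [q0 qx]; have yS v : v \notin S -> y q v = 0.
    move=> vS; rewrite /y /mv; case: eqP => [E|_]; first by rewrite E kS in vS.
    by case: eqP => [E|_]; [rewrite E oS in vS | apply: xS].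
  split=> //; first by apply: mv_ge0; rewrite // q0.
    by rewrite -W1 tot_mv ?inE.
  by apply: (le_trans near); rewrite -lS -(lam_rest G yS); apply: hk.
have xoK : 0 < (2 * x o / eta) by rewrite divr_gt0 // mulr_gt0.
(* Enough steps for each of them to move at most [eta / 2]. *)
pose K := (Num.bound (2 * x o / eta)).
have KE : 2 * x o / eta < K%:R by apply: archi_boundP; apply: ltW.
have K0 : 0 < K%:R :> rat by apply: lt_trans KE.
pose dl := x o / K%:R.
have dl0 : 0 <= dl by rewrite divr_ge0 // ltW.
have dle : dl <= eta / 2.
  rewrite /dl ler_pdivrMr //; move: KE; rewrite ltr_pdivrMr // => h.
  by move: h; clear; lra.
have dlK : dl * K%:R = x o by rewrite /dl divfK // lt0r_neq0.
(* After [j] steps back, the weight [dl * (K - j)] is still displaced from [o] to [k]: [j = 0] is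
   the merged weight and [j = K] the original one. *)
suff step j : (j <= K)%N -> exists psi : V -> 'I_(3 * T + 3),
    deg0 rat T / 4 - eta / 2 <= lam (y (dl * (K - j)%:R)) (cross G psi).
  have [psi hpsi] := step K (leqnn _); exists psi.
  rewrite subnn mulr0 in hpsi; apply: le_trans hpsi _; rewrite le_eqVlt; apply/orP; left; apply/eqP.
  apply: eq_lam => e _ v _; rewrite /y /mv addr0 subr0.
  by case: eqP => [->|_] //; case: eqP => [->|].
elim: j => [|j IHj] jK.
  rewrite subn0 dlK.
  have [|y0 Wy yS ny] := yE (x o); first by rewrite lexx ltW.
  apply: (IH (y (x o))) => //.
  suff : (#|[set v | (0 < y (x o) v)%R]| < #|S|)%N.
    by move=> hS; apply: leq_trans hS _; rewrite -ltnS.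
  apply: proper_card; apply/properP; split.
    by apply/subsetP => v; rewrite inE => yv; apply: contraLR yv => /yS ->; rewrite ltxx.
  by exists o; rewrite // inE /y /mv eq_sym (negPf kno) eqxx subrr ltxx.
have [psi hpsi] := IHj (ltnW jK).
pose q := dl * (K - j.+1)%:R.
have qE : dl * (K - j)%:R = q + dl.
  by rewrite /q -[X in _ + X]mulr1 -mulrDr natr1 subnSK.
have qx : 0 <= q <= x o.
  rewrite /q mulr_ge0 //= -dlK ler_wpM2l // ler_nat leq_subr //.
have [y0 Wy yS ny] := yE q qx.
have mvq : forall v, y (q + dl) v = mv (y q) k o dl v.
  move=> v; rewrite /y /mv; case: eqP => _; first by rewrite eqxx addrA.
  by case: eqP => [_|//]; rewrite eq_sym (negPf kno) eqxx opprD addrA.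
have uC : uniform 4 (cross G psi) by apply: uniform_sub (subsetIl _ _) uG.
(* A step back costs at most [dl <= eta / 2], so the loss grows from [eta / 2] to at most [eta]; the
   new colouring [chi] brings it down to [eta / 2] again. *)
have near_q : deg0 rat T / 4 - eta <= lam (y q) (cross G psi).
  move: hpsi; rewrite qE (eq_lam (y := mv (y q) k o dl)); last by move=> e _ v _; apply: mvq.
  rewrite lam_mv_gen //.
  have h1 : 0 <= dl ^+ 2 * lam (y q) (link (cross G psi) [set k; o]).
    by rewrite mulr_ge0 ?exprn_ge0 // lam_ge0.
  have h2 : dl * (deg (y q) (cross G psi) k - deg (y q) (cross G psi) o) <= dl.
    rewrite ler_piMr // lerBlDr; apply: le_trans (degree_le1 k uC y0 Wy) _.
    by rewrite lerDl; apply: lam_ge0.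
  by move: h1 h2 dle; clear; lra.
have cC : #|{: 'I_(3 * T + 3)}| = (3 * T + 3)%N by rewrite card_ord.
have nr := KFfree_norich (T := T) (x := y q) k0 kf.
have [//|chi hchi] := ext V _ G (y q) psi false uG y0 Wy cC nr _ near_q.
exists chi; rewrite -/q.
pose Z := [set v | deg (y q) G v < deg0 rat T - eta1].
have tZ := lowdeg _ y0 Wy ny; rewrite -/Z in tZ.
have h := lam_hit G Z y0.
have h1 : \sum_(v in Z) y q v * deg (y q) G v <= tot (y q) Z.
  by apply: ler_sum => v _; rewrite ler_piMr //; apply: degree_le1 uG y0 Wy.
have h2 : lam (y q) [set e in G | [disjoint e & Z]] <= lam (y q) (cross G chi).
  apply: (lamS y0); apply/subsetP => e; rewrite inE => /andP [eG dj].
  rewrite in_setI eG; apply/rbowP; split=> //; first exact/eqP/(forall_inP uG).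
  move=> u w ue we; apply: (hchi e) => //; rewrite leNgt; apply/negP => low.
    by have := disjointFr dj ue; rewrite inE low.
  by have := disjointFr dj we; rewrite inE low.
by move: ny tZ h h1 h2 r1 s3 eta0; rewrite /deg; clear; lra.
Qed.

End Symmetrization.

(** * Embedding the extension where codegrees are large *)

Section Embedding.
Variables (V : finType).
Implicit Types (e S U q : {set V}) (G H M : {set {set V}}).

Lemma link_uniform2 G u w : uniform 4 G -> u != w -> uniform 2 (link G [set u; w]).
Proof. by move=> uG uw; have := link_card [set u; w] uG; rewrite cards2 uw. Qed.

(** At most [#|U| * #|V|] pairs meet [U]. *)
Lemma avoid_pair L U : uniform 2 L -> #|U| * #|V| < #|L| ->
  exists2 q, q \in L & [disjoint q & U].
Proof.
move=> uL big; have [/existsP [q /andP [qL qU]]|/existsPn no] :=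
  boolP [exists q in L, [disjoint q & U]]; first by exists q.
suff : #|L| <= #|U| * #|V| by rewrite leqNgt big.
rewrite -cardsT -cardsX.
apply: leq_trans (_ : #|[set [set z.1; z.2] | z in setX U [set: V]]| <= _); last exact: leq_imset_card.
apply: subset_leq_card; apply/subsetP => q qL.
have := no q; rewrite qL /= => /pred0Pn [u /andP [uq uU]].
have uq' : u \in q by [].
have uU' : u \in U by [].
have : #|q :\ u| = 1 by have := forall_inP uL _ qL; rewrite (cardsD1 u) uq' add1n => /eqP [].
move=> /eqP/cards1P [w qw]; apply/imsetP; exists (u, w); first by rewrite inE uU' inE.
by rewrite -(setD1K uq') qw.
Qed.

(** A new pair has to avoid [F] and the fewer than [2 * size s] vertices used by the other pairs. *)
Lemma greedy (I : eqType) (s : seq I) (p : I -> {set V}) G (F : {set V}) :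
  (forall i, i \in s -> uniform 2 (link G (p i))) ->
  (forall i, i \in s -> (#|F| + 2 * size s) * #|V| < #|link G (p i)|) -> uniq s ->
  exists B : I -> {set V}, (forall i, i \in s -> B i \in link G (p i) /\ [disjoint B i & F]) /\
    (forall i j, i \in s -> j \in s -> i != j -> [disjoint B i & B j]).
Proof.
elim: s => [|i s IH] uL big; first by exists (fun=> set0); split.
move=> /= /andP [is_ us].
have sub j : j \in s -> j \in i :: s by rewrite inE => ->; rewrite orbT.
have [B [B1 B2]] : exists B : I -> {set V}, (forall i, i \in s -> B i \in link G (p i) /\ [disjoint B i & F]) /\
    (forall i j, i \in s -> j \in s -> i != j -> [disjoint B i & B j]).
  apply: IH => // j /sub js; first exact: uL.
  apply: leq_ltn_trans (big j js); rewrite leq_mul2r leq_add2l /= mulnS leq_addl orbT.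
  by [].
pose U := F :|: \bigcup_(j <- s) B j.
have cU : #|U| <= #|F| + 2 * size s.
  apply: leq_trans (leq_card_setU _ _) _; rewrite leq_add2l.
  have : forall j, j \in s -> #|B j| = 2.
    by move=> j js; have [Bj _] := B1 j js; apply/eqP/(forall_inP (uL j (sub j js))).
  clear; elim: s => [|j s IH] h; first by rewrite big_nil cards0.
  rewrite big_cons mulnS; apply: leq_trans (leq_card_setU _ _) _.
  apply: leq_add; first by rewrite h // mem_head.
  by apply: IH => k ks; apply: h; rewrite inE ks orbT.
have iin : i \in i :: s by rewrite mem_head.
have [q qL qU] : exists2 q, q \in link G (p i) & [disjoint q & U].
  apply: avoid_pair; first exact: uL.
  apply: leq_ltn_trans (big i iin); rewrite leq_mul2r; apply/orP; right.
  by apply: (leq_trans cU); rewrite leq_add2l leq_mul2l /= leqnSn.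
have qB j : j \in s -> [disjoint q & B j].
  move=> js; apply: disjointWr qU; apply: subset_trans (subsetUr _ _).
  by rewrite (big_rem j js) subsetUl.
exists (fun j => if j == i then q else B j); split.
  move=> j; rewrite inE; case: eqP => [-> _|_ /= js]; last exact: B1.
  by split=> //; apply: disjointWr qU; apply: subsetUl.
move=> j k; rewrite !inE; case: eqP => [->|_] /=; case: eqP => [->|_] //=.
- by rewrite eqxx.
- by move=> _ ks _; apply: qB.
- by move=> js _ _; rewrite disjoint_sym; apply: qB.
exact: B2.
Qed.

Lemma star_map T G v M : uniform 4 G -> star_config T.+1 G v M ->
  exists g : star_vertex 4 T.+1 -> V, [/\ injective g, forall w, g w \in v |: cover M &
    forall i, g @: star_edge 4 i \in G].
Proof.
move=> uG [/subsetP ML tM cM].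
pose Mi (i : 'I_T.+1) := nth set0 (enum M) i.
have MiM i : Mi i \in M by rewrite -mem_enum mem_nth // -cardE cM.
have Mi_inj : injective Mi.
  move=> i j /eqP; rewrite nth_uniq ?enum_uniq -?cardE ?cM // => /eqP E.
  exact: val_inj.
have cMi i : #|Mi i| = 3.
  by apply/eqP/(forall_inP (link_uniform v uG))/ML.
pose el i (j : 'I_3) := nth v (enum (Mi i)) j.
have elM i j : el i j \in Mi i by rewrite -mem_enum mem_nth // -cardE cMi.
have vMi i : v \notin Mi i by have := ML _ (MiM i); rewrite mem_link1 => /andP[].
pose g (w : star_vertex 4 T.+1) := if w is Some z then el z.1 z.2 else v.
exists g; split.
- case=> [[i j]|] [[k l]|] //= E.
  + have ik : i = k.
      apply: Mi_inj; apply/eqP; apply: contraT => ne.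
      have /trivIsetP/(_ _ _ (MiM i) (MiM k) ne) := tM => /disjointFr /(_ (elM i j)).
      by rewrite E elM.
    move: E; rewrite ik => /eqP; rewrite /el nth_uniq ?enum_uniq -?cardE ?cMi // => /eqP jl.
    by congr (Some (_, _)); apply: val_inj.
  + by have := vMi i; rewrite -E elM.
  by have := vMi k; rewrite E elM.
- case=> [[i j]|] /=; last by rewrite setU11.
  rewrite in_setU1; apply/orP; right; apply/bigcupP; exists (Mi i); [exact: MiM | exact: elM].
move=> i; rewrite (_ : g @: star_edge 4 i = v |: Mi i).
  by have := ML _ (MiM i); rewrite mem_link1 => /andP[].
apply/setP => w; apply/imsetP/setU1P => [[z zi ->]|[->|wM]].
- move: zi; rewrite in_setU1 => /orP [/eqP ->|/imsetP [j _ ->]]; first by left.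
  by right; apply: elM.
- by exists None; rewrite // setU11.
have wlt : index w (enum (Mi i)) < 3 by rewrite -(cMi i) cardE index_mem mem_enum.
exists (Some (i, Ordinal wlt)); last by rewrite /= /el nth_index ?mem_enum.
by rewrite in_setU1 /=; apply: imset_f.
Qed.

Notation ext_pairs T := (uncovered_pair (3 * T.+1 + 1) (linear_star 4 T.+1)).

(** Here [p] is the number of vertices of the star, so the core has no added vertices. *)
Lemma core_inr_absurd T (k : 'I_(3 * T.+1 + 1 - #|star_vertex 4 T.+1|)) : False.
Proof.
have := leq_ltn_trans (leq0n k) (ltn_ord k).
by rewrite (card_star_vertex 4 T.+1) /= subnn.
Qed.

(** When [h] holds, the pair [a], [b] is not joined greedily but through the given edge [e0]; the
    vertices of [e0] are reserved by including them in the set to be avoided. *)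
Lemma embed_extension T G v M (a b : V) (h : bool) e0 :
  uniform 4 G -> star_config T.+1 G v M ->
  (h -> [/\ a != b, e0 \in G, a \in e0, b \in e0 & e0 :&: (v |: cover M) \subset [set a; b]]) ->
  (forall u w, u \in v |: cover M -> w \in v |: cover M -> u != w ->
     ~~ (h && ([set u; w] == [set a; b])) ->
     (#|(v |: cover M) :|: e0| + 2 * #|{: ext_pairs T}|) * #|V| < #|link G [set u; w]|) ->
  contains G (extension 4 (3 * T.+1 + 1) (linear_star 4 T.+1)).
Proof.
move=> uG conf exc rich.
have [g [ginj gcore gedge]] := star_map uG conf.
set K := v |: cover M in gcore exc rich *.
pose W := star_vertex 4 T.+1.
pose cr := core (3 * T.+1 + 1) W.
pose g' (c : cr) : V := match c with inl w => g w | inr _ => v end.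
have g'inj : injective g'.
  move=> [w|k] [w'|k'] //=; last 3 first.
  - by case: (core_inr_absurd k').
  - by case: (core_inr_absurd k).
  - by case: (core_inr_absurd k).
  by move=> /ginj ->.
have g'core c : g' c \in K by case: c => [w|k] /=; [exact: gcore | case: (core_inr_absurd k)].
pose p (P : ext_pairs T) : {set V} := g' @: val P.
have p2 P : exists u w, [/\ u \in K, w \in K, u != w & p P = [set u; w]].
  have /andP [/cards2P [c [d [cd Pcd]]] _] := valP P.
  exists (g' c), (g' d); split=> //; first by rewrite (inj_eq g'inj).
  by rewrite /p Pcd imsetU1 imset_set1.
have pinj : injective p.
  by move=> P Q /(imset_inj g'inj) /val_inj.
pose F := K :|: e0.
pose s := [seq P <- enum {: ext_pairs T} | ~~ (h && (p P == [set a; b]))].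
have us : uniq s by rewrite filter_uniq ?enum_uniq.
have ss : size s <= #|{: ext_pairs T}| by rewrite size_filter cardE count_size.
have [B [B1 B2]] : exists B : ext_pairs T -> {set V},
   (forall i, i \in s -> B i \in link G (p i) /\ [disjoint B i & F]) /\
   (forall i j, i \in s -> j \in s -> i != j -> [disjoint B i & B j]).
  apply: greedy => // P; rewrite mem_filter => /andP [hP _]; have [u [w [uK wK uw E]]] := p2 P.
    by rewrite E; apply: link_uniform2.
  rewrite E in hP *; apply: leq_ltn_trans (rich u w uK wK uw hP).
  by rewrite leq_mul2r leq_add2l leq_mul2l ss !orbT.
pose BB P := if h && (p P == [set a; b]) then e0 :\: [set a; b] else B P.
have ins P : ~~ (h && (p P == [set a; b])) -> P \in s by move=> hP; rewrite mem_filter hP mem_enum.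
have BB1 P : BB P \in link G (p P) /\ [disjoint BB P & K].
  rewrite /BB; case: ifP => [/andP [hh /eqP E]|/negbT /ins /B1 [L D]]; last first.
    by split=> //; apply: disjointWr D; apply: subsetUl.
  have [ab eG ae be eK] := exc hh; rewrite E inE; split.
    rewrite -setI_eq0 setDE -setIA (setIC _ [set a; b]) setICr setI0 eqxx /=.
    rewrite (_ : [set a; b] :|: _ = e0) //; apply/setP => w; rewrite !inE.
    have [->|wa] := eqVneq w a; first by rewrite ae.
    by have [->|wb] := eqVneq w b; rewrite ?be /= ?andbT.
  rewrite -setI_eq0 -subset0; apply/subsetP => w; rewrite in_setI in_setD => /andP [/andP [nw we] wK].
  by have := subsetP eK w; rewrite in_setI we wK (negPf nw) => /(_ isT).
have BB2 P Q : P != Q -> [disjoint BB P & BB Q].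
  move=> PQ; rewrite /BB; case: ifP => [/andP [hh /eqP E]|/negbT /ins Ps]; case: ifP => [/andP [_ /eqP E']|/negbT /ins Qs].
  - by move: PQ; rewrite (pinj P Q) ?eqxx // E E'.
  - have [_ D] := B1 _ Qs; rewrite disjoint_sym; apply: disjointWr D.
    exact: subset_trans (subsetDl _ _) (subsetUr _ _).
  - have [_ D] := B1 _ Ps; apply: disjointWr D.
    exact: subset_trans (subsetDl _ _) (subsetUr _ _).
  exact: B2.
have cB P : #|BB P| = 2.
  have [u [w [uK wK uw E]]] := p2 P; have [L _] := BB1 P; rewrite E in L.
  exact/eqP/(forall_inP (link_uniform2 uG uw)).
pose el P (k : 'I_(4 - 2)) := nth v (enum (BB P)) k.
have elB P k : el P k \in BB P by rewrite -mem_enum mem_nth // -cardE cB.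
have elK P k : el P k \notin K.
  by have [_ D] := BB1 P; rewrite (disjointFr D (elB P k)).
pose f (z : ext_vertex 4 (3 * T.+1 + 1) (linear_star 4 T.+1)) : V :=
  match z with inl c => g' c | inr (P, k) => el P k end.
have finj : injective f.
  move=> [c|[P k]] [d|[Q l]] /= E.
  - by rewrite (g'inj _ _ E).
  - by have := elK Q l; rewrite -E g'core.
  - by have := elK P k; rewrite E g'core.
  have PQ : P = Q.
    apply/eqP; apply: contraT => /BB2 D; have := disjointFr D (elB P k).
    by rewrite E elB.
  rewrite PQ in E *; congr (inr (_, _)); apply: val_inj => /=.
  by move: E => /eqP; rewrite /el nth_uniq ?enum_uniq -?cardE ?cB // => /eqP.
apply/existsP; exists (finfun f); apply/andP; split.
  by apply/injectiveP => z z'; rewrite !ffunE; apply: finj.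
apply/forall_inP => e eE.
rewrite (eq_imset (g := f)); last by move=> z; rewrite ffunE.
move: eE; rewrite inE => /orP [/imsetP [e1 /imsetP [e2 /imsetP [i _ ->] ->] ->]|/imsetP [P _ ->]].
  rewrite -!imset_comp (eq_imset (g := g)) //; exact: gedge.
have [L _] := BB1 P; move: L; rewrite inE => /andP [_].
rewrite (_ : f @: ext_edge 4 P = p P :|: BB P) //.
rewrite /ext_edge imsetU -imset_comp; congr (_ :|: _).
apply/setP => w; apply/imsetP/idP => [[z /imsetP [k _ ->] ->]|wB]; first exact: elB.
have wlt : index w (enum (BB P)) < 4 - 2 by rewrite -[4 - 2]/2 -(cB P) cardE index_mem mem_enum.
exists (inr (P, Ordinal wlt)); first by apply: imset_f.
by rewrite /= /el nth_index ?mem_enum.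
Qed.

End Embedding.

(** * Consequences of not containing the extension *)

Section FreeGraphs.
Import Order.TTheory GRing.Theory Num.Theory.
Variables (V : finType) (T : nat) (G : {set {set V}}).
Implicit Types (e S : {set V}) (M : {set {set V}}).

(** Counts the vertices to be avoided: [3 T + 4] of the star, four of an extra edge, and two for
    each pair still to be joined. *)
Definition rich_codegree : nat :=
  3 * T + 8 + 2 * #|{: uncovered_pair (3 * T.+1 + 1) (linear_star 4 T.+1)}|.

Hypotheses (uG : uniform 4 G)
  (freeG : ~~ contains G (extension 4 (3 * T.+1 + 1) (linear_star 4 T.+1))).

Lemma star_card v M : star_config T.+1 G v M -> #|v |: cover M| <= 3 * T + 4.
Proof.
move=> [ML tM cM]; have uM := uniform_sub ML (link_uniform v uG).
have [_ cC] : cover M \subset [set: V] /\ #|cover M| = (#|M| * 3)%N.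
  by apply: cover_card => //; apply/subsetP => e _; rewrite inE subsetT.
apply: leq_trans (leq_card_setU _ _) _; rewrite cards1 cC cM; lia.
Qed.

Lemma free_star v M a b (h : bool) e0 : star_config T.+1 G v M ->
  (h -> [/\ a != b, e0 \in G, a \in e0, b \in e0 & e0 :&: (v |: cover M) \subset [set a; b]]) ->
  (forall u w, u \in v |: cover M -> w \in v |: cover M -> u != w ->
     ~~ (h && ([set u; w] == [set a; b])) -> rich_codegree * #|V| < #|link G [set u; w]|) -> False.
Proof.
move=> conf exc rich; move/negP: freeG; apply.
apply: (@embed_extension _ T G v M a b h (if h then e0 else set0) uG conf).
  by case: h exc {rich}.
move=> u w uK wK uw hh; apply: leq_ltn_trans (rich u w uK wK uw hh).
rewrite leq_mul2r; apply/orP; right; rewrite leq_add2r.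
apply: leq_trans (leq_card_setU _ _) _.
have ce : #|if h then e0 else set0| <= 4.
  by case: h exc {rich hh} => [/(_ isT) [_ /(forall_inP uG) /eqP -> _ _ _]|_] //; rewrite cards0.
by apply: leq_trans (leq_add (star_card conf) ce) _; rewrite -addnA.
Qed.

(** Pairs covered in [G'] have large codegree in [G], so a star of [G'] with all pairs covered would
    extend in [G]. *)
Lemma KFfree_free (G' : {set {set V}}) : G' \subset G ->
  (forall e u w, e \in G' -> u \in e -> w \in e -> u != w ->
    rich_codegree * #|V| < #|link G [set u; w]|) -> KFfree T.+1 G'.
Proof.
move=> G'G clean v M [ML tM cM].
have conf : star_config T.+1 G v M.
  split=> //; apply: subset_trans ML _; apply/subsetP => e.
  by rewrite !mem_link1 => /andP [-> /(subsetP G'G)].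
have [/existsP [u /existsP [w /and4P [uK wK uw nc]]]|no] := boolP [exists u, exists w,
  [&& u \in v |: cover M, w \in v |: cover M, u != w & ~~ covered G' u w]].
  by exists u, w.
case: (@free_star v M v v false set0 conf) => // u w uK wK uw _.
have : covered G' u w.
  apply: contraT => nc; case/negP: no; apply/existsP; exists u; apply/existsP; exists w.
  by rewrite uK wK uw nc.
by move=> /existsP [e /and3P [eG ue we]]; apply: clean eG ue we uw.
Qed.

Local Open Scope ring_scope.

Lemma lam_const (R : realFieldType) k (c : R) (L : {set {set V}}) : uniform k L ->
  lam (fun=> c) L = c ^+ k * #|L|%:R.
Proof.
move=> uL; rewrite /lam (eq_bigr (fun=> c ^+ k)).
  by rewrite sumr_const mulr_natr.
by move=> e /(forall_inP uL) /eqP ek; rewrite /wt prodr_const ek.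
Qed.

(** For constant weight [c] a weighted codegree is [c ^+ 2] times the number of completing pairs, so
    [kap] translates into the threshold of [free_star]. *)
Lemma norich_free (R : realFieldType) (c kap : R) : 0 <= c ->
  c ^+ 2 * (rich_codegree * #|V|)%:R < kap -> norich T G (fun=> c) kap true.
Proof.
move=> c0 small v M a b conf aK bK ab hab rich.
have rich' u w : u != w -> kap <= cod (fun=> c) G u w -> (rich_codegree * #|V| < #|link G [set u; w]|)%N.
  move=> uw; rewrite /cod (lam_const _ (link_uniform2 uG uw)) => h.
  rewrite ltnNge; apply/negP => le; have : c ^+ 2 * #|link G [set u; w]|%:R < kap.
    by apply: le_lt_trans small; rewrite ler_wpM2l ?exprn_ge0 // ler_nat.
  by rewrite ltNge h.
case: hab => [hab|[e0 e0G [ae be /(_ isT) eK]]].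
  apply: (@free_star v M a b false set0 conf) => // u w uK wK uw _; apply: rich' => //.
  have [E|ne] := eqVneq [set u; w] [set a; b]; last exact: rich.
  by rewrite /cod E.
by apply: (@free_star v M a b true e0 conf) => // u w uK wK uw /= ne; apply: rich' => //; apply: rich.
Qed.

End FreeGraphs.

(** * Balanced partitions are unique up to relabelling *)

Lemma fibre_bijection (V : finType) (X : eqType) (a b : V -> X) :
  (forall i, #|[set v | a v == i]| = #|[set v | b v == i]|) ->
  exists2 f : V -> V, injective f & forall v, b (f v) = a v.
Proof.
move=> E; pose A i := enum [set v | a v == i]; pose B i := enum [set v | b v == i].
pose f v := nth v (B (a v)) (index v (A (a v))).
have idx v : index v (A (a v)) < size (B (a v)).
  by rewrite /B -cardE -E cardE index_mem mem_enum inE.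
have fb v : b (f v) = a v.
  have : f v \in B (a v) by apply: mem_nth; apply: idx.
  by rewrite mem_enum inE => /eqP.
exists f => // v w fE; have avw : a v = a w by rewrite -!fb fE.
have := idx v; have := idx w; move: fE; rewrite /f avw => fE iw iv.
move: fE; rewrite (set_nth_default w) // => /eqP; rewrite nth_uniq ?enum_uniq // => /eqP.
have mem u : a u = a w -> u \in A (a w) by move=> uw; rewrite mem_enum inE uw.
by move=> vw; rewrite -(nth_index v (mem v avw)) vw nth_index // mem.
Qed.

Definition balanced (C : finType) (a : C -> nat) := forall i j, a i <= (a j).+1.

(** Only the minimum and its successor occur as values, so division with remainder of the sum
    recovers the values and how often each occurs. *)
Lemma balanced_value (C : finType) (a : C -> nat) i : balanced a -> 0 < #|C| ->
  let n := \sum_j a j in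
  (a i = n %/ #|C| \/ a i = (n %/ #|C|).+1) /\ #|[set j | a j == (n %/ #|C|).+1]| = n %% #|C|.
Proof.
move=> bal C0 n; pose i0 := [arg min_(j < i) a j].
have [low] : (forall j, a i0 <= a j) /\ True.
  by split=> // j; rewrite /i0; case: arg_minnP => // k _; apply.
move=> _; have val j : a j = a i0 + (a j == (a i0).+1).
  have := low j; have := bal j i0; case: eqP; lia.
have nE : n = a i0 * #|C| + #|[set j | a j == (a i0).+1]|.
  rewrite /n (eq_bigr (fun j => a i0 + (a j == (a i0).+1))) // big_split /= sum_nat_const mulnC.
  by congr addn; rewrite -sum1dep_card [RHS]big_mkcond; apply: eq_bigr => j _; case: eqP.
have lt : #|[set j | a j == (a i0).+1]| < #|C|.
  rewrite -cardsT; apply: proper_card; rewrite properE subsetT /=.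
  by apply/subsetPn; exists i0; rewrite !inE //; lia.
have -> : n %/ #|C| = a i0 by rewrite nE divnMDl // divn_small ?addn0.
split; first by rewrite (val i); case: eqP; [right|left]; lia.
by rewrite nE modnMDl modn_small.
Qed.

Lemma balanced_perm (C : finType) (a b : C -> nat) : balanced a -> balanced b ->
  \sum_j a j = \sum_j b j -> exists2 p : C -> C, injective p & forall i, b (p i) = a i.
Proof.
move=> ba bb E; apply: fibre_bijection => k.
have [C0|C0] := posnP #|C|.
  by apply: eq_card => i; have := card0_eq C0 i; rewrite !inE.
have [i0 _] := card_gt0P C0.
set q := (\sum_j a j) %/ #|C|; set r := (\sum_j a j) %% #|C|.
have aux (c : C -> nat) : balanced c -> \sum_j c j = \sum_j a j ->
    #|[set i | c i == k]| = if k == q then #|C| - r else if k == q.+1 then r else 0.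
  move=> bc cE; have val i := balanced_value i bc C0; rewrite /= cE -/q -/r in val.
  case: eqP => [->|kq].
    rewrite cardsCs -(val i0).2; congr (_ - _); apply: eq_card => i; rewrite !inE.
    by have [[->|->] _] := val i; rewrite ?eqxx; apply/eqP/eqP; lia.
  case: eqP => [->|kq1]; first by rewrite (val i0).2.
  apply: eq_card0 => i; rewrite !inE; apply/eqP.
  by have [[->|->] _] := val i; lia.
by rewrite (aux a) // (aux b).
Qed.

(** * Part sizes and the number of rainbow 4-sets *)

Section Colourings.
Import Order.TTheory GRing.Theory Num.Theory.
Local Open Scope ring_scope.
Variables (V C : finType).
Implicit Types (chi tau : V -> C) (y : C -> rat).

Definition part chi i : nat := #|[set v | chi v == i]|.

Lemma pw_part chi i : pw (fun=> 1 : rat) chi i = (part chi i)%:R.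
Proof.
rewrite /pw /tot sumr_const; congr (_%:R); apply: eq_card => v.
by rewrite !inE.
Qed.

Lemma sum_part chi : (\sum_i part chi i)%N = #|V|.
Proof.
rewrite -sum1_card (partition_big chi predT) //=; apply: eq_bigr => i _.
by rewrite /part -sum1dep_card.
Qed.

Lemma card_rbow chi k D : #|rbow chi k D|%:R = elsym (fun i => (part chi i)%:R : rat) D k.
Proof.
transitivity (lam (fun=> 1 : rat) (rbow chi k D)).
  by rewrite (lam_const _ (uniform_rbow _ _ _)) expr1n mul1r.
rewrite lam_rbow; apply: eq_bigr => e _; apply: eq_wt => i _; exact: pw_part.
Qed.

Lemma elsym_pos y D k : (forall i, 0 <= y i) -> 0 < elsym y D k.+1 -> 0 < elsym y D k.
Proof.
move=> y0; rewrite !lt_neqAle !elsym_ge0 // !andbT eq_sym => pos; rewrite eq_sym.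
move: pos; rewrite /elsym /lam psumr_neq0; last by move=> e _; apply: wt_ge0.
move=> /hasP [e _ /andP []]; rewrite inE => /andP [eD /eqP ek] e0.
have [i ie] : exists i, i \in e by apply/card_gt0P; rewrite ek.
rewrite psumr_neq0; last by move=> f _; apply: wt_ge0.
apply/hasP; exists (e :\ i); first by rewrite mem_index_enum.
rewrite inE (subset_trans (subD1set e i) eD) /=.
have -> : #|e :\ i| == k by move: ek; rewrite (cardsD1 i e) ie add1n => -[->].
rewrite lt_neqAle wt_ge0 // andbT eq_sym.
move: e0; rewrite -{1}(setD1K ie) wtU1 ?setD11 // lt_neqAle eq_sym mulf_eq0 negb_or.
by move=> /andP [/andP []].
Qed.

Lemma elsym_two y i j k : i != j -> elsym y [set: C] k.+2 =
  elsym y (~: [set i; j]) k.+2 + (y i + y j) * elsym y (~: [set i; j]) k.+1 +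
  y i * y j * elsym y (~: [set i; j]) k.
Proof.
move=> ij; have jS : j \in [set: C] :\ i by rewrite !inE eq_sym ij.
rewrite (elsymS _ _ (in_setT i)) !(elsymS _ _ jS).
have -> : ([set: C] :\ i) :\ j = ~: [set i; j].
  by apply/setP => l; rewrite !inE negb_or andbT andbC.
by ring.
Qed.

(** Let part [j] have size [p] and part [i] size [q + 1]. Moving a vertex from [i] to [j] gains
    [q - p] times the second elementary symmetric function of the other part sizes. That function is
    positive: otherwise those of order 3 and 4 would vanish too, and there would be no rainbow
    4-set. *)
Lemma recolour chi i j : ((part chi j).+1 < part chi i)%N -> (0 < #|rbow chi 4 [set: C]|)%N ->
  exists chi', (#|rbow chi 4 [set: C]| < #|rbow chi' 4 [set: C]|)%N.
Proof.
move=> ij; have ne : i != j by apply: contraTneq ij => ->; rewrite -leqNgt.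
have [v] : exists v, v \in [set v | chi v == i].
  by apply/card_gt0P; move: ij; rewrite /part; clear; lia.
rewrite inE => /eqP cv; rewrite -(ltr0n rat) card_rbow => pos.
pose chi' w := if w == v then j else chi w.
exists chi'; rewrite -(ltr_nat rat) !card_rbow.
have pi : part chi i = (part chi' i).+1.
  rewrite /part (cardsD1 v) inE cv eqxx add1n; congr _.+1; apply: eq_card => w.
  by rewrite !inE /chi'; case: eqP => //= _; rewrite eq_sym (negPf ne).
have pj : part chi' j = (part chi j).+1.
  rewrite /part (cardsD1 v) inE /chi' eqxx eqxx add1n; congr _.+1; apply: eq_card => w.
  by rewrite !inE; case: eqP => //= ->; rewrite cv (negPf ne).
have pk k : k \in ~: [set i; j] -> part chi' k = part chi k.
  rewrite !inE negb_or => /andP [ki kj]; apply: eq_card => w; rewrite !inE /chi'.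
  by have [->|//] := eqVneq w v; rewrite cv (eq_sym j) (eq_sym i) (negPf ki) (negPf kj).
have same l : elsym (fun i => (part chi' i)%:R : rat) (~: [set i; j]) l =
              elsym (fun i => (part chi i)%:R : rat) (~: [set i; j]) l.
  apply: eq_lam => e; rewrite inE => /andP [/subsetP eS _] k ke.
  by rewrite pk // eS.
rewrite !(elsym_two _ _ ne) !same in pos *.
set e2 := elsym _ _ 2 in pos *; set e3 := elsym _ _ 3 in pos *; set e4 := elsym _ _ 4 in pos *.
have y0 k : 0 <= (part chi k)%:R :> rat by apply: ler0n.
have e2pos : 0 < e2.
  rewrite lt_neqAle elsym_ge0 // andbT; apply: contraTneq pos => e20.
  have e30 : e3 = 0.
    apply: le_anti; rewrite elsym_ge0 // andbT leNgt; apply/negP => /elsym_pos h.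
    by have := h y0; rewrite -/e2 -e20 ltxx.
  have e40 : e4 = 0.
    apply: le_anti; rewrite elsym_ge0 // andbT leNgt; apply/negP => /elsym_pos h.
    by have := h y0; rewrite -/e3 e30 ltxx.
  by rewrite e40 e30 -e20 !mulr0 !addr0 ltxx.
rewrite pj pi -2!natr1.
have : (part chi j)%:R + 1 <= (part chi' i)%:R :> rat.
  by rewrite natr1 ler_nat; move: ij; rewrite pi.
move: (part chi j)%:R (part chi' i)%:R => p q pq.
rewrite -subr_gt0.
rewrite (_ : _ - _ = (q - p) * e2); last by ring.
by rewrite mulr_gt0 //; move: pq; clear; lra.
Qed.

Lemma elsym_const (c : rat) (D : {set C}) k : elsym (fun=> c) D k = 'C(#|D|, k)%:R * c ^+ k.
Proof.
rewrite /elsym (lam_const (k := k)); first by rewrite cards_draws mulrC.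
by apply/forall_inP => e; rewrite inE => /andP [].
Qed.

Lemma rbow_iso chi tau (p : C -> C) (f : V -> V) k : injective f -> injective p ->
  (forall v, tau (f v) = p (chi v)) ->
  isomorphic (rbow chi k [set: C]) (rbow tau k [set: C]).
Proof.
move=> finj pinj fE; exists f; first exact: injF_bij.
have [g fK gK] := injF_bij finj.
have key (e : {set V}) : (f @: e \in rbow tau k [set: C]) = (e \in rbow chi k [set: C]).
  have cf : #|f @: e| = #|e| by apply: card_imset.
  rewrite !inE cf -!imset_comp !subsetT /=; congr (_ && (_ == _)).
  rewrite (eq_imset (g := p \o chi)); last by move=> v; apply: fE.
  by rewrite imset_comp card_imset.
apply/setP => e; apply/idP/imsetP => [et|[e' h ->]]; last by rewrite key.
exists (g @: e); last first.
  by rewrite -imset_comp (eq_imset (g := id)) ?imset_id // => v /=; rewrite gK.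
rewrite -key -imset_comp (eq_imset (g := id)) ?imset_id // => v /=; exact: gK.
Qed.

Lemma balanced_iso chi tau k : balanced (part chi) -> balanced (part tau) ->
  isomorphic (rbow chi k [set: C]) (rbow tau k [set: C]).
Proof.
move=> bc bt; have [p pinj pE] : exists2 p : C -> C, injective p & forall i, part tau (p i) = part chi i.
  by apply: balanced_perm; rewrite ?sum_part.
have [f finj fE] : exists2 f : V -> V, injective f & forall v, tau (f v) = p (chi v).
  apply: (fibre_bijection (a := fun v => p (chi v))) => i.
  have [q pK qK] := injF_bij pinj.
  rewrite -/(part tau i) -(qK i) pE; apply: eq_card => v.
  by rewrite !inE (inj_eq pinj).
exact: rbow_iso finj pinj fE.
Qed.

Lemma isomorphic_card (W W' : finType) (G : {set {set W}}) (H : {set {set W'}}) :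
  isomorphic G H -> #|G| = #|H|.
Proof. by move=> [f /bij_inj finj ->]; rewrite card_imset //; apply: imset_inj. Qed.

(** By [recolour], a colouring with the largest positive number of rainbow 4-sets is balanced, and
    all balanced colourings give isomorphic hypergraphs. *)
Lemma rbow_max tau chi : balanced (part tau) ->
  (#|rbow chi 4 [set: C]| <= #|rbow tau 4 [set: C]|)%N /\
  (#|rbow chi 4 [set: C]| = #|rbow tau 4 [set: C]| -> (0 < #|rbow tau 4 [set: C]|)%N ->
   isomorphic (rbow chi 4 [set: C]) (rbow tau 4 [set: C])).
Proof.
move=> bt; pose w (c : {ffun V -> C}) := #|rbow c 4 [set: C]|.
have wE c : w (finfun c) = #|rbow c 4 [set: C]|.
  rewrite /w; apply: eq_card => e; rewrite !inE (eq_imset (g := c)) // => v.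
  by rewrite ffunE.
have bal (c : {ffun V -> C}) : (forall c', (w c' <= w c)%N) -> (0 < w c)%N -> balanced (part c).
  move=> mx c0 i j; rewrite leqNgt; apply/negP => /recolour /(_ c0) [c'].
  by rewrite -(wE c') ltnNge mx.
have bound c' : (w c' <= #|rbow tau 4 [set: C]|)%N.
  have [c mx] : exists c, forall c', (w c' <= w c)%N.
    by exists [arg max_(c > c' | true) w c] => c1; case: arg_maxnP => // c _; apply.
  have [c0|c0] := posnP (w c); first by apply: leq_trans (mx c') _; rewrite c0.
  by apply: leq_trans (mx c') _; rewrite /w (isomorphic_card (balanced_iso 4 (bal c mx c0) bt)).
split=> [|E pos]; first by rewrite -wE bound.
apply: balanced_iso => //.
have := bal (finfun chi); rewrite wE E => /(_ _ pos) b i j.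
have pE k : part (finfun chi) k = part chi k.
  by apply: eq_card => v; rewrite !inE ffunE.
by rewrite -!pE; apply: b => c'; apply: bound.
Qed.

End Colourings.

(** * The Turan hypergraph: freeness and density *)

Section Turan.
Import Order.TTheory GRing.Theory Num.Theory.
Local Open Scope ring_scope.

Definition residue (m n : nat) (v : 'I_n) : 'I_m.+1 := inord (v %% m.+1).

Lemma residueE m n (v : 'I_n) : residue m v = (v %% m.+1)%N :> nat.
Proof. by rewrite inordK // ltn_mod. Qed.

Lemma turan_rbow r m n : turan r m.+1 n = rbow (residue m (n := n)) r [set: 'I_m.+1].
Proof.
apply/setP => e; rewrite inE; apply/andP/rbowP => [[/eqP er h]|[er _ inj]].
  split=> // u v ue ve E; have /forall_inP/(_ v ve) := forall_inP h u ue.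
  by rewrite -!residueE E eqxx => /eqP.
split; first exact/eqP.
apply/forall_inP => u ue; apply/forall_inP => v ve; apply/implyP => E.
by apply/eqP/inj => //; apply: val_inj; rewrite /= !residueE; apply/eqP.
Qed.

Lemma balanced_residue m n : balanced (part (residue m (n := n))).
Proof.
move=> i j; have E k : part (residue m (n := n)) k = #|[set v : 'I_n | v %% m.+1 == k]|%N.
  by apply: eq_card => v; rewrite !inE -val_eqE /= residueE.
by rewrite !E; apply: turan_parts.
Qed.

(** There are [3 T + 4] core vertices and [3 T + 3] parts, so two core vertices share a part; yet
    any two of them lie in a common edge of the extension. *)
Lemma turan_free T n :
  ~~ contains (turan 4 (3 * T.+1) n) (extension 4 (3 * T.+1 + 1) (linear_star 4 T.+1)).
Proof.
apply/negP => /existsP [f /andP [/injectiveP finj /forall_inP fe]].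
pose W := star_vertex 4 T.+1.
have tE : turan 4 (3 * T.+1) n = rbow (residue (3 * T + 2) (n := n)) 4 [set: _].
  by rewrite -turan_rbow; have -> : (3 * T.+1 = (3 * T + 2).+1)%N by clear; lia.
pose res (w : W) : 'I_(3 * T + 2).+1 := residue (3 * T + 2) (f (inl (inl w))).
have ninj : ~~ injectiveb res.
  apply/negP => /injectiveP /leq_card; rewrite card_ord (card_star_vertex 4 T.+1) /=.
  by clear; lia.
have [w [w' [ww' E]]] : exists w w', w != w' /\ res w = res w'.
  move: ninj; rewrite /injectiveb /dinjectiveb => /injectivePn [w [w' ww' E]].
  by exists w, w'.
have key e : e \in turan 4 (3 * T.+1) n -> f (inl (inl w)) \in e -> f (inl (inl w')) \in e -> False.
  rewrite tE => /rbowP [_ _ inj] we w'e; have := inj _ _ we w'e E.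
  by move=> /finj [] ww; rewrite ww eqxx in ww'.
pose P : {set core (3 * T.+1 + 1) W} := [set inl w; inl w'].
have cP : #|P| == 2 by rewrite cards2 eqSS eqb1; apply: contra ww' => /eqP [->].
have [/existsP [e /andP [eE /subsetP Pe]]|unc] := boolP [exists e in core_edges (3 * T.+1 + 1) (linear_star 4 T.+1), P \subset e].
  apply: (key (f @: [set inl v | v in e])).
  - by apply: fe; rewrite inE; apply/orP; left; apply: imset_f.
  - by apply: imset_f; apply: imset_f; apply: Pe; rewrite !inE eqxx.
  by apply: imset_f; apply: imset_f; apply: Pe; rewrite !inE eqxx orbT.
have uP : uncovered (linear_star 4 T.+1) P by rewrite /uncovered cP.
apply: (key (f @: ext_edge 4 (Sub P uP))).
- by apply: fe; rewrite inE; apply/orP; right; apply: imset_f.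
- by apply: imset_f; rewrite inE; apply/orP; left; apply: imset_f; rewrite SubK !inE eqxx.
by apply: imset_f; rewrite inE; apply/orP; left; apply: imset_f; rewrite SubK !inE eqxx orbT.
Qed.

(** Put [m = 3 T + 3]. Every part has at least [q = n %/ m] vertices, which gives at least
    ['C(m, 4) * q ^ 4] edges, and [m q >= n - m]. *)
Lemma turan_card_ge T n : (3 * T + 3 <= n)%N ->
  deg0 rat T / 4 - deg0 rat T * (3 * T + 3)%:R / n%:R <=
  #|turan 4 (3 * T + 3) n|%:R / n%:R ^+ 4.
Proof.
move=> mn; have mE : (3 * T + 3 = (3 * T + 2).+1)%N by lia.
have m0 : 0 < (3 * T + 3)%:R :> rat by rewrite ltr0n; lia.
have n0 : 0 < n%:R :> rat by rewrite ltr0n; lia.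
rewrite {2}mE turan_rbow card_rbow.
set q := (n %/ (3 * T + 3))%N.
have partq i : (q <= part (residue (3 * T + 2) (n := n)) i)%N.
  have C0 : (0 < #|'I_(3 * T + 2).+1|)%N by rewrite card_ord.
  have [+ _] := balanced_value i (@balanced_residue (3 * T + 2) n) C0.
  rewrite sum_part !card_ord; move: (part _ _) => z; rewrite -mE -/q; clear; lia.
have low : 'C(3 * T + 3, 4)%:R * q%:R ^+ 4 <=
    elsym (fun i => (part (residue (3 * T + 2) (n := n)) i)%:R : rat) [set: _] 4.
  have cT : #|[set: 'I_(3 * T + 2).+1]| = (3 * T + 3)%N by rewrite cardsT card_ord mE.
  rewrite -cT -elsym_const.
  apply: ler_sum => e _; apply: le_wt => i; rewrite ler0n /= ler_nat; exact: partq.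
rewrite ler_pdivlMr ?exprn_gt0 //; apply: le_trans low.
have -> : 'C(3 * T + 3, 4)%:R = deg0 rat T / 4 * (3 * T + 3)%:R ^+ 4.
  by rewrite -mac4E /mac divfK // expf_neq0 // lt0r_neq0.
have d0 := deg0_ge0 rat T.
have qn : n%:R <= (3 * T + 3)%:R * q%:R + (3 * T + 3)%:R :> rat.
  rewrite -natrM -natrD ler_nat; have := divn_eq n (3 * T + 3); have := ltn_pmod n (_ : 0 < 3 * T + 3)%N.
  by rewrite -/q; move=> /(_ _) h; nia.
have mn' : (3 * T + 3)%:R <= n%:R :> rat by rewrite ler_nat.
have q0 : 0 <= q%:R :> rat := ler0n _ _.
move: (deg0 rat T) (3 * T + 3)%:R (n%:R : rat) (q%:R : rat) d0 m0 n0 qn mn' q0 => d m N p d0 m0 N0 qn mN p0.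
rewrite (_ : _ * N ^+ 4 = d / 4 * ((N - 4 * m) * N ^+ 3)); last by field; apply: lt0r_neq0.
rewrite -[leRHS]mulrA; apply: ler_wpM2l; first by rewrite divr_ge0.
rewrite -exprMn; apply: le_trans (_ : (N - m) ^+ 4 <= _).
  rewrite -subr_ge0 (_ : _ - _ = m ^+ 2 * (6 * N ^+ 2 - 4 * N * m + m ^+ 2)); last by ring.
  by rewrite mulr_ge0 ?sqr_ge0 //; clear -mN m0 N0; nra.
by apply: lerXn2r; rewrite ?nnegrE ?mulr_ge0 ?subr_ge0 ?(ltW m0) // lerBlDr.
Qed.

End Turan.

(** * Deleting edges through pairs of small codegree *)

Section Cleaning.
Import Order.TTheory GRing.Theory Num.Theory.
Local Open Scope ring_scope.
Variables (R : realFieldType) (V : finType).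
Implicit Types (e : {set V}) (G : {set {set V}}).

Definition clean G k := [set e in G | [forall u in e, forall w in e,
  (u != w) ==> (k < #|link G [set u; w]|)%N]].

(** Each of the at most [#|V| ^ 2] ordered poor pairs destroys edges of weight at most
    [c ^+ 4 * k]. *)
Lemma lam_clean G k (c : R) : uniform 4 G -> 0 <= c -> c * #|V|%:R = 1 ->
  lam (fun=> c) G - c ^+ 2 * k%:R <= lam (fun=> c) (clean G k).
Proof.
move=> uG c0 cV; pose x := (fun=> c) : V -> R; have x0 v : 0 <= x v by [].
rewrite lerBlDr (lamID (fun=> c) G (fun e => [forall u in e, forall w in e,
  (u != w) ==> (k < #|link G [set u; w]|)%N])) lerD2l.
set B := [set e in G | _].
pose poor (p : V * V) := (p.1 != p.2) && (#|link G [set p.1; p.2]| <= k)%N.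
apply: le_trans (_ : \sum_(p | poor p) \sum_(e in G | [set p.1; p.2] \subset e) wt x e <= _).
  rewrite (exchange_big_dep (mem G)) /=; last by move=> p e _ /andP[].
  rewrite [leRHS](big_setID B) /= (_ : G :&: B = B); last first.
    by apply/setIidPr/subsetP => e; rewrite inE => /andP[].
  rewrite -[leLHS]addr0; apply: lerD; last first.
    by apply: sumr_ge0 => e _; apply: sumr_ge0 => p _; apply: wt_ge0.
  apply: ler_sum => e; rewrite inE => /andP [eG].
  rewrite negb_forall_in => /exists_inP [u ue]; rewrite negb_forall_in => /exists_inP [w we].
  rewrite negb_imply -leqNgt => uw.
  rewrite (bigD1 (u, w)) /=; last by rewrite /poor uw eG subUset !sub1set ue we.
  by rewrite lerDl; apply: sumr_ge0 => p _; apply: wt_ge0.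
apply: le_trans (_ : \sum_(p : V * V) c ^+ 4 * k%:R <= _).
  rewrite [leRHS](bigID poor) /= -[leLHS]addr0; apply: lerD; last first.
    by apply: sumr_ge0 => p _; rewrite mulr_ge0 ?exprn_ge0.
  apply: ler_sum => p /andP [ne pk]; rewrite sum_link (lam_const _ (link_uniform2 uG ne)).
  rewrite /wt prodr_const cards2 ne mulrA -exprD.
  by rewrite ler_wpM2l ?exprn_ge0 // ler_nat.
rewrite sumr_const (_ : #|_| = #|V| * #|V|)%N; last by rewrite card_prod.
rewrite -[X in X <= _]mulr_natr natrM (_ : _ * _ = c ^+ 2 * k%:R * (c * #|V|%:R) ^+ 2); last by ring.
by rewrite cV expr1n mulr1.
Qed.

End Cleaning.

(** * Excluding vertices of low degree *)

Section LowDegree.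
Import Order.TTheory GRing.Theory Num.Theory.
Local Open Scope ring_scope.

Lemma deg0_bin (R : realFieldType) T : deg0 R T = 'C(3 * T + 2, 3)%:R / (3 * T%:R + 3) ^+ 3.
Proof.
have m0 : (3 * T%:R + 3 : R) != 0.
  by apply: lt0r_neq0; have T0 : 0 <= T%:R :> R := ler0n _ _; lra.
have E : 6 * 'C(3 * T + 2, 3)%:R = 3 * T%:R * (3 * T%:R + 1) * (3 * T%:R + 2) :> R.
  have : (3`! * 'C(3 * T + 2, 3) = 3 * T * (3 * T).+1 * (3 * T).+2)%N.
    by rewrite mulnC bin_ffact addn2 !ffactnS ffactn0 /=; ring.
  move=> /(congr1 (fun k => k%:R : R)); rewrite !natrM => ->.
  by rewrite -(natr1 (3 * T).+1) -(natr1 (3 * T)) natrM; ring.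
have -> : 'C(3 * T + 2, 3)%:R = 3 * T%:R * (3 * T%:R + 1) * (3 * T%:R + 2) / 6 :> R.
  by rewrite -E; field.
by rewrite /deg0; field.
Qed.

(** The rainbow hypergraph of [chi] contains all edges of [G] off [Z]. In it each vertex of [Z],
    whatever its colour, has degree at least [deg0 - eta1 / 2] from edges otherwise avoiding [Z],
    against less than [deg0 - eta1] in [G]. If [Z] had positive weight, the rainbow hypergraph would
    be heavier than [G]. *)
Lemma no_low_degree (V C : finType) T (G : {set {set V}}) (x : V -> rat) (chi : V -> C)
    (eta1 th z : rat) (Z := [set v | deg x G v < deg0 rat T - eta1]) :
  (0 < T)%N -> uniform 4 G -> (forall v, 0 <= x v) -> tot x [set: V] = 1 ->
  #|C| = (3 * T + 3)%N -> 0 < eta1 ->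
  (forall e u w, e \in G -> u \in e -> w \in e -> u \notin Z -> w \notin Z ->
     chi u = chi w -> u = w) ->
  tot x Z <= z -> deg0 rat T / 4 - z <= lam x G ->
  0 <= th -> 2 * z <= deg0 rat T / 4 * th ^+ 2 -> (th + z) * (3 * T%:R + 3) <= 1 ->
  (th + z) * (3 * T%:R + 3) <= eta1 -> lam x (rbow chi 4 [set: C]) <= lam x G ->
  tot x Z = 0 /\ [set e in G | [disjoint e & Z]] \subset rbow chi 4 [set: C].
Proof.
move=> T0 uG x0 W1 cC e10 prop Zz near th0 small1 small2 small3 TG.
have d0 := deg0_ge0 rat T; have d1 := deg0_le rat T.
set D := deg0 rat T in Z prop Zz near small1 d0 d1 *.
have zZ : 0 <= tot x Z by apply: tot_ge0.
pose GX := [set e in G | [disjoint e & Z]].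
have GXr : GX \subset rbow chi 4 [set: C].
  apply/subsetP => e; rewrite inE => /andP [eG eZ]; apply/rbowP; split.
  - exact/eqP/(forall_inP uG).
  - by move=> v _; rewrite inE.
  by move=> u w ue we; apply: (prop e) => //; rewrite (disjointFr eZ).
split=> //.
have upper : lam x G <= tot x Z * (D - eta1) + lam x GX.
  apply: le_trans (lam_hit G Z x0) _; rewrite lerD2r /tot mulr_suml.
  by apply: ler_sum => v; rewrite inE => h; rewrite ler_wpM2l // ltW.
have near2 : D / 4 - D / 4 * th ^+ 2 <= elsym (pw x chi) [set: C] 4.
  rewrite -lam_rbow; apply: le_trans (lamS x0 GXr).
  have : tot x Z * (D - eta1) <= z.
    apply: le_trans Zz; rewrite ler_piMr //.
    by move: d1 e10; clear; lra.
  by move: upper near small1; clear; move: (_ * (D - eta1)) (_ * th ^+ 2) (lam x GX) (lam x G) => p q r s; lra.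
have parts i : (3 * T%:R + 3)^-1 - th <= pw x chi i.
  by apply: balance_low near2 => // [j|]; rewrite ?tot_pw //; apply: pw_ge0.
(* Removing [Z] from the weight, so that only triples off [Z] are counted below. *)
pose x' v := if v \in Z then 0 else x v.
have x'0 v : 0 <= x' v by rewrite /x'; case: ifP.
have parts' i : (3 * T%:R + 3)^-1 - (th + z) <= pw x' chi i.
  have : pw x chi i <= pw x' chi i + tot x Z.
    rewrite /pw /tot [leLHS](bigID (mem Z)) /= addrC lerD //.
      by rewrite [leRHS](bigID (mem Z)) /= [X in _ <= X + _]big1 ?add0r; [apply: ler_sum => v /andP [_ vZ]; rewrite /x' (negPf vZ)|move=> v /andP [_ vZ]; rewrite /x' vZ].
    rewrite [leRHS](bigID (mem (chi @^-1: [set i]))) /= (eq_bigl (fun v => (v \in Z) && (v \in chi @^-1: [set i]))).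
      by rewrite lerDl sumr_ge0.
    by move=> v; rewrite andbC.
  by move: (parts i) Zz; clear; lra.
have m0 : 0 < (3 * T%:R + 3 : rat) by have T0' : 0 <= T%:R :> rat := ler0n _ _; lra.
set s := th + z in small2 small3 parts'.
have degT i : D - eta1 / 2 <= lam x' (rbow chi 3 ([set: C] :\ i)).
  rewrite lam_rbow; apply: le_trans (_ : elsym (fun=> (3 * T%:R + 3)^-1 - s) ([set: C] :\ i) 3 <= _); last first.
    apply: ler_sum => e _; apply: le_wt => j; rewrite parts' andbT subr_ge0.
    by rewrite -[leRHS]div1r ler_pdivlMr.
  rewrite elsym_const (_ : #|_| = 3 * T + 2)%N; last first.
    by have := cardsD1 i [set: C]; rewrite cardsT cC in_setT; clear; lia.
  have -> : 'C(3 * T + 2, 3)%:R = D * (3 * T%:R + 3) ^+ 3.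
    by rewrite /D deg0_bin divfK // expf_neq0 // lt0r_neq0.
  rewrite -mulrA -exprMn mulrBr mulfV ?lt0r_neq0 // [_ * s]mulrC.
  move: e10 small2 small3 d0 d1; clear -s; move: (s * _) => u e10 u1 ue d0 d1.
  have [u0|u0] := lerP u 0.
    have h : 1 <= (1 - u) ^+ 3 by rewrite exprn_ege1 //; lra.
    by have := ler_wpM2l d0 h; lra.
  have h : 1 - 3 * u <= (1 - u) ^+ 3.
    rewrite -subr_ge0 (_ : _ - _ = u ^+ 2 * (3 - u)); last by ring.
    by rewrite mulr_ge0 ?sqr_ge0 //; lra.
  have := ler_wpM2l d0 h; rewrite mulrBr mulr1.
  have : D * (3 * u) <= 1 / 6 * (3 * u) by rewrite ler_wpM2r //; lra.
  by move: (D * (3 * u)) (D * _) => p q; lra.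
have lower : lam x GX + tot x Z * (D - eta1 / 2) <= lam x (rbow chi 4 [set: C]).
  rewrite [leRHS](lamID x _ (fun e => [disjoint e & Z])); apply: lerD.
    apply: lamS => //; apply/subsetP => e eX; rewrite inE (subsetP GXr) //=.
    by move: eX; rewrite inE => /andP[].
  (* Rainbow edges with exactly one vertex in [Z], grouped by that vertex; the families are
     disjoint, so nothing is counted twice. *)
  pose F v := [set v |: f | f in [set f in rbow chi 3 ([set: C] :\ chi v) | (v \in Z) && [disjoint f & Z]]].
  apply: le_trans (_ : \sum_v lam x (F v) <= _).
    rewrite /tot mulr_suml [leRHS](bigID (mem Z)) /= -[leLHS]addr0.
    apply: lerD; last by apply: sumr_ge0 => v _; apply: lam_ge0.
    apply: ler_sum => v vZ; rewrite /lam big_imset /=; last first.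
      move=> f g; rewrite !inE => /and3P [_ _ fZ] /and3P [_ _ gZ] E.
      by rewrite -(setU1K (_ : v \notin f)) ?E ?setU1K ?(disjointFl fZ) ?(disjointFl gZ).
    rewrite (eq_bigr (fun f => x v * wt x f)); last first.
      by move=> f; rewrite inE => /and3P [_ _ fZ]; rewrite wtU1 // (disjointFl fZ).
    rewrite -mulr_sumr ler_wpM2l //; apply: le_trans (degT (chi v)) _.
    rewrite (lamID x' _ (fun e => [disjoint e & Z])) [X in _ + X]big1 ?addr0.
      rewrite vZ /= (eq_lam (y := x)) // => f; rewrite inE => /andP [_ fZ] w wf.
      by rewrite /x' (disjointFr fZ).
    move=> f; rewrite inE => /andP [_ /pred0Pn [w /andP [wf wZ]]].
    have wZ' : w \in Z by [].
    by have wf' : w \in f by []; rewrite /wt (bigD1 w) //= /x' wZ' mul0r.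
  rewrite -[leRHS]/(\sum_(e in _) wt x e).
  set B := [set e in _ | _].
  have Fdis u v : u != v -> [disjoint F u & F v].
    move=> uv; rewrite -setI_eq0 -subset0; apply/subsetP => e; rewrite inE => /andP [].
    move=> /imsetP [f fF ->] /imsetP [g gF E]; move: fF gF; rewrite inE => /and3P [_ uZ _]; rewrite inE => /and3P [_ _ gZ].
    have : u \in v |: g by rewrite -E setU11.
    by rewrite in_setU1 (negPf uv) (disjointFl gZ uZ).
  have FB : \bigcup_v F v \subset B.
    apply/bigcupsP => v _; apply/subsetP => e /imsetP [f]; rewrite inE => /and3P [fr vZ fZ] ->.
    rewrite inE; apply/andP; split.
      by move: fr; rewrite -(link_rbow _ (in_setT _)) mem_link1 => /andP[].
    by apply/negP => dj; have := disjointFr dj (setU11 v f); rewrite vZ.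
  by apply: le_trans (lamS x0 FB); rewrite [leRHS]partition_disjoint_bigcup.
apply: le_anti; rewrite zZ andbT leNgt; apply/negP => Zpos.
have : 0 < tot x Z * (eta1 / 2) by rewrite mulr_gt0 // divr_gt0.
have := le_trans lower (le_trans TG upper).
rewrite !mulrBr; move: (tot x Z * D) (lam x GX) => p q; clear -p.
by rewrite mulrA; lra.
Qed.

End LowDegree.

(** * The extremal result for large orders *)

Section Main.
Import Order.TTheory GRing.Theory Num.Theory.
Local Open Scope ring_scope.

Lemma mul_inv_le (a b c : rat) n : 0 < b -> a / b <= n%:R -> c * n%:R = 1 -> 0 <= c -> a * c <= b.
Proof.
move=> b0; rewrite ler_pdivrMr // => h cn c0.
have := ler_wpM2r c0 h; rewrite mulrAC [n%:R * c]mulrC cn mul1r; exact.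
Qed.

(** With [T = t - 1], assuming only that [G] has at least as many edges as the Turan hypergraph
    yields both the extremal number and the uniqueness. *)
Lemma extremal T : (0 < T)%N -> exists n0 : nat, forall n, (n0 <= n)%N ->
  forall G : {set {set 'I_n}}, uniform 4 G ->
  ~~ contains G (extension 4 (3 * T.+1 + 1) (linear_star 4 T.+1)) ->
  (#|turan 4 (3 * T.+1) n| <= #|G|)%N ->
  #|G| = #|turan 4 (3 * T.+1) n| /\ isomorphic G (turan 4 (3 * T.+1) n).
Proof.
move=> T0; have t1 : 1 <= T%:R :> rat by rewrite ler1n.
have [eta1 [kap [xh [eta [etaS [[e10 kap0 xh0 eta0 ext] [eS0 eSe stab]]]]]]] := stability T0.
move: stab; rewrite (addnS (3 * T) 2) => stab.
have D0 : 0 < deg0 rat T.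
  by rewrite /deg0 divr_gt0 ?mulr_gt0 ?exprn_gt0 //; lra.
have d1 := deg0_le rat T.
have [M ME] : exists M, M = 3 * T%:R + 3 :> rat by eexists.
have M0 : 0 < M by rewrite ME; move: t1; clear; lra.
have [D DE] : exists D, D = deg0 rat T by eexists.
rewrite -DE in D0 d1 stab.
(* As [z <= th] will hold, [2 * th] bounds the sum [th + z] that occurs in [no_low_degree]. *)
have [th [th0 th1 thM thE]] : exists th : rat, [/\ 0 < th, th <= 1, 2 * th * M <= 1 & 2 * th * M <= eta1].
  exists (Num.min 1 eta1 / (2 * M)).
  have mn0 : 0 < Num.min 1 eta1 by rewrite lt_min ltr01.
  have M1 : 1 <= M by rewrite ME; move: t1; clear; lra.
  have E : 2 * (Num.min 1 eta1 / (2 * M)) * M = Num.min 1 eta1.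
    by field; apply: lt0r_neq0.
  rewrite E !ge_min !lexx ?orbT; split=> //.
    by rewrite divr_gt0 // mulr_gt0.
  rewrite ler_pdivrMr ?mulr_gt0 // mul1r ge_min; apply/orP; left.
  by move: M1; clear; lra.
have [z [z0 zth zD zs]] : exists z : rat, [/\ 0 < z, z <= th, 2 * z <= D / 4 * th ^+ 2 & 8 * z <= D].
  exists (D * th ^+ 2 / 8); have t2 : 0 < th ^+ 2 by rewrite exprn_gt0.
  have t2' : th ^+ 2 <= th by rewrite expr2 ler_piMr // ltW.
  have h : D * th ^+ 2 <= th ^+ 2 by rewrite ler_piMl ?(ltW t2) //; move: d1; clear; lra.
  have h2 : D * th ^+ 2 <= D by rewrite ler_piMr ?(ltW D0) //; move: t2' th1; clear; lra.
  split; first by rewrite divr_gt0 // mulr_gt0.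
  - by move: h t2' t2; clear; move: (th ^+ 2) (D * th ^+ 2) => p q; lra.
  - by rewrite le_eqVlt; apply/orP; left; apply/eqP; field.
  by move: h2; clear; move: (D * th ^+ 2) => p; lra.
have [ep [ep0 epS epz epe]] : exists ep : rat, [/\ 0 < ep, ep <= etaS, ep <= z & 2 * ep / eta1 <= z].
  exists (Num.min (Num.min etaS z) (eta1 * z / 2)).
  rewrite !lt_min eS0 z0 divr_gt0 ?mulr_gt0 //; split=> //.
  - by rewrite !ge_min lexx.
  - by rewrite !ge_min lexx orbT.
  rewrite ler_pdivrMr // [z * _]mulrC.
  have : Num.min (Num.min etaS z) (eta1 * z / 2) <= eta1 * z / 2 by rewrite ge_min lexx orbT.
  by move: (eta1 * z) (Num.min _ _); clear => p q; lra.
pose K := rich_codegree T.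
(* Each summand makes one error of order [1/n] small: the density of the Turan hypergraph together
   with the cleaning, the codegree threshold against [kap], and the weight of an edge against [xh].
   The last one gives every part a vertex. *)
have [A AE] : exists A, A = (D * M + K%:R) / ep + (K%:R + 1) / kap + 4 / xh + M by eexists.
have K0 : 0 <= K%:R :> rat := ler0n _ _.
have A1 : 0 <= (D * M + K%:R) / ep by rewrite divr_ge0 ?addr_ge0 ?mulr_ge0 // ltW.
have A2 : 0 <= (K%:R + 1) / kap by rewrite divr_ge0 ?addr_ge0 // ltW.
have A3 : 0 <= 4 / xh by rewrite divr_ge0 // ltW.
have A0 : 0 <= A by rewrite AE !addr_ge0 // ltW.
exists (Num.bound A) => n nA G uG free big.
have {}nA : A <= n%:R.
  by apply: ltW; apply: lt_le_trans (archi_boundP A0) _; rewrite ler_nat.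
have nM : M <= n%:R by move: A1 A2 A3 nA; rewrite AE; clear; lra.
have n0 : 0 < n%:R :> rat by apply: lt_le_trans nM.
have [c cE] : exists c : rat, c = n%:R^-1 by eexists.
have c0 : 0 <= c by rewrite cE invr_ge0 ltW.
have cn : c * n%:R = 1 by rewrite cE mulVf // lt0r_neq0.
have b1 : (D * M + K%:R) * c <= ep.
  by apply: (mul_inv_le (n := n)) => //; move: A2 A3 nA M0; rewrite AE; clear; lra.
have b2 : (K%:R + 1) * c <= kap.
  by apply: (mul_inv_le (n := n)) => //; move: A1 A3 nA M0; rewrite AE; clear; lra.
have b3 : 4 * c <= xh.
  by apply: (mul_inv_le (n := n)) => //; move: A1 A2 nA M0; rewrite AE; clear; lra.
have cpos : 0 < c by rewrite cE invr_gt0.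
pose x : 'I_n -> rat := fun=> c.
have x0 v : 0 <= x v by [].
have W1 : tot x [set: 'I_n] = 1 by rewrite /tot sumr_const cardsT card_ord -[LHS]mulr_natr.
pose tau := residue (3 * T + 2) (n := n).
have tE k : k = (3 * T + 2).+1 -> turan 4 k n = rbow tau 4 [set: _] by move=> ->; apply: turan_rbow.
have tE1 : turan 4 (3 * T.+1) n = rbow tau 4 [set: _] by apply: tE; clear; lia.
have tE2 : turan 4 (3 * T + 3) n = rbow tau 4 [set: _] by apply: tE; clear; lia.
rewrite tE1 in big *.
have rmax chi := rbow_max chi (@balanced_residue (3 * T + 2) n); rewrite -/tau in rmax.
have TG (chi : 'I_n -> 'I_(3 * T + 2).+1) : lam x (rbow chi 4 [set: _]) <= lam x G.
  rewrite (lam_const _ uG) (lam_const _ (uniform_rbow _ _ _)) ler_wpM2l ?exprn_ge0 // ler_nat.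
  by apply: leq_trans big; have [] := rmax chi.
have Tlow : D / 4 - D * M * c <= lam x (rbow tau 4 [set: _]).
  rewrite (lam_const _ (uniform_rbow _ _ _)) [leRHS]mulrC cE exprVn DE ME.
  have := @turan_card_ge T n; rewrite tE2 natrD natrM; apply.
  by move: nM; rewrite ME -natrM -natrD ler_nat.
have Glow := le_trans Tlow (TG tau).
pose k := (K * #|'I_n|)%N.
have kE : c ^+ 2 * k%:R = K%:R * c.
  by rewrite /k card_ord natrM mulrCA expr2 -mulrA cn mulr1.
pose G' := clean G k.
have G'G : G' \subset G by apply/subsetP => e; rewrite inE => /andP[].
have uG' := uniform_sub G'G uG.
have G'low : D / 4 - ep <= lam x G'.
  have := lam_clean k uG c0; rewrite card_ord kE => /(_ cn); rewrite -/G' -/x => h.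
  by move: h Glow b1; rewrite mulrDl; clear; move: (D * M * c) (K%:R * c) (lam _ _) (lam _ _) => p q r s; lra.
have kf : KFfree T.+1 G'.
  apply: (KFfree_free uG free G'G) => e u w; rewrite inE => /andP [_ /forall_inP h] ue we uw.
  by have /forall_inP /(_ w we) := h u ue; rewrite uw.
have [psi psiE] : exists psi : 'I_n -> 'I_(3 * T + 2).+1, D / 4 - eta / 2 <= lam x (cross G' psi).
  apply: stab => //; apply: le_trans G'low.
  by rewrite lerD2l lerN2.
have cC : #|'I_(3 * T + 2).+1| = (3 * T + 3)%N by rewrite card_ord; clear; lia.
(* [psi] was found for the cleaned hypergraph, but the extension is applied to [G] itself, so that
   [chi] controls every edge of [G] between vertices of high degree. Edges of [G] may contain pairs
   of small codegree, hence the flag [true]. *)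
have [chi prop] : exists chi : 'I_n -> 'I_(3 * T + 2).+1, forall e u w, e \in G -> u \in e -> w \in e ->
    D - eta1 <= deg x G u -> D - eta1 <= deg x G w -> chi u = chi w -> u = w.
  rewrite DE; apply: (ext _ _ G x psi true) => //.
  - apply: norich_free => //; rewrite kE; move: b2; rewrite mulrDl mul1r.
    by move: cpos; clear; move: (K%:R * c) => p; lra.
  - move=> e0 /(forall_inP uG) /eqP e4 _; apply: le_trans b3.
    by rewrite /tot sumr_const e4 -[leLHS]mulr_natl.
  rewrite -DE; apply: le_trans (_ : lam x (cross G' psi) <= _).
    by apply: le_trans psiE; move: eta0; clear; lra.
  by apply: lamS => //; apply: setSI.
pose Z := [set v | deg x G v < D - eta1].
have Zz : tot x Z <= z.
  apply: le_trans epe; have e2 : ep < eta1 ^+ 2 by apply: le_lt_trans eSe.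
  have l0 : 0 <= D / 4 <= 1 / 24 by move: D0 d1; clear; lra.
  have bd (y : 'I_n -> rat) : (forall v, 0 <= y v) -> lam y G' <= D / 4 * tot y [set: 'I_n] ^+ 4.
    by rewrite DE; apply: kf_bound.
  apply: le_trans (low_degree uG' bd l0 ep0 e10 e2 x0 W1 G'low).
  apply: totS => //; apply/subsetP => v; rewrite !inE mulrC divfK //.
  apply: le_lt_trans; apply: lamS => //; apply/subsetP => e; rewrite !mem_link1 => /andP [-> /=].
  exact: (subsetP G'G).
have [Z0 sub] : tot x Z = 0 /\ [set e in G | [disjoint e & Z]] \subset rbow chi 4 [set: _].
  have := @no_low_degree _ _ T G x chi eta1 th z T0 uG x0 W1 cC e10; rewrite -DE -ME -/Z.
  apply=> //.
  - move=> e u w eG ue we; rewrite !inE -!leNgt => hu hw; exact: (prop e).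
  - by apply: le_trans Glow; move: b1 epz K0 c0; clear -ep; rewrite mulrDl => h1 h2 h3 h4; have := mulr_ge0 h3 h4; lra.
  - exact: ltW.
  - by have := ler_wpM2r (ltW M0) zth; rewrite mulrDl; move: thM; clear; rewrite -mulrA mulr_natl mulr2n; lra.
  by have := ler_wpM2r (ltW M0) zth; rewrite mulrDl; move: thE; clear; rewrite -mulrA mulr_natl mulr2n; lra.
have {}Z0 : Z = set0.
  apply/eqP; rewrite -subset0; apply/subsetP => v vZ.
  by have := le_tot x0 vZ; rewrite Z0 leNgt cpos.
have GT : G \subset rbow chi 4 [set: _].
  by apply: subset_trans sub; apply/subsetP => e eG; rewrite inE eG Z0 -setI_eq0 setI0 eqxx.
have [le iso] := rmax chi.
have GE : G = rbow chi 4 [set: _].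
  by apply/eqP; rewrite eqEcard GT (leq_trans le big).
have cardE : #|G| = #|rbow tau 4 [set: _]|.
  by apply/eqP; rewrite eqn_leq big {1}GE le.
split=> //; rewrite GE; apply: iso; first by rewrite -GE.
rewrite lt0n; apply/negP => /eqP E.
move: Tlow; rewrite (lam_const _ (uniform_rbow _ _ _)) E mulr0.
have := mulr_ge0 K0 c0; move: b1 epz zs D0; rewrite mulrDl; clear.
by move: (D * M * c) (K%:R * c) => p q; lra.
Qed.

End Main.

Theorem theorem4p19 (t : nat) (ht : 2 <= t) :
  (exists n0 : nat, forall n : nat, n0 <= n ->
     ex_number 4 n (extension 4 (3 * t + 1) (linear_star 4 t))
       = #|turan 4 (3 * t) n|) /\
  (exists n0 : nat, forall n : nat, n0 <= n ->
     forall G : {set {set 'I_n}},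
       uniform 4 G ->
       ~~ contains G (extension 4 (3 * t + 1) (linear_star 4 t)) ->
       #|G| = #|turan 4 (3 * t) n| ->
       isomorphic G (turan 4 (3 * t) n)).
Proof.
(* The hypothesis [2 <= t] becomes [0 < T] for [t = T + 1]. *)
case: t ht => // T T1; have [n0 ext] := @extremal T T1.
split; exists n0 => n nn0; last first.
  by move=> G uG free E; have [] := ext n nn0 G uG free; rewrite ?E.
apply/eqP; rewrite eqn_leq; apply/andP; split.
  apply/bigmax_leqP => G /andP [uG free]; rewrite leqNgt; apply/negP => lt.
  by have [E _] := ext n nn0 G uG free (ltnW lt); rewrite E ltnn in lt.
apply: (bigmax_sup (turan 4 (3 * T.+1) n)) => //; rewrite turan_free andbT.
by apply/forall_inP => e; rewrite inE => /andP[].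
Qed.
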